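(* Let $\phi_1$ and $\phi_2$ be holomorphic self-maps of $\mathbb{D}$. The sequences $(C_{\phi_1^n})_n$, $(C_{\phi_2^n})_n$ admit a disjointly $\mathcal{B}$-universal Blaschke product if and only if all of the following hold: $\phi_1\neq\phi_2$; each of $\phi_1$ and $\phi_2$ is either a parabolic or a hyperbolic automorphism of the disc (not necessarily both of the same type); and in case $\phi_1$ and $\phi_2$ are both of hyperbolic type and have the same attractive point, their multipliers are different.
   Context: $\mathbb{D}=\{z\in\mathbb{C}:|z|<1\}$, and $\phi^n$ denotes the $n$-th iterate of $\phi$. $\mathcal{B}=\{f\in H(\mathbb{D}):\sup_{z\in\mathbb{D}}|f(z)|\le 1\}$ with the topology of uniform convergence on compact subsets of $\mathbb{D}$. For $\phi:\mathbb{D}\to\mathbb{D}$ holomorphic, $C_\phi(f)=f\circ\phi$ is the composition operator, so $C_\phi^n=C_{\phi^n}$, and it maps $\mathcal{B}$ into itself. A function $f\in\mathcal{B}$ is disjointly $\mathcal{B}$-universal for $(C_{\phi_1^n})_n,(C_{\phi_2^n})_n$ if $\{(f\circ\phi_1^n,f\circ\phi_2^n):n\in\mathbb{N}\}$ is dense in $\mathcal{B}\times\mathcal{B}$ with the product topology. An automorphism of $\mathbb{D}$ is parabolic if it is not the identity and has exactly one fixed point in $\overline{\mathbb{D}}$, lying on the unit circle; it is hyperbolic if it has exactly two fixed points in $\overline{\mathbb{D}}$, both on the unit circle, one attractive and one repelling. The multiplier of a hyperbolic automorphism is the number $\lambda>1$ such that, conjugating by a linear fractional map of $\mathbb{D}$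 onto the upper half plane that sends the attractive point to $\infty$ and the repelling point to $0$, the automorphism becomes $z\mapsto\lambda z$. *)

(* Defs.v *)
From Stdlib Require Export Reals List.
From Coquelicot Require Export Coquelicot.

(* Functions on the disc are total functions C -> C of which only the values
   on the disc matter: every definition below looks at them on [disc] only. *)

Definition disc (z : C) : Prop := (Cmod z < 1)%R.

Definition eq_on_disc (f g : C -> C) : Prop := forall z, disc z -> f z = g z.

Definition holomorphic_on_disc (f : C -> C) : Prop :=
  forall z, disc z -> ex_derive (K := C_AbsRing) (V := C_NormedModule) f z.

Definition holomorphic_self_map (phi : C -> C) : Prop :=
  holomorphic_on_disc phi /\ (forall z, disc z -> disc (phi z)).

Definition iterate (phi : C -> C) (n : nat) : C -> C :=
  fun z => Nat.iter n phi z.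

Definition unit_ball (f : C -> C) : Prop :=
  holomorphic_on_disc f /\ (forall z, disc z -> (Cmod (f z) <= 1)%R).

Definition compact (K : C -> Prop) : Prop :=
  forall (I : Type) (U : I -> C -> Prop),
    (forall i, open (T := C_UniformSpace) (U i)) ->
    (forall z, K z -> exists i, U i z) ->
    exists l : list I, forall z, K z -> exists i, In i l /\ U i z.

(* [ucc_locally f] is the filter of neighbourhoods of [f]. *)
Definition ucc_locally (f : C -> C) (P : (C -> C) -> Prop) : Prop :=
  exists (K : C -> Prop) (eps : posreal),
    compact K /\ (forall z, K z -> disc z) /\
    forall g : C -> C,
      (forall z, K z -> (Cmod (g z - f z) < eps)%R) -> P g.

(* [S] is dense in [unit_ball] x [unit_ball] for the product topology;
   meant for sets [S] contained in [unit_ball] x [unit_ball]. *)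
Definition dense_in_ball_square (S : (C -> C) * (C -> C) -> Prop) : Prop :=
  forall g1 g2 : C -> C, unit_ball g1 -> unit_ball g2 ->
  forall P : (C -> C) * (C -> C) -> Prop,
    filter_prod (ucc_locally g1) (ucc_locally g2) P ->
    exists p, S p /\ P p.

Definition composition_operator (phi f : C -> C) : C -> C :=
  fun z => f (phi z).

Definition disjointly_universal (phi1 phi2 f : C -> C) : Prop :=
  unit_ball f /\
  dense_in_ball_square (fun p => exists n : nat,
    p = (composition_operator (iterate phi1 n) f,
         composition_operator (iterate phi2 n) f)).

Definition blaschke_factor (a z : C) : C :=
  ((RtoC (Cmod a) / a) * ((a - z) / (1 - Cconj a * z)))%C.

Fixpoint Cprod (u : nat -> C) (n : nat) : C :=
  match n with
  | O => RtoC 1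
  | S k => (Cprod u k * u k)%C
  end.

(* The zeros of the product are 0, with multiplicity [m], and the [a]'s. *)
Definition finite_blaschke_product (f : C -> C) : Prop :=
  exists (c : C) (m N : nat) (a : nat -> C),
    Cmod c = 1%R /\
    (forall n, (n < N)%nat -> disc (a n) /\ a n <> RtoC 0) /\
    (forall z, disc z ->
      f z = (c * z ^ m * Cprod (fun n => blaschke_factor (a n) z) N)%C).

Definition infinite_blaschke_product (f : C -> C) : Prop :=
  exists (c : C) (m : nat) (a : nat -> C),
    Cmod c = 1%R /\
    (forall n, disc (a n) /\ a n <> RtoC 0) /\
    ex_series (fun n => (1 - Cmod (a n))%R) /\
    (forall z, disc z ->
      filterlim
        (fun N => (c * z ^ m * Cprod (fun n => blaschke_factor (a n) z) N)%C)
        eventually (locally (T := C_UniformSpace) (f z))).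

Definition blaschke_product (f : C -> C) : Prop :=
  finite_blaschke_product f \/ infinite_blaschke_product f.

Definition inverse_on_disc (phi psi : C -> C) : Prop :=
  holomorphic_self_map psi /\
  (forall z, disc z -> psi (phi z) = z) /\
  (forall z, disc z -> phi (psi z) = z).

Definition automorphism (phi : C -> C) : Prop :=
  holomorphic_self_map phi /\ exists psi, inverse_on_disc phi psi.

(* [p] is a fixed point of the continuous extension of [phi] to the closed
   disc. The filter [within disc (locally p)] contains [p] itself when [p] is
   in the open disc, where the limit therefore means [phi p = p]. *)
Definition fixed_point (phi : C -> C) (p : C) : Prop :=
  (Cmod p <= 1)%R /\
  filterlim phi (within disc (locally (T := C_UniformSpace) p))
                (locally (T := C_UniformSpace) p).

Definition attractive (phi : C -> C) (p : C) : Prop :=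
  fixed_point phi p /\
  forall z, disc z ->
    filterlim (fun n => iterate phi n z) eventually
              (locally (T := C_UniformSpace) p).

Definition repelling (phi : C -> C) (p : C) : Prop :=
  exists psi, inverse_on_disc phi psi /\ attractive psi p.

Definition parabolic (phi : C -> C) : Prop :=
  automorphism phi /\ ~ eq_on_disc phi (fun z => z) /\
  exists p, Cmod p = 1%R /\ (forall q, fixed_point phi q <-> q = p).

Definition hyperbolic_with (phi : C -> C) (a b : C) : Prop :=
  automorphism phi /\ Cmod a = 1%R /\ Cmod b = 1%R /\ a <> b /\
  (forall q, fixed_point phi q <-> q = a \/ q = b) /\
  attractive phi a /\ repelling phi b.

Definition hyperbolic (phi : C -> C) : Prop :=
  exists a b, hyperbolic_with phi a b.

Definition linear_fractional (al be ga de z : C) : C :=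
  ((al * z + be) / (ga * z + de))%C.

Definition upper_half_plane (w : C) : Prop := (0 < Im w)%R.

Definition maps_disc_onto_half_plane (al be ga de : C) : Prop :=
  (al * de - be * ga)%C <> RtoC 0 /\
  (forall z, disc z -> (ga * z + de)%C <> RtoC 0 /\
                       upper_half_plane (linear_fractional al be ga de z)) /\
  (forall w, upper_half_plane w ->
     exists z, disc z /\ linear_fractional al be ga de z = w).

(* The attractive point goes to infinity (the denominator vanishes there) and
   the repelling point to 0. *)
Definition is_multiplier (phi : C -> C) (lambda : R) : Prop :=
  (1 < lambda)%R /\
  exists a b, hyperbolic_with phi a b /\
  exists al be ga de : C,
    maps_disc_onto_half_plane al be ga de /\
    (ga * a + de)%C = RtoC 0 /\ (al * b + be)%C = RtoC 0 /\
    (forall z, disc z ->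
       linear_fractional al be ga de (phi z) =
       (RtoC lambda * linear_fractional al be ga de z)%C).

(* Main.v *)
Require Import Defs.
From Stdlib Require Import Lra Lia Psatz Classical ClassicalEpsilon.
From Stdlib Require Cantor.

(** Write [rho] for the pseudo-hyperbolic distance. By the Schwarz-Pick lemma no
    function bounded by one and no holomorphic self-map increases it.

    Necessity. If [f o phi^n], with [n > 0], is close to the identity (or its
    opposite), then [phi] cannot have decreased any distance, so it is an
    isometry of [rho], hence a Moebius automorphism ([universal_isometry],
    [isometry_mobius]). It has no fixed point in the disc, since [f o phi^n]
    would be constant there. Then one fixed point lies on the circle. With that
    point at infinity in the right half-plane, [phi] becomes an affine map
    [s |-> mu s + i tau], and a suitable choice of the point makes it attracting
    ([attracting_form_exists]): [mu = 1] is the parabolic case and [mu > 1] the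
    hyperbolic case with multiplier [mu]. If both maps have the same attracting
    point and the same multiplier, the distance between [phi1^n 0] and
    [phi2^n 0] is at most some [c < 1] ([same_form_bounded]), so [f] cannot be
    close to [0] at one and to [1] at the other.

    Sufficiency. In all other cases [phi1^n 0] and [phi2^n 0] move arbitrarily
    far from the origin and from each other ([orbits_separate]). The hyperbolic
    discs around these three points can then be told apart by a holomorphic
    function [chi] bounded by one, nearly [1] on one and nearly [-1] on another;
    the weights [((1 + chi) / 2)^2] and [((1 - chi) / 2)^2] combine two functions
    of the unit ball into one that follows the first or the second
    ([three_targets]). So there is a function of the unit ball that is nearly [1]
    on a large disc around the origin, while its compositions with [phi1^n] and
    [phi2^n] are near two prescribed functions. By the Schur-Nevanlinna algorithm
    it may be replaced by a finite Blaschke product ([bprod_approximation]). An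
    infinite product of such blocks converges to a Blaschke product. Each block
    compensates the effect of the earlier ones, which are nearly unimodular
    constants on the distant discs ([next_block]), and the later ones are nearly
    [1] there. As the prescribed pairs run through a countable dense set and each
    recurs infinitely often, the product is universal
    ([block_sequence_universal]).

    The function theory rests on Goursat's theorem. It gives the mean value
    property and from it the maximum principle, for functions that are continuous
    on the disc and differentiable off a finite set ([max_principle]). In that
    class a zero can be divided out ([schwarz_division]), which is the step of
    the Schwarz-Pick lemma and of the Schur-Nevanlinna algorithm. The algorithm
    interpolates at distinct nodes, because the class records no differentiability
    at a node already used; its outcome is a rational function with modulus tending to one at the
    circle, and the maximum principle factors it ([inner_factorization]). *)

Local Open Scope R_scope.

(** * Complex numbers *)

Lemma Cmod_sqr (z : C) : Cmod z ^ 2 = Re z ^ 2 + Im z ^ 2.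
Proof. exact (Cmod2_alt z). Qed.

Lemma Cmod_le_sqr (z w : C) : Cmod z ^ 2 <= Cmod w ^ 2 -> Cmod z <= Cmod w.
Proof.
  intros H. pose proof (Cmod_ge_0 z). pose proof (Cmod_ge_0 w).
  destruct (Rle_lt_dec (Cmod z) (Cmod w)); [assumption | nra].
Qed.

Lemma Cmod_sub_sym (z w : C) : Cmod (z - w)%C = Cmod (w - z)%C.
Proof. rewrite <- (Cmod_opp (z - w)%C). f_equal. ring. Qed.

Lemma Cmod_triangle_sub (z w : C) : Cmod (z - w)%C <= Cmod z + Cmod w.
Proof. unfold Cminus. rewrite <- (Cmod_opp w). apply Cmod_triangle. Qed.

Lemma Cmod_triangle_rev (z w : C) : Cmod z - Cmod w <= Cmod (z - w)%C.
Proof.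
  pose proof (Cmod_triangle (z - w)%C w) as H.
  replace (z - w + w)%C with z in H by ring. lra.
Qed.

Lemma Cmod_triangle_mid (z w v : C) :
  Cmod (z - v)%C <= Cmod (z - w)%C + Cmod (w - v)%C.
Proof. replace (z - v)%C with ((z - w) + (w - v))%C by ring. apply Cmod_triangle. Qed.

Lemma Cmod_pos (z : C) : z <> RtoC 0 -> 0 < Cmod z.
Proof. intros H. now apply Cmod_gt_0. Qed.

Lemma Cmod_pos_neq (z : C) : 0 < Cmod z -> z <> RtoC 0.
Proof. intros H. now apply Cmod_gt_0. Qed.

Lemma Csub_eq_0 (z w : C) : (z - w)%C = RtoC 0 -> z = w.
Proof. intros H. replace z with ((z - w) + w)%C by ring. rewrite H. ring. Qed.

Lemma Csub_neq_0 (z w : C) : z <> w -> (z - w)%C <> RtoC 0.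
Proof. intros H E. apply H. now apply Csub_eq_0. Qed.

Lemma Cmod_sub_0 (z w : C) : Cmod (z - w)%C = 0 -> z = w.
Proof. intros H. apply Csub_eq_0. now apply Cmod_eq_0. Qed.

Lemma im_le_Cmod (z : C) : Rabs (Im z) <= Cmod z.
Proof.
  pose proof (Rmax_Cmod z) as H. pose proof (Rmax_r (Rabs (fst z)) (Rabs (snd z))).
  unfold Im. lra.
Qed.

Lemma Re_le_Cmod (z : C) : Re z <= Cmod z.
Proof. pose proof (re_le_Cmod z). pose proof (Rle_abs (Re z)). lra. Qed.

Lemma Cmod_le_Re_Im (z : C) : Cmod z <= Rabs (Re z) + Rabs (Im z).
Proof.
  pose proof (Cmod_sqr z) as H. pose proof (Cmod_ge_0 z).
  pose proof (Rabs_pos (Re z)). pose proof (Rabs_pos (Im z)).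
  rewrite <- (pow2_abs (Re z)), <- (pow2_abs (Im z)) in H.
  destruct (Rle_lt_dec (Cmod z) (Rabs (Re z) + Rabs (Im z))); [assumption | nra].
Qed.

Lemma Cmod_conj_mul (z : C) : (Cconj z * z)%C = RtoC (Cmod z ^ 2).
Proof.
  rewrite Cmult_comm, <- Cmod2_conj. now rewrite RtoC_pow.
Qed.

Lemma Cconj_unit (u : C) : Cmod u = 1 -> (Cconj u * u)%C = RtoC 1.
Proof. intros H. rewrite Cmod_conj_mul, H. f_equal. ring. Qed.

Lemma Cmod_RtoC_pos (x : R) : 0 <= x -> Cmod (RtoC x) = x.
Proof. intros H. rewrite Cmod_R. now apply Rabs_pos_eq. Qed.

Lemma Cconj_RtoC (x : R) : Cconj (RtoC x) = RtoC x.
Proof. unfold Cconj, RtoC. simpl. f_equal. ring. Qed.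

Lemma RtoC_m1 : RtoC (-1) = (- RtoC 1)%C.
Proof. unfold RtoC, Copp. simpl. f_equal; ring. Qed.

(** The identity behind the invariance of the pseudo-hyperbolic distance. *)
Lemma Cmod_one_sub_conj_mul (a z : C) :
  Cmod (1 - Cconj a * z)%C ^ 2 - Cmod (z - a)%C ^ 2
  = (1 - Cmod a ^ 2) * (1 - Cmod z ^ 2).
Proof.
  rewrite !Cmod_sqr. destruct a as [a1 a2], z as [z1 z2]. simpl. ring.
Qed.

Lemma disc_sqr (z : C) : disc z -> 0 < 1 - Cmod z ^ 2.
Proof. unfold disc. intros H. pose proof (Cmod_ge_0 z). nra. Qed.

Lemma Cmod_one_sub_conj_mul_ge (a z : C) :
  1 - Cmod a * Cmod z <= Cmod (1 - Cconj a * z)%C.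
Proof.
  pose proof (Cmod_triangle_rev (RtoC 1) (Cconj a * z)%C) as H.
  rewrite Cmod_1, Cmod_mult, Cmod_conj in H. exact H.
Qed.

Lemma Cmod_mul_lt_1 (a z : C) : Cmod a <= 1 -> disc z -> Cmod a * Cmod z < 1.
Proof. unfold disc. intros. pose proof (Cmod_ge_0 a). pose proof (Cmod_ge_0 z). nra. Qed.

Lemma one_sub_conj_mul_pos (a z : C) :
  Cmod a <= 1 -> disc z -> 0 < Cmod (1 - Cconj a * z)%C.
Proof.
  intros Ha Hz. pose proof (Cmod_one_sub_conj_mul_ge a z).
  pose proof (Cmod_mul_lt_1 a z Ha Hz). lra.
Qed.

Lemma one_sub_conj_mul_neq (a z : C) :
  Cmod a <= 1 -> disc z -> (1 - Cconj a * z)%C <> RtoC 0.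
Proof. intros. apply Cmod_pos_neq. now apply one_sub_conj_mul_pos. Qed.

Lemma disc_0 : disc (RtoC 0).
Proof. unfold disc. rewrite Cmod_0. lra. Qed.

(** * Continuity and complex differentiability at a point *)

Definition ccont (f : C -> C) (z : C) : Prop :=
  forall eps, 0 < eps -> exists del, 0 < del /\
  forall w, Cmod (w - z)%C < del -> Cmod (f w - f z)%C < eps.

(** Differentiability through a slope function that is continuous at [z]:
    sums, products and compositions then reduce to algebra, and dividing a zero
    out of a function costs nothing, as the quotient is the slope itself. *)
Definition cdiff (f : C -> C) (z : C) : Prop :=
  exists q, ccont q z /\ forall w, (f w - f z = q w * (w - z))%C.

Lemma ccont_local (f g : C -> C) (z : C) (r : R) :
  0 < r -> (forall w, Cmod (w - z)%C < r -> f w = g w) -> ccont f z -> ccont g z.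
Proof.
  intros Hr H Hf eps He. destruct (Hf eps He) as [del [Hd K]].
  exists (Rmin del r). split; [now apply Rmin_pos |].
  intros w Hw. rewrite <- !H.
  - apply K. eapply Rlt_le_trans; [exact Hw | apply Rmin_l].
  - replace (z - z)%C with (RtoC 0) by ring. rewrite Cmod_0. exact Hr.
  - eapply Rlt_le_trans; [exact Hw | apply Rmin_r].
Qed.

Lemma ccont_const (c z : C) : ccont (fun _ => c) z.
Proof.
  intros eps He. exists 1. split; [lra |]. intros w _.
  replace (c - c)%C with (RtoC 0) by ring. now rewrite Cmod_0.
Qed.

Lemma ccont_id (z : C) : ccont (fun w => w) z.
Proof. intros eps He. exists eps. auto. Qed.

Lemma ccont_bounded (f : C -> C) (z : C) :
  ccont f z -> exists del, 0 < del /\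
  forall w, Cmod (w - z)%C < del -> Cmod (f w) < Cmod (f z) + 1.
Proof.
  intros H. destruct (H 1 Rlt_0_1) as [d [Hd K]]. exists d. split; [exact Hd |].
  intros w Hw. pose proof (Cmod_triangle_rev (f w) (f z)). specialize (K w Hw). lra.
Qed.

Lemma ccont_plus (f g : C -> C) (z : C) :
  ccont f z -> ccont g z -> ccont (fun w => f w + g w)%C z.
Proof.
  intros Hf Hg eps He.
  destruct (Hf (eps / 2)) as [d1 [H1 K1]]; [lra |].
  destruct (Hg (eps / 2)) as [d2 [H2 K2]]; [lra |].
  exists (Rmin d1 d2). split; [now apply Rmin_pos |].
  intros w Hw.
  replace (f w + g w - (f z + g z))%C with ((f w - f z) + (g w - g z))%C by ring.
  eapply Rle_lt_trans; [apply Cmod_triangle |].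
  pose proof (Rmin_l d1 d2). pose proof (Rmin_r d1 d2).
  specialize (K1 w ltac:(lra)). specialize (K2 w ltac:(lra)). lra.
Qed.

Lemma ccont_mult (f g : C -> C) (z : C) :
  ccont f z -> ccont g z -> ccont (fun w => f w * g w)%C z.
Proof.
  intros Hf Hg eps He.
  pose proof (Cmod_ge_0 (f z)). pose proof (Cmod_ge_0 (g z)).
  set (M := Cmod (f z) + Cmod (g z) + 1).
  destruct (ccont_bounded f z Hf) as [d0 [Hd0 K0]].
  assert (HM : 0 < eps / (2 * M)) by (apply Rdiv_lt_0_compat; unfold M; lra).
  destruct (Hf _ HM) as [d1 [Hd1 K1]]. destruct (Hg _ HM) as [d2 [Hd2 K2]].
  exists (Rmin d0 (Rmin d1 d2)). split; [now repeat apply Rmin_pos |].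
  intros w Hw.
  pose proof (Rmin_l d0 (Rmin d1 d2)). pose proof (Rmin_r d0 (Rmin d1 d2)).
  pose proof (Rmin_l d1 d2). pose proof (Rmin_r d1 d2).
  specialize (K0 w ltac:(lra)). specialize (K1 w ltac:(lra)). specialize (K2 w ltac:(lra)).
  replace (f w * g w - f z * g z)%C
    with (f w * (g w - g z) + (f w - f z) * g z)%C by ring.
  eapply Rle_lt_trans; [apply Cmod_triangle |]. rewrite !Cmod_mult.
  pose proof (Cmod_ge_0 (f w)). pose proof (Cmod_ge_0 (g w - g z)%C).
  pose proof (Cmod_ge_0 (f w - f z)%C).
  assert (E : eps = 2 * (M * (eps / (2 * M)))) by (field; unfold M; lra).
  assert (Cmod (f w) * Cmod (g w - g z)%C < M * (eps / (2 * M))).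
  { apply Rle_lt_trans with (M * Cmod (g w - g z)%C).
    - apply Rmult_le_compat_r; unfold M; lra.
    - apply Rmult_lt_compat_l; [unfold M; lra | exact K2]. }
  assert (Cmod (f w - f z)%C * Cmod (g z) <= M * (eps / (2 * M))).
  { rewrite (Rmult_comm _ (Cmod (g z))). apply Rmult_le_compat; unfold M in *; lra. }
  lra.
Qed.

Lemma ccont_comp (f g : C -> C) (z : C) :
  ccont g z -> ccont f (g z) -> ccont (fun w => f (g w)) z.
Proof.
  intros Hg Hf eps He. destruct (Hf eps He) as [d [Hd K]].
  destruct (Hg d Hd) as [d' [Hd' K']]. exists d'. split; [exact Hd' |].
  intros w Hw. apply K. now apply K'.
Qed.

Lemma ccont_inv_id (z : C) : z <> RtoC 0 -> ccont Cinv z.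
Proof.
  intros Hz eps He. pose proof (Cmod_pos z Hz) as Hp.
  exists (Rmin (Cmod z / 2) (eps * Cmod z ^ 2 / 2)).
  split.
  { apply Rmin_pos; [lra |]. apply Rdiv_lt_0_compat; [|lra].
    apply Rmult_lt_0_compat; [lra | now apply pow_lt]. }
  intros w Hw.
  pose proof (Rmin_l (Cmod z / 2) (eps * Cmod z ^ 2 / 2)).
  pose proof (Rmin_r (Cmod z / 2) (eps * Cmod z ^ 2 / 2)).
  pose proof (Cmod_triangle_rev z w) as Ht. rewrite Cmod_sub_sym in Ht.
  assert (Hw0 : Cmod z / 2 < Cmod w) by lra.
  assert (Hwn : w <> RtoC 0) by (apply Cmod_pos_neq; lra).
  replace (/ w - / z)%C with ((z - w) / (w * z))%C by (field; auto).
  rewrite Cmod_div by (now apply Cmult_neq_0). rewrite Cmod_mult, Cmod_sub_sym.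
  apply Rmult_lt_reg_r with (Cmod w * Cmod z); [nra |].
  unfold Rdiv. rewrite Rmult_assoc, Rinv_l, Rmult_1_r by nra.
  eapply Rlt_le_trans; [eapply Rlt_le_trans; [exact Hw | eassumption] |].
  assert (0 < eps * Cmod z) by nra. nra.
Qed.

Lemma ccont_inv (f : C -> C) (z : C) :
  f z <> RtoC 0 -> ccont f z -> ccont (fun w => / f w)%C z.
Proof. intros H Hf. apply (ccont_comp Cinv f z Hf). now apply ccont_inv_id. Qed.

Lemma cdiff_ccont (f : C -> C) (z : C) : cdiff f z -> ccont f z.
Proof.
  intros [q [Hq E]].
  assert (H : ccont (fun w => q w * (w + (- z)) + f z)%C z).
  { apply ccont_plus; [|apply ccont_const]. apply ccont_mult; [exact Hq |].
    apply ccont_plus; [apply ccont_id | apply ccont_const]. }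
  apply (ccont_local _ f z 1 Rlt_0_1) in H; [exact H |].
  intros w _. replace (f w) with ((f w - f z) + f z)%C by ring. rewrite E. ring.
Qed.

Lemma cdiff_local (f g : C -> C) (z : C) (r : R) :
  0 < r -> (forall w, Cmod (w - z)%C < r -> f w = g w) -> cdiff f z -> cdiff g z.
Proof.
  intros Hr H [q [Hq E]].
  assert (Hz : f z = g z).
  { apply H. replace (z - z)%C with (RtoC 0) by ring. now rewrite Cmod_0. }
  exists (fun w => if Rlt_dec (Cmod (w - z)%C) r then q w else ((g w - g z) / (w - z))%C).
  split.
  - apply (ccont_local q _ z r Hr); [|exact Hq].
    intros w Hw. now destruct (Rlt_dec (Cmod (w - z)%C) r).
  - intros w. destruct (Rlt_dec (Cmod (w - z)%C) r) as [Hw | Hw].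
    + rewrite <- Hz, <- (H w Hw). apply E.
    + field. intros E0. apply Hw. now rewrite E0, Cmod_0.
Qed.

Lemma cdiff_const (c z : C) : cdiff (fun _ => c) z.
Proof. exists (fun _ => RtoC 0). split; [apply ccont_const | intros w; ring]. Qed.

Lemma cdiff_id (z : C) : cdiff (fun w => w) z.
Proof. exists (fun _ => RtoC 1). split; [apply ccont_const | intros w; ring]. Qed.

Lemma cdiff_plus (f g : C -> C) (z : C) :
  cdiff f z -> cdiff g z -> cdiff (fun w => f w + g w)%C z.
Proof.
  intros [p [Hp E]] [q [Hq F]]. exists (fun w => p w + q w)%C. split.
  - now apply ccont_plus.
  - intros w. replace (f w + g w - (f z + g z))%C with ((f w - f z) + (g w - g z))%C by ring.
    rewrite E, F. ring.
Qed.

Lemma cdiff_mult (f g : C -> C) (z : C) :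
  cdiff f z -> cdiff g z -> cdiff (fun w => f w * g w)%C z.
Proof.
  intros Hf Hg. pose proof (cdiff_ccont f z Hf) as Cf.
  destruct Hf as [p [Hp E]], Hg as [q [Hq F]].
  exists (fun w => f w * q w + p w * g z)%C. split.
  - apply ccont_plus; apply ccont_mult; auto. apply ccont_const.
  - intros w. replace (f w * g w - f z * g z)%C
      with (f w * (g w - g z) + (f w - f z) * g z)%C by ring.
    rewrite E, F. ring.
Qed.

Lemma cdiff_opp (f : C -> C) (z : C) : cdiff f z -> cdiff (fun w => - f w)%C z.
Proof.
  intros H. apply (cdiff_local (fun w => RtoC (-1) * f w)%C _ z 1 Rlt_0_1).
  - intros w _. rewrite RtoC_m1. ring.
  - apply cdiff_mult; [apply cdiff_const | exact H].
Qed.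

Lemma cdiff_minus (f g : C -> C) (z : C) :
  cdiff f z -> cdiff g z -> cdiff (fun w => f w - g w)%C z.
Proof. intros Hf Hg. apply cdiff_plus; [exact Hf | now apply cdiff_opp]. Qed.

Lemma cdiff_comp (f g : C -> C) (z : C) :
  cdiff g z -> cdiff f (g z) -> cdiff (fun w => f (g w)) z.
Proof.
  intros Hg [p [Hp E]]. pose proof (cdiff_ccont g z Hg) as Cg.
  destruct Hg as [q [Hq F]].
  exists (fun w => p (g w) * q w)%C. split.
  - apply ccont_mult; [|exact Hq]. now apply (ccont_comp p g).
  - intros w. rewrite E, F. ring.
Qed.

Lemma cdiff_inv_id (z : C) : z <> RtoC 0 -> cdiff Cinv z.
Proof.
  intros Hz. pose proof (Cmod_pos z Hz) as Hp.
  exists (fun w => if Ceq_dec w 0 then (/ z / z)%C else (- (/ w * / z))%C). split.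
  - apply (ccont_local (fun w => RtoC (-1) * (/ w * / z))%C _ z (Cmod z) Hp).
    + intros w Hw. destruct (Ceq_dec w 0) as [-> | _].
      * exfalso. rewrite Cmod_sub_sym in Hw. replace (z - 0)%C with z in Hw by ring. lra.
      * rewrite RtoC_m1. ring.
    + apply ccont_mult; [apply ccont_const |].
      apply ccont_mult; [now apply ccont_inv_id | apply ccont_const].
  - intros w. destruct (Ceq_dec w 0) as [-> | Hw].
    + assert (E : (/ RtoC 0)%C = RtoC 0).
      { unfold Cinv, RtoC. simpl. f_equal; unfold Rdiv; ring. }
      rewrite E. field. exact Hz.
    + field. auto.
Qed.

Lemma cdiff_inv (f : C -> C) (z : C) :
  f z <> RtoC 0 -> cdiff f z -> cdiff (fun w => / f w)%C z.
Proof. intros H Hf. apply (cdiff_comp Cinv f z Hf). now apply cdiff_inv_id. Qed.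

Lemma cdiff_div (f g : C -> C) (z : C) :
  g z <> RtoC 0 -> cdiff f z -> cdiff g z -> cdiff (fun w => f w / g w)%C z.
Proof. intros H Hf Hg. apply cdiff_mult; [exact Hf | now apply cdiff_inv]. Qed.

Lemma ccont_minus (f g : C -> C) (z : C) :
  ccont f z -> ccont g z -> ccont (fun w => f w - g w)%C z.
Proof.
  intros Hf Hg.
  apply (ccont_local (fun w => f w + RtoC (-1) * g w)%C _ z 1 Rlt_0_1).
  - intros w _. rewrite RtoC_m1. ring.
  - apply ccont_plus; [exact Hf |]. apply ccont_mult; [apply ccont_const | exact Hg].
Qed.

Lemma ccont_div (f g : C -> C) (z : C) :
  g z <> RtoC 0 -> ccont f z -> ccont g z -> ccont (fun w => f w / g w)%C z.
Proof. intros H Hf Hg. apply ccont_mult; [exact Hf | now apply ccont_inv]. Qed.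

Lemma cdiff_ex_derive (f : C -> C) (z : C) :
  cdiff f z <-> ex_derive (K := C_AbsRing) (V := C_NormedModule) f z.
Proof.
  split.
  - intros [q [Hq E]]. exists (q z). split; [apply is_linear_scal_l |].
    intros x Hx. apply (is_filter_lim_locally_unique (V := AbsRing_NormedModule C_AbsRing)) in Hx. subst x.
    intros eps. destruct (Hq eps (cond_pos eps)) as [d [Hd K]].
    exists (mkposreal d Hd). intros w Hw.
    change (Cmod (w - z)%C < d) in Hw.
    change (Cmod ((f w - f z) - (w - z) * q z)%C <= eps * Cmod (w - z)%C).
    rewrite E. replace (q w * (w - z) - (w - z) * q z)%C with ((q w - q z) * (w - z))%C by ring.
    rewrite Cmod_mult. apply Rmult_le_compat_r; [apply Cmod_ge_0 |].
    left. now apply K.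
  - intros [l [_ H]].
    specialize (H z (fun P HP => HP)).
    exists (fun w => if Ceq_dec w z then l else ((f w - f z) / (w - z))%C). split.
    + intros eps He. assert (He2 : 0 < eps / 2) by lra.
      destruct (H (mkposreal _ He2)) as [d K].
      exists d. split; [apply cond_pos |]. intros w Hw.
      destruct (Ceq_dec z z) as [_ | N]; [|now elim N].
      destruct (Ceq_dec w z) as [_ | N].
      * replace (l - l)%C with (RtoC 0) by ring. now rewrite Cmod_0.
      * specialize (K w Hw).
        change (Cmod ((f w - f z) - (w - z) * l)%C <= eps / 2 * Cmod (w - z)%C) in K.
        pose proof (Csub_neq_0 _ _ N) as N'. pose proof (Cmod_pos _ N').
        replace ((f w - f z) / (w - z) - l)%C
          with ((f w - f z - (w - z) * l) / (w - z))%C by (field; exact N').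
        rewrite Cmod_div by exact N'.
        apply Rle_lt_trans with (eps / 2); [|lra].
        apply Rmult_le_reg_r with (Cmod (w - z)%C); [assumption |].
        unfold Rdiv at 1. rewrite Rmult_assoc, Rinv_l by lra. lra.
    + intros w. destruct (Ceq_dec w z) as [-> | N]; [ring |].
      field. now apply Csub_neq_0.
Qed.

Lemma holomorphic_cdiff (f : C -> C) :
  holomorphic_on_disc f <-> forall z, disc z -> cdiff f z.
Proof. split; intros H z Hz; apply cdiff_ex_derive, H, Hz. Qed.

Lemma disc_open (z : C) : disc z ->
  exists r, 0 < r /\ forall w, Cmod (w - z)%C < r -> disc w.
Proof.
  unfold disc. intros Hz. exists (1 - Cmod z). split; [lra |].
  intros w Hw. pose proof (Cmod_triangle_rev w z). lra.
Qed.

Lemma cdiff_disc_ext (f g : C -> C) (z : C) :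
  eq_on_disc f g -> disc z -> cdiff f z -> cdiff g z.
Proof.
  intros H Hz. destruct (disc_open z Hz) as [r [Hr K]].
  apply (cdiff_local f g z r Hr). intros w Hw. now apply H, K.
Qed.

(** * Subdivision of rectangles *)

Lemma nested_intervals (x : nat -> R) (a : R) :
  (forall n, x n <= x (S n)) ->
  (forall n, x (S n) + a / 2 ^ S n <= x n + a / 2 ^ n) -> 0 < a ->
  exists u, forall n, x n <= u <= x n + a / 2 ^ n.
Proof.
  intros Hi Hd Ha.
  assert (Hpos : forall n, 0 < a / 2 ^ n).
  { intros n. apply Rdiv_lt_0_compat; [exact Ha | apply pow_lt; lra]. }
  assert (Hmi : forall n k, x n <= x (n + k)%nat).
  { intros n k. induction k as [|k IH].
    - rewrite Nat.add_0_r. lra.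
    - rewrite Nat.add_succ_r. specialize (Hi (n + k)%nat). lra. }
  assert (Hmd : forall n k, x (n + k)%nat + a / 2 ^ (n + k) <= x n + a / 2 ^ n).
  { intros n k. induction k as [|k IH].
    - rewrite Nat.add_0_r. lra.
    - rewrite Nat.add_succ_r. specialize (Hd (n + k)%nat). lra. }
  assert (Hmn : forall m n, x m <= x n + a / 2 ^ n).
  { intros m n. destruct (Nat.le_ge_cases m n) as [H | H].
    - replace n with (m + (n - m))%nat at 1 by lia.
      specialize (Hmi m (n - m)%nat). specialize (Hpos n). lra.
    - replace m with (n + (m - n))%nat by lia.
      specialize (Hmd n (m - n)%nat). specialize (Hpos (n + (m - n))%nat). lra. }
  destruct (completeness (fun t => exists n, t = x n)) as [u [Hu1 Hu2]].
  - exists (x 0%nat + a / 2 ^ 0). intros t [n ->]. apply Hmn.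
  - exists (x 0%nat). now exists 0%nat.
  - exists u. intros n. split.
    + apply Hu1. now exists n.
    + apply Hu2. intros t [m ->]. apply Hmn.
Qed.

Lemma half_powers_small (a del : R) : 0 < a -> 0 < del -> exists n, a / 2 ^ n < del.
Proof.
  intros Ha Hd. destruct (Pow_x_infinity 2) with (b := a / del + 1) as [n Hn].
  - rewrite Rabs_pos_eq; lra.
  - exists n. specialize (Hn n (Nat.le_refl n)).
    rewrite Rabs_pos_eq in Hn by (apply pow_le; lra).
    assert (Hp : 0 < 2 ^ n) by (apply pow_lt; lra).
    apply Rmult_lt_reg_r with (2 ^ n); [exact Hp |].
    unfold Rdiv. rewrite Rmult_assoc, Rinv_l by lra.
    assert (a = del * (a / del)) by (field; lra). nra.
Qed.

(** Otherwise bisection would close in on a point around which the property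
    fails. The arguments of [Good] are the lower left corner and the sides. The
    principle serves both for the vanishing of contour integrals and for the
    existence of maxima. *)
Lemma rectangle_subdivision (Good : R -> R -> R -> R -> Prop) (x0 y0 a0 b0 : R) :
  0 < a0 -> 0 < b0 ->
  (forall x y a b,
     Good x y (a / 2) (b / 2) -> Good (x + a / 2) y (a / 2) (b / 2) ->
     Good x (y + b / 2) (a / 2) (b / 2) ->
     Good (x + a / 2) (y + b / 2) (a / 2) (b / 2) ->
     Good x y a b) ->
  (forall u v, x0 <= u <= x0 + a0 -> y0 <= v <= y0 + b0 ->
     exists del, 0 < del /\ forall x y a b,
     x <= u <= x + a -> y <= v <= y + b -> 0 < a < del -> 0 < b < del ->
     Good x y a b) ->
  Good x0 y0 a0 b0.
Proof.
  intros Ha Hb Hsplit Hloc. apply NNPP. intros Hbad.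
  set (al := fun n => a0 / 2 ^ n). set (be := fun n => b0 / 2 ^ n).
  assert (Hal : forall n, al (S n) = al n / 2)
    by (intros n; unfold al; simpl; field; apply pow_nonzero; lra).
  assert (Hbe : forall n, be (S n) = be n / 2)
    by (intros n; unfold be; simpl; field; apply pow_nonzero; lra).
  set (Bad := fun n (p : R * R) => ~ Good (fst p) (snd p) (al n) (be n)).
  assert (step : forall n (p : sig (Bad n)), exists p' : sig (Bad (S n)),
    let '(x, y) := proj1_sig p in let '(x', y') := proj1_sig p' in
    (x' = x \/ x' = x + al n / 2) /\ (y' = y \/ y' = y + be n / 2)).
  { intros n [[x y] Hp]. simpl. apply NNPP. intros Hno.
    apply Hp. simpl. apply Hsplit; rewrite <- Hal, <- Hbe; apply NNPP; intros Hq; apply Hno.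
    - exists (exist (Bad (S n)) (x, y) Hq). simpl. auto.
    - exists (exist (Bad (S n)) (x + al (S n), y) Hq). simpl. rewrite Hal. auto.
    - exists (exist (Bad (S n)) (x, y + be (S n)) Hq). simpl. rewrite Hbe. auto.
    - exists (exist (Bad (S n)) (x + al (S n), y + be (S n)) Hq). simpl. rewrite Hal, Hbe. auto. }
  assert (Hbad0 : Bad 0%nat (x0, y0)).
  { unfold Bad, al, be. simpl. now rewrite !Rdiv_1_r. }
  set (s := nat_rect (fun n => sig (Bad n)) (exist _ _ Hbad0)
    (fun n p => proj1_sig (constructive_indefinite_description _ (step n p)))).
  set (X := fun n => fst (proj1_sig (s n))). set (Y := fun n => snd (proj1_sig (s n))).
  assert (Hs : forall n, (X (S n) = X n \/ X (S n) = X n + al n / 2) /\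
                         (Y (S n) = Y n \/ Y (S n) = Y n + be n / 2)).
  { intros n. unfold X, Y.
    change (s (S n)) with (proj1_sig (constructive_indefinite_description _ (step n (s n)))).
    destruct (constructive_indefinite_description _ (step n (s n))) as [p' H]. simpl.
    destruct (proj1_sig (s n)) as [x y], (proj1_sig p') as [x' y']. exact H. }
  assert (Hpa : forall n, 0 < al n) by (intros; apply Rdiv_lt_0_compat; [lra | apply pow_lt; lra]).
  assert (Hpb : forall n, 0 < be n) by (intros; apply Rdiv_lt_0_compat; [lra | apply pow_lt; lra]).
  destruct (nested_intervals X a0) as [u Hu]; [| |exact Ha|].
  { intros n. specialize (Hpa n). destruct (proj1 (Hs n)) as [-> | ->]; lra. }
  { intros n. fold (al n) (al (S n)). rewrite Hal. specialize (Hpa n).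
    destruct (proj1 (Hs n)) as [-> | ->]; lra. }
  destruct (nested_intervals Y b0) as [v Hv]; [| |exact Hb|].
  { intros n. specialize (Hpb n). destruct (proj2 (Hs n)) as [-> | ->]; lra. }
  { intros n. fold (be n) (be (S n)). rewrite Hbe. specialize (Hpb n).
    destruct (proj2 (Hs n)) as [-> | ->]; lra. }
  destruct (Hloc u v) as [del [Hd K]].
  { specialize (Hu 0%nat). unfold X in Hu. simpl in Hu. lra. }
  { specialize (Hv 0%nat). unfold Y in Hv. simpl in Hv. lra. }
  destruct (half_powers_small (Rmax a0 b0) del) as [n Hn].
  { eapply Rlt_le_trans; [exact Ha | apply Rmax_l]. }
  { exact Hd. }
  assert (H2 : 0 < / 2 ^ n) by (apply Rinv_0_lt_compat, pow_lt; lra).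
  apply (proj2_sig (s n)). apply K.
  - apply (Hu n).
  - apply (Hv n).
  - split; [apply Hpa |]. unfold al, Rdiv in *. pose proof (Rmax_l a0 b0). nra.
  - split; [apply Hpb |]. unfold be, Rdiv in *. pose proof (Rmax_r a0 b0). nra.
Qed.

(** * Goursat's theorem and the mean value over circles *)

Lemma continuous_of_eps (f : R -> R) (t : R) :
  (forall eps, 0 < eps -> exists del, 0 < del /\
     forall s, Rabs (s - t) < del -> Rabs (f s - f t) < eps) -> continuous f t.
Proof.
  intros H. apply filterlim_locally. intros eps.
  destruct (H eps (cond_pos eps)) as [d [Hd K]].
  exists (mkposreal d Hd). intros s Hs. now apply K.
Qed.

Lemma continuous_along (G : C -> C) (path : R -> C) (K t : R) :
  0 < K -> (forall s, Cmod (path s - path t)%C <= K * Rabs (s - t)) ->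
  ccont G (path t) ->
  continuous (fun s => Re (G (path s))) t /\ continuous (fun s => Im (G (path s))) t.
Proof.
  intros HK HL HG.
  assert (H : forall eps, 0 < eps -> exists del, 0 < del /\ forall s,
    Rabs (s - t) < del -> Cmod (G (path s) - G (path t))%C < eps).
  { intros eps He. destruct (HG eps He) as [d [Hd Q]].
    exists (d / K). split; [now apply Rdiv_lt_0_compat |].
    intros s Hs. apply Q. eapply Rle_lt_trans; [apply HL |].
    apply Rmult_lt_compat_l with (r := K) in Hs; [|exact HK].
    replace (K * (d / K)) with d in Hs by (field; lra). exact Hs. }
  split; apply continuous_of_eps; intros eps He; destruct (H eps He) as [d [Hd Q]];
    exists d; (split; [exact Hd |]); intros s Hs; specialize (Q s Hs);
    (eapply Rle_lt_trans; [|exact Q]).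
  - exact (re_le_Cmod (G (path s) - G (path t))%C).
  - exact (im_le_Cmod (G (path s) - G (path t))%C).
Qed.

Lemma horizontal_lipschitz (y s t : R) :
  Cmod (((s, y) : C) - ((t, y) : C))%C <= 1 * Rabs (s - t).
Proof.
  eapply Rle_trans; [apply Cmod_le_Re_Im |]. simpl.
  replace (y + - y) with 0 by ring. rewrite Rabs_R0. unfold Rminus. lra.
Qed.

Lemma vertical_lipschitz (x s t : R) :
  Cmod (((x, s) : C) - ((x, t) : C))%C <= 1 * Rabs (s - t).
Proof.
  eapply Rle_trans; [apply Cmod_le_Re_Im |]. simpl.
  replace (x + - x) with 0 by ring. rewrite Rabs_R0. unfold Rminus. lra.
Qed.

Lemma RInt_near_affine (f : R -> R) (p h al be M : R) :
  0 <= h -> (forall t, p <= t <= p + h -> continuous f t) ->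
  (forall t, p <= t <= p + h -> Rabs (f t - (al + be * t)) <= M) ->
  Rabs (RInt f p (p + h) - (al * h + be * ((p + h) ^ 2 - p ^ 2) / 2)) <= M * h.
Proof.
  intros Hh Hc HM.
  assert (Ef : ex_RInt f p (p + h)).
  { apply (ex_RInt_continuous (V := R_CompleteNormedModule)).
    rewrite Rmin_left, Rmax_right by lra. exact Hc. }
  assert (Ig : is_RInt (fun t => al + be * t) p (p + h)
                 (al * h + be * ((p + h) ^ 2 - p ^ 2) / 2)).
  { replace (al * h + be * ((p + h) ^ 2 - p ^ 2) / 2)
      with (minus (al * (p + h) + be * (p + h) ^ 2 / 2) (al * p + be * p ^ 2 / 2))
      by (unfold minus, plus, opp; simpl; field).
    apply (is_RInt_derive (fun t => al * t + be * t ^ 2 / 2)).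
    - intros t _. auto_derive; [exact I | field].
    - intros t _. apply continuity_pt_filterlim. reg. }
  rewrite <- (is_RInt_unique _ _ _ _ Ig).
  assert (Eg : ex_RInt (fun t => al + be * t) p (p + h)) by (eexists; exact Ig).
  pose proof (RInt_minus (V := R_CompleteNormedModule) _ _ _ _ Ef Eg) as Em.
  change (RInt (fun t => f t - (al + be * t)) p (p + h)
    = RInt f p (p + h) - RInt (fun t => al + be * t) p (p + h)) in Em.
  rewrite <- Em.
  replace (M * h) with ((p + h - p) * M) by ring.
  apply abs_RInt_le_const; [lra | | exact HM].
  apply (ex_RInt_minus (V := R_NormedModule)); assumption.
Qed.

(** The real part of the integral of [G dw] around the rectangle. *)
Definition contour_re (G : C -> C) (x y a b : R) : R :=
  RInt (fun t => Re (G (t, y))) x (x + a) + - RInt (fun t => Re (G (t, y + b))) x (x + a)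
  + - RInt (fun t => Im (G (x + a, t))) y (y + b) + RInt (fun t => Im (G (x, t))) y (y + b).

(** On a small rectangle, [G] is affine up to [eps] times its size, and an affine
    function integrates to zero around a rectangle. So the integral is at most
    [eps (a + b)^2], a bound that is compatible with subdivision. *)
Lemma goursat (G : C -> C) (x0 y0 a0 b0 : R) :
  0 < a0 -> 0 < b0 ->
  (forall u v, x0 <= u <= x0 + a0 -> y0 <= v <= y0 + b0 -> cdiff G (u, v)) ->
  contour_re G x0 y0 a0 b0 = 0.
Proof.
  intros Ha Hb HG.
  assert (HC : forall u v, x0 <= u <= x0 + a0 -> y0 <= v <= y0 + b0 -> ccont G (u, v))
    by (intros; now apply cdiff_ccont, HG).
  assert (HcH : forall y t, y0 <= y <= y0 + b0 -> x0 <= t <= x0 + a0 ->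
     continuous (fun s => Re (G (s, y))) t).
  { intros y t Hy Ht. apply (continuous_along G (fun s => (s, y)) 1); [lra | |now apply HC].
    intros s. apply horizontal_lipschitz. }
  assert (HcV : forall x t, x0 <= x <= x0 + a0 -> y0 <= t <= y0 + b0 ->
     continuous (fun s => Im (G (x, s))) t).
  { intros x t Hx Ht. apply (continuous_along G (fun s => (x, s)) 1); [lra | |now apply HC].
    intros s. apply vertical_lipschitz. }
  assert (Hchas : forall (f : R -> R) p h, 0 <= h ->
     (forall t, p <= t <= p + h -> continuous f t) ->
     RInt f p (p + h) = RInt f p (p + h / 2) + RInt f (p + h / 2) (p + h / 2 + h / 2)).
  { intros f p h Hh Hf. replace (p + h / 2 + h / 2) with (p + h) by field.
    symmetry. apply (RInt_Chasles (V := R_CompleteNormedModule));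
      apply (ex_RInt_continuous (V := R_CompleteNormedModule));
      intros z; rewrite Rmin_left, Rmax_right by lra; intros Hz; apply Hf; lra. }
  assert (Hmain : forall eps, 0 < eps ->
    Rabs (contour_re G x0 y0 a0 b0) <= eps * (a0 + b0) ^ 2).
  { intros eps He.
    cut ((fun x y a b => 0 < a -> 0 < b -> x0 <= x -> x + a <= x0 + a0 -> y0 <= y ->
            y + b <= y0 + b0 ->
            Rabs (contour_re G x y a b) <= eps * (a + b) ^ 2) x0 y0 a0 b0).
    { intros H. apply H; lra. }
    apply rectangle_subdivision; [exact Ha | exact Hb | |].
    - intros x y a b H1 H2 H3 H4 Pa Pb Hx Hxa Hy Hyb.
      specialize (H1 ltac:(lra) ltac:(lra) ltac:(lra) ltac:(lra) ltac:(lra) ltac:(lra)).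
      specialize (H2 ltac:(lra) ltac:(lra) ltac:(lra) ltac:(lra) ltac:(lra) ltac:(lra)).
      specialize (H3 ltac:(lra) ltac:(lra) ltac:(lra) ltac:(lra) ltac:(lra) ltac:(lra)).
      specialize (H4 ltac:(lra) ltac:(lra) ltac:(lra) ltac:(lra) ltac:(lra) ltac:(lra)).
      assert (E : contour_re G x y a b =
        (contour_re G x y (a / 2) (b / 2) + contour_re G (x + a / 2) y (a / 2) (b / 2))
        + (contour_re G x (y + b / 2) (a / 2) (b / 2)
           + contour_re G (x + a / 2) (y + b / 2) (a / 2) (b / 2))).
      { unfold contour_re.
        rewrite (Hchas (fun t => Re (G (t, y))) x a), (Hchas (fun t => Re (G (t, y + b))) x a),
          (Hchas (fun t => Im (G (x + a, t))) y b), (Hchas (fun t => Im (G (x, t))) y b);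
          try lra; try (intros t Ht; first [apply HcH | apply HcV]; lra).
        replace (y + b / 2 + b / 2) with (y + b) by field.
        replace (x + a / 2 + a / 2) with (x + a) by field. ring. }
      rewrite E. eapply Rle_trans; [apply Rabs_triang |].
      eapply Rle_trans; [apply Rplus_le_compat; apply Rabs_triang |].
      replace (eps * (a + b) ^ 2) with (eps * (a / 2 + b / 2) ^ 2 + eps * (a / 2 + b / 2) ^ 2
        + (eps * (a / 2 + b / 2) ^ 2 + eps * (a / 2 + b / 2) ^ 2)) by field.
      lra.
    - intros u v Hu Hv. destruct (HG u v Hu Hv) as [q [Hq E]].
      assert (He2 : 0 < eps / 2) by lra.
      destruct (Hq (eps / 2) He2) as [d [Hd K]].
      exists (d / 2). split; [lra |].
      intros x y a b Hxu Hyv Hda Hdb Pa Pb Hx Hxa Hy Hyb.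
      set (c := G (u, v)). set (l := q (u, v)).
      assert (near : forall s t, x <= s <= x + a -> y <= t <= y + b ->
        Cmod (G (s, t) - (c + l * (((s, t) : C) - ((u, v) : C))))%C <= eps / 2 * (a + b)).
      { intros s t Hs Ht.
        assert (Hw : Cmod (((s, t) : C) - ((u, v) : C))%C <= a + b).
        { eapply Rle_trans; [apply Cmod_le_Re_Im |]. simpl.
          apply Rplus_le_compat; apply Rabs_le; lra. }
        replace (G (s, t) - (c + l * (((s, t) : C) - ((u, v) : C))))%C
          with ((G (s, t) - G (u, v)) - l * (((s, t) : C) - ((u, v) : C)))%C
          by (unfold c; ring).
        rewrite E. unfold l.
        replace (q (s, t) * (((s, t) : C) - ((u, v) : C)) - q (u, v) * (((s, t) : C) - ((u, v) : C)))%C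
          with ((q (s, t) - q (u, v)) * (((s, t) : C) - ((u, v) : C)))%C by ring.
        rewrite Cmod_mult. apply Rmult_le_compat; try apply Cmod_ge_0; [|exact Hw].
        left. apply K. lra. }
      assert (nearRe : forall s t, x <= s <= x + a -> y <= t <= y + b ->
        Rabs (Re (G (s, t)) - ((Re c - Re l * u - Im l * (t - v)) + Re l * s)) <= eps / 2 * (a + b)).
      { intros s t Hs Ht. eapply Rle_trans; [|apply (near s t Hs Ht)].
        eapply Rle_trans; [|apply re_le_Cmod]. right. f_equal.
        destruct c, l, (G (s, t)). simpl. ring. }
      assert (nearIm : forall s t, x <= s <= x + a -> y <= t <= y + b ->
        Rabs (Im (G (s, t)) - ((Im c - Re l * v + Im l * (s - u)) + Re l * t)) <= eps / 2 * (a + b)).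
      { intros s t Hs Ht. eapply Rle_trans; [|apply (near s t Hs Ht)].
        eapply Rle_trans; [|apply im_le_Cmod]. right. f_equal.
        destruct c, l, (G (s, t)). simpl. ring. }
      unfold contour_re.
      pose proof (RInt_near_affine (fun t => Re (G (t, y))) x a _ (Re l) _ ltac:(lra)
        ltac:(intros t Ht; apply HcH; lra) (fun t Ht => nearRe t y Ht ltac:(lra))) as I1.
      pose proof (RInt_near_affine (fun t => Re (G (t, y + b))) x a _ (Re l) _ ltac:(lra)
        ltac:(intros t Ht; apply HcH; lra) (fun t Ht => nearRe t (y + b) Ht ltac:(lra))) as I2.
      pose proof (RInt_near_affine (fun t => Im (G (x + a, t))) y b _ (Re l) _ ltac:(lra)
        ltac:(intros t Ht; apply HcV; lra) (fun t Ht => nearIm (x + a) t ltac:(lra) Ht)) as I3.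
      pose proof (RInt_near_affine (fun t => Im (G (x, t))) y b _ (Re l) _ ltac:(lra)
        ltac:(intros t Ht; apply HcV; lra) (fun t Ht => nearIm x t ltac:(lra) Ht)) as I4.
      apply Rabs_le_between in I1. apply Rabs_le_between in I2.
      apply Rabs_le_between in I3. apply Rabs_le_between in I4.
      apply Rabs_le_between. nra. }
  apply NNPP. intros Hn. apply Rabs_pos_lt in Hn.
  set (J := Rabs (contour_re G x0 y0 a0 b0)) in *.
  assert (Hs : 0 < (a0 + b0) ^ 2) by (apply pow_lt; lra).
  specialize (Hmain (J / 2 / (a0 + b0) ^ 2)).
  assert (He : 0 < J / 2 / (a0 + b0) ^ 2) by (apply Rdiv_lt_0_compat; lra).
  specialize (Hmain He).
  replace (J / 2 / (a0 + b0) ^ 2 * (a0 + b0) ^ 2) with (J / 2) in Hmain by (field; lra).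
  lra.
Qed.

Definition cexp (w : C) : C := (exp (Re w) * cos (Im w), exp (Re w) * sin (Im w)).

Lemma cexp_plus (w v : C) : cexp (w + v)%C = (cexp w * cexp v)%C.
Proof.
  unfold cexp, Cmult. destruct w as [w1 w2], v as [v1 v2]. simpl.
  rewrite exp_plus, cos_plus, sin_plus. f_equal; ring.
Qed.

Lemma Cmod_cexp (w : C) : Cmod (cexp w) = exp (Re w).
Proof.
  pose proof (exp_pos (Re w)). pose proof (Cmod_ge_0 (cexp w)).
  assert (E : Cmod (cexp w) ^ 2 = exp (Re w) ^ 2).
  { rewrite Cmod_sqr. unfold cexp. simpl. pose proof (sin2_cos2 (Im w)) as S.
    unfold Rsqr in S.
    transitivity (exp (Re w) * exp (Re w) * (sin (Im w) * sin (Im w) + cos (Im w) * cos (Im w)));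
      [ring | rewrite S; ring]. }
  nra.
Qed.

Lemma derivable_pt_lim_linear_bound (f : R -> R) (l eps : R) :
  derivable_pt_lim f 0 l -> 0 < eps ->
  exists d, 0 < d /\ forall h, Rabs h < d -> Rabs (f h - f 0 - l * h) <= eps * Rabs h.
Proof.
  intros H He. destruct (H eps He) as [d K]. exists d. split; [apply cond_pos |].
  intros h Hh. destruct (Req_dec h 0) as [-> | Hn].
  - replace (f 0 - f 0 - l * 0) with 0 by ring. rewrite Rabs_R0. lra.
  - specialize (K h Hn Hh). rewrite Rplus_0_l in K.
    replace (f h - f 0 - l * h) with (((f h - f 0) / h - l) * h) by (field; exact Hn).
    rewrite Rabs_mult. apply Rmult_le_compat_r; [apply Rabs_pos | lra].
Qed.

Lemma cexp_linear_bound (eps : R) : 0 < eps ->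
  exists d, 0 < d /\ forall h, Cmod h < d ->
  Cmod (cexp h - 1 - h)%C <= eps * Cmod h.
Proof.
  intros He. set (e := Rmin (eps / 8) 1).
  assert (Hep : 0 < e) by (apply Rmin_pos; lra).
  assert (He8 : e <= eps / 8) by apply Rmin_l.
  assert (He1 : e <= 1) by apply Rmin_r.
  destruct (derivable_pt_lim_linear_bound exp (exp 0) e (derivable_pt_lim_exp 0) Hep) as [d1 [D1 K1]].
  destruct (derivable_pt_lim_linear_bound sin (cos 0) e (derivable_pt_lim_sin 0) Hep) as [d2 [D2 K2]].
  destruct (derivable_pt_lim_linear_bound cos (- sin 0) e (derivable_pt_lim_cos 0) Hep) as [d3 [D3 K3]].
  rewrite exp_0 in K1. rewrite sin_0, cos_0 in K2, K3.
  set (d := Rmin (Rmin d1 d2) (Rmin d3 (Rmin (e / 2) 1))).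
  exists d. split; [unfold d; repeat apply Rmin_pos; lra |].
  intros [x y] Hh.
  pose proof (re_le_Cmod (x, y)) as Hx. pose proof (im_le_Cmod (x, y)) as Hy. simpl in Hx, Hy.
  assert (Hd : d <= d1 /\ d <= d2 /\ d <= d3 /\ d <= e / 2 /\ d <= 1).
  { unfold d. pose proof (Rmin_l (Rmin d1 d2) (Rmin d3 (Rmin (e / 2) 1))).
    pose proof (Rmin_r (Rmin d1 d2) (Rmin d3 (Rmin (e / 2) 1))).
    pose proof (Rmin_l d1 d2). pose proof (Rmin_r d1 d2).
    pose proof (Rmin_l d3 (Rmin (e / 2) 1)). pose proof (Rmin_r d3 (Rmin (e / 2) 1)).
    pose proof (Rmin_l (e / 2) 1). pose proof (Rmin_r (e / 2) 1). lra. }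
  specialize (K1 x ltac:(lra)). specialize (K2 y ltac:(lra)). specialize (K3 y ltac:(lra)).
  set (m := Cmod (x, y)) in *.
  assert (Bx : Rabs (exp x - 1 - x) <= e * m) by (replace (exp x - 1 - x) with (exp x - 1 - 1 * x) by ring; nra).
  assert (Bs : Rabs (sin y - y) <= e * m) by (replace (sin y - y) with (sin y - 0 - 1 * y) by ring; nra).
  assert (Bc : Rabs (cos y - 1) <= e * m) by (replace (cos y - 1) with (cos y - 1 - - 0 * y) by ring; nra).
  assert (Bx' : Rabs (exp x - 1) <= 2 * m).
  { replace (exp x - 1) with ((exp x - 1 - x) + x) by ring.
    eapply Rle_trans; [apply Rabs_triang |]. pose proof (Rabs_pos x). nra. }
  assert (Bx'' : Rabs (exp x) <= 3).
  { replace (exp x) with ((exp x - 1) + 1) by ring.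
    eapply Rle_trans; [apply Rabs_triang |]. rewrite Rabs_R1. lra. }
  assert (Hm : 0 <= m) by apply Cmod_ge_0.
  eapply Rle_trans; [apply Cmod_le_Re_Im |]. unfold cexp. simpl.
  replace (exp x * cos y + - (1) + - x) with ((exp x - 1 - x) + exp x * (cos y - 1)) by ring.
  replace (exp x * sin y + - 0 + - y) with (exp x * (sin y - y) + (exp x - 1) * y) by ring.
  pose proof (Rabs_triang (exp x - 1 - x) (exp x * (cos y - 1))) as T1.
  pose proof (Rabs_triang (exp x * (sin y - y)) ((exp x - 1) * y)) as T2.
  rewrite Rabs_mult in T1. rewrite !Rabs_mult in T2.
  assert (P1 : Rabs (exp x) * Rabs (cos y - 1) <= 3 * (e * m))
    by (apply Rmult_le_compat; try apply Rabs_pos; assumption).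
  assert (P2 : Rabs (exp x) * Rabs (sin y - y) <= 3 * (e * m))
    by (apply Rmult_le_compat; try apply Rabs_pos; assumption).
  assert (P3 : Rabs (exp x - 1) * Rabs y <= (2 * m) * (e / 2))
    by (apply Rmult_le_compat; try apply Rabs_pos; [assumption | lra]).
  nra.
Qed.

Lemma cdiff_cexp (w : C) : cdiff cexp w.
Proof.
  assert (H0 : cdiff cexp 0).
  { apply cdiff_ex_derive. exists (RtoC 1). split; [apply is_linear_scal_l |].
    intros x Hx. apply (is_filter_lim_locally_unique (V := AbsRing_NormedModule C_AbsRing)) in Hx.
    subst x. intros eps. destruct (cexp_linear_bound eps (cond_pos eps)) as [d [Hd K]].
    exists (mkposreal d Hd). intros h Hh.
    change (Cmod (h - 0)%C < d) in Hh.
    change (Cmod (cexp h - cexp 0 - (h - 0) * 1)%C <= eps * Cmod (h - 0)%C).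
    replace (cexp 0) with (RtoC 1).
    - assert (E0 : forall k : C, (k - 0)%C = k) by (intros; ring).
      assert (E1 : forall k : C, (k * 1)%C = k) by (intros; ring).
      rewrite E0 in *. rewrite E1. now apply K.
    - unfold cexp, RtoC. simpl. rewrite exp_0, cos_0, sin_0. f_equal; ring. }
  apply (cdiff_local (fun v => cexp w * cexp (v - w))%C _ w 1 Rlt_0_1).
  - intros v _. rewrite <- cexp_plus. f_equal. ring.
  - apply cdiff_mult; [apply cdiff_const |].
    apply (cdiff_comp cexp (fun v => v - w)%C).
    + apply cdiff_minus; [apply cdiff_id | apply cdiff_const].
    + replace (w - w)%C with (RtoC 0) by ring. exact H0.
Qed.

(** In the coordinate [w] with [z = z1 + exp w], concentric circles around [z1]
    are the vertical sides of a rectangle whose horizontal sides carry the same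
    values; so the mean of [g] over a circle does not depend on the radius, and
    tends to [g z1] as the radius shrinks. The rectangles never reach the centre,
    where continuity is therefore enough. *)
Lemma Re_le_of_circle (g : C -> C) (z1 : C) (r m : R) :
  0 < r ->
  ccont g z1 ->
  (forall z, 0 < Cmod (z - z1)%C <= r -> cdiff g z) ->
  (forall z, Cmod (z - z1)%C = r -> Re (g z) <= m) ->
  Re (g z1) <= m.
Proof.
  intros Hr Hc Hd Hm. apply le_epsilon. intros eps He.
  destruct (Hc eps He) as [d [Hd0 K]].
  set (x1 := ln r). set (r0 := Rmin d r / 2).
  assert (Hr0 : 0 < r0 < r /\ r0 < d).
  { unfold r0. pose proof (Rmin_l d r). pose proof (Rmin_r d r).
    assert (0 < Rmin d r) by (now apply Rmin_pos). lra. }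
  set (x0 := ln r0).
  assert (Hx : x0 < x1) by (apply ln_increasing; lra).
  assert (Ex1 : exp x1 = r) by (apply exp_ln; lra).
  assert (Ex0 : exp x0 = r0) by (apply exp_ln; lra).
  (* With the factor [i], the vertical sides carry the real part of [g]. *)
  set (G := fun w => (Ci * g (z1 + cexp w))%C).
  assert (Hdist : forall w, Cmod (z1 + cexp w - z1)%C = exp (Re w)).
  { intros w. replace (z1 + cexp w - z1)%C with (cexp w) by ring. apply Cmod_cexp. }
  assert (HG : forall u v, u <= x1 -> cdiff G (u, v)).
  { intros u v Hu. apply cdiff_mult; [apply cdiff_const |].
    apply (cdiff_comp g (fun w => z1 + cexp w)%C).
    - apply cdiff_plus; [apply cdiff_const | apply cdiff_cexp].
    - apply Hd. rewrite Hdist. simpl. split; [apply exp_pos |].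
      rewrite <- Ex1. destruct Hu as [Hu | ->]; [left; now apply exp_increasing | lra]. }
  pose proof PI_RGT_0 as Hpi.
  pose proof (goursat G x0 0 (x1 - x0) (2 * PI) ltac:(lra) ltac:(lra)
    ltac:(intros; apply HG; lra)) as J.
  unfold contour_re in J.
  replace (x0 + (x1 - x0)) with x1 in J by ring. rewrite Rplus_0_l in J.
  rewrite (RInt_ext (fun t => Re (G (t, 2 * PI))) (fun t => Re (G (t, 0)))) in J.
  2:{ intros t _. unfold G.
      assert (E : cexp (t, 2 * PI) = cexp (t, 0)); [|now rewrite E].
      unfold cexp. cbn [Re Im fst snd]. now rewrite cos_2PI, sin_2PI, cos_0, sin_0. }
  assert (HcV : forall u t, u <= x1 -> continuous (fun s => Im (G (u, s))) t).
  { intros u t Hu. apply (continuous_along G (fun s => (u, s)) 1); [lra | |].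
    - intros s. apply vertical_lipschitz.
    - now apply cdiff_ccont, HG. }
  assert (HImG : forall w, Im (G w) = Re (g (z1 + cexp w)%C)).
  { intros w. unfold G. destruct (g (z1 + cexp w)%C). simpl. ring. }
  assert (Eint : forall u, u <= x1 -> ex_RInt (fun t => Im (G (u, t))) 0 (2 * PI)).
  { intros u Hu. apply (ex_RInt_continuous (V := R_CompleteNormedModule)).
    intros t _. now apply HcV. }
  assert (U : RInt (fun t => Im (G (x1, t))) 0 (2 * PI) <= m * (2 * PI)).
  { replace (m * (2 * PI)) with (RInt (fun _ => m) 0 (2 * PI)).
    - apply RInt_le; [lra | apply Eint; lra | apply ex_RInt_const |].
      intros t _. rewrite HImG. apply Hm. rewrite Hdist. exact Ex1.
    - rewrite RInt_const. unfold scal. simpl. unfold mult. simpl. ring. }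
  assert (L : (Re (g z1) - eps) * (2 * PI) <= RInt (fun t => Im (G (x0, t))) 0 (2 * PI)).
  { replace ((Re (g z1) - eps) * (2 * PI)) with (RInt (fun _ => Re (g z1) - eps) 0 (2 * PI)).
    - apply RInt_le; [lra | apply ex_RInt_const | apply Eint; lra |].
      intros t _. rewrite HImG.
      assert (Hn : Cmod (g (z1 + cexp (x0, t)) - g z1)%C < eps).
      { apply K. rewrite Hdist. simpl. lra. }
      pose proof (re_le_Cmod (g (z1 + cexp (x0, t)) - g z1)%C) as Hre.
      assert (E : Re (g (z1 + cexp (x0, t)) - g z1)%C = Re (g (z1 + cexp (x0, t))%C) - Re (g z1))
        by reflexivity.
      rewrite E in Hre.
      pose proof (Rabs_le_between (Re (g (z1 + cexp (x0, t))%C) - Re (g z1)) eps) as [Hb _].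
      specialize (Hb ltac:(lra)). lra.
    - rewrite RInt_const. unfold scal. simpl. unfold mult. simpl. ring. }
  apply Rmult_le_reg_r with (2 * PI); [lra |].
  replace ((m + eps) * (2 * PI)) with (m * (2 * PI) + eps * (2 * PI)) by ring. nra.
Qed.

(** * The maximum principle and the Schwarz-Pick lemma *)

(** If no point were a maximum, every point would have a neighbourhood on which
    [h] stays below some value that it takes; so would the whole ball, by
    subdivision, and that value is taken in the ball. *)
Lemma max_on_closed_ball (h : C -> R) (rho : R) :
  0 <= rho ->
  (forall z, Cmod z <= rho -> forall eps, 0 < eps -> exists del, 0 < del /\
     forall w, Cmod (w - z)%C < del -> Rabs (h w - h z) < eps) ->
  exists z1, Cmod z1 <= rho /\ forall z, Cmod z <= rho -> h z <= h z1.
Proof.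
  intros Hrho Hc. apply NNPP. intros Hno.
  assert (Hup : forall z, Cmod z <= rho -> exists q, Cmod q <= rho /\ h z < h q).
  { intros z Hz. apply NNPP. intros Hn. apply Hno. exists z. split; [exact Hz |].
    intros w Hw. destruct (Rle_lt_dec (h w) (h z)) as [|Hlt]; [assumption |].
    elim Hn. now exists w. }
  set (Good := fun x y a b => exists q, Cmod q <= rho /\
    forall s t, x <= s <= x + a -> y <= t <= y + b -> Cmod (s, t) <= rho -> h (s, t) < h q).
  assert (HG : Good (- (rho + 1)) (- (rho + 1)) (2 * (rho + 1)) (2 * (rho + 1))).
  { apply rectangle_subdivision; [lra | lra | |].
    - assert (better : forall q q', Cmod q <= rho -> Cmod q' <= rho ->
        exists p, Cmod p <= rho /\ h q <= h p /\ h q' <= h p).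
      { intros q q' H H'. destruct (Rle_lt_dec (h q) (h q')).
        - exists q'. repeat split; lra.
        - exists q. repeat split; lra. }
      intros x y a b [q1 [B1 H1]] [q2 [B2 H2]] [q3 [B3 H3]] [q4 [B4 H4]].
      destruct (better q1 q2 B1 B2) as [p [Bp [L1 L2]]].
      destruct (better q3 q4 B3 B4) as [p' [Bp' [L3 L4]]].
      destruct (better p p' Bp Bp') as [q [Bq [L5 L6]]].
      exists q. split; [exact Bq |]. intros s t Hs Ht Hst.
      destruct (Rle_lt_dec s (x + a / 2)); destruct (Rle_lt_dec t (y + b / 2)).
      + specialize (H1 s t ltac:(lra) ltac:(lra) Hst). lra.
      + specialize (H3 s t ltac:(lra) ltac:(lra) Hst). lra.
      + specialize (H2 s t ltac:(lra) ltac:(lra) Hst). lra.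
      + specialize (H4 s t ltac:(lra) ltac:(lra) Hst). lra.
    - intros u v _ _.
      assert (Hclose : forall x y a b d s t, x <= u <= x + a -> y <= v <= y + b ->
        0 < a < d / 2 -> 0 < b < d / 2 -> x <= s <= x + a -> y <= t <= y + b ->
        Cmod (((s, t) : C) - ((u, v) : C))%C < d).
      { intros x y a b d s t Hu Hv Ha Hb Hs Ht.
        eapply Rle_lt_trans; [apply Cmod_le_Re_Im |]. simpl.
        replace d with (d / 2 + d / 2) by field.
        apply Rplus_lt_compat; apply Rabs_def1; lra. }
      destruct (Rle_lt_dec (Cmod (u, v)) rho) as [Hin | Hout].
      + destruct (Hup _ Hin) as [q [Bq Hq]].
        destruct (Hc _ Hin (h q - h (u, v)) ltac:(lra)) as [d [Hd K]].
        exists (d / 2). split; [lra |]. intros x y a b Hu Hv Ha Hb.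
        exists q. split; [exact Bq |]. intros s t Hs Ht _.
        specialize (K (s, t) (Hclose x y a b d s t Hu Hv Ha Hb Hs Ht)).
        apply Rabs_def2 in K. lra.
      + exists ((Cmod (u, v) - rho) / 2). split; [lra |]. intros x y a b Hu Hv Ha Hb.
        exists (RtoC 0). split; [rewrite Cmod_0; exact Hrho |]. intros s t Hs Ht Hst.
        pose proof (Hclose x y a b _ s t Hu Hv Ha Hb Hs Ht) as K.
        rewrite Cmod_sub_sym in K. pose proof (Cmod_triangle_rev (u, v) (s, t)). lra. }
  destruct HG as [q [Bq Hq]].
  pose proof (re_le_Cmod q) as H1. pose proof (im_le_Cmod q) as H2.
  destruct q as [s t]. simpl in H1, H2.
  apply Rabs_le_between in H1. apply Rabs_le_between in H2.
  specialize (Hq s t ltac:(lra) ltac:(lra) Bq). lra.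
Qed.

(** Continuous on the disc and holomorphic off the finite set [F]. Quotients
    by a vanishing factor stay in this class without any theorem on removable
    singularities, and the maximum principle still holds in it. *)
Definition holo_off (F : list C) (f : C -> C) : Prop :=
  forall z, disc z -> ccont f z /\ (~ In z F -> cdiff f z).

Lemma holo_off_of_holomorphic (f : C -> C) : holomorphic_on_disc f -> holo_off nil f.
Proof.
  intros H z Hz. pose proof (proj1 (holomorphic_cdiff f) H z Hz).
  split; [now apply cdiff_ccont | auto].
Qed.

Lemma holo_off_const (F : list C) (c : C) : holo_off F (fun _ => c).
Proof. intros z _. split; [apply ccont_const | intros _; apply cdiff_const]. Qed.

Lemma holo_off_id (F : list C) : holo_off F (fun z => z).
Proof. intros z _. split; [apply ccont_id | intros _; apply cdiff_id]. Qed.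

Lemma holo_off_minus (F : list C) (f g : C -> C) :
  holo_off F f -> holo_off F g -> holo_off F (fun z => f z - g z)%C.
Proof.
  intros Hf Hg z Hz. destruct (Hf z Hz), (Hg z Hz).
  split; [now apply ccont_minus | intros N; apply cdiff_minus; auto].
Qed.

Lemma holo_off_mult (F : list C) (f g : C -> C) :
  holo_off F f -> holo_off F g -> holo_off F (fun z => f z * g z)%C.
Proof.
  intros Hf Hg z Hz. destruct (Hf z Hz), (Hg z Hz).
  split; [now apply ccont_mult | intros N; apply cdiff_mult; auto].
Qed.

Lemma holo_off_div (F : list C) (f g : C -> C) :
  (forall z, disc z -> g z <> RtoC 0) ->
  holo_off F f -> holo_off F g -> holo_off F (fun z => f z / g z)%C.
Proof.
  intros H0 Hf Hg z Hz. destruct (Hf z Hz), (Hg z Hz).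
  split; [apply ccont_div; auto | intros N; apply cdiff_div; auto].
Qed.

Lemma isolated_in_list (F : list C) (z1 : C) :
  exists r, 0 < r /\ forall w, In w F -> w <> z1 -> r <= Cmod (w - z1)%C.
Proof.
  induction F as [|v F [r [Hr K]]].
  - exists 1. split; [lra | intros w []].
  - destruct (Ceq_dec v z1) as [-> | N].
    + exists r. split; [exact Hr |]. intros w [-> | Hw] Hn; [now elim Hn | now apply K].
    + exists (Rmin r (Cmod (v - z1)%C)). split.
      * apply Rmin_pos; [exact Hr |]. now apply Cmod_pos, Csub_neq_0.
      * intros w [<- | Hw] Hn; [apply Rmin_r |].
        eapply Rle_trans; [apply Rmin_l | now apply K].
Qed.

Lemma Cmod_sqr_expand (c w : C) :
  Cmod w ^ 2 = Cmod c ^ 2 + 2 * Re (Cconj c * (w - c))%C + Cmod (w - c)%C ^ 2.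
Proof. rewrite !Cmod_sqr. destruct c, w. simpl. ring. Qed.

Lemma Cmod_sqr_continuous (f : C -> C) (z : C) : ccont f z ->
  forall eps, 0 < eps -> exists del, 0 < del /\
  forall w, Cmod (w - z)%C < del -> Rabs (Cmod (f w) ^ 2 - Cmod (f z) ^ 2) < eps.
Proof.
  intros Hf eps He. pose proof (Cmod_ge_0 (f z)) as Hp.
  set (M := 2 * Cmod (f z) + 1).
  assert (He' : 0 < Rmin 1 (eps / M)).
  { apply Rmin_pos; [lra |]. apply Rdiv_lt_0_compat; unfold M; lra. }
  destruct (Hf _ He') as [d [Hd K]]. exists d. split; [exact Hd |].
  intros w Hw. specialize (K w Hw).
  pose proof (Rmin_l 1 (eps / M)). pose proof (Rmin_r 1 (eps / M)).
  pose proof (Cmod_triangle_rev (f w) (f z)) as T1.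
  pose proof (Cmod_triangle_rev (f z) (f w)) as T2. rewrite Cmod_sub_sym in T2.
  pose proof (Cmod_ge_0 (f w)). pose proof (Cmod_ge_0 (f w - f z)%C).
  set (e := Cmod (f w - f z)%C) in *.
  assert (e * M < eps).
  { apply Rlt_le_trans with (eps / M * M); [apply Rmult_lt_compat_r; unfold M in *; lra |].
    right. field. unfold M. lra. }
  unfold M in *. apply Rabs_def1; nra.
Qed.

(** A point where [|f|^2 + eta |z|^2] is largest in a ball cannot be interior:
    there, [2 conj(c) f + 2 eta conj(z1) z] with [c = f z1] would have a real
    part that is smaller by [eta r^2] on a circle of radius [r] than at its
    centre [z1]. *)
Lemma max_principle (F : list C) (f : C -> C) (M : R) :
  holo_off F f -> 0 <= M ->
  (forall eps, 0 < eps -> exists rho, rho < 1 /\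
     forall z, disc z -> rho < Cmod z -> Cmod (f z) <= M + eps) ->
  forall z, disc z -> Cmod (f z) <= M.
Proof.
  intros Hf HM Hb z0 Hz0. destruct (Rle_lt_dec (Cmod (f z0)) M) as [|Hlt]; [assumption |].
  exfalso.
  set (eps := (Cmod (f z0) - M) / 2). assert (He : 0 < eps) by (unfold eps; lra).
  destruct (Hb eps He) as [rho [Hr K]].
  set (M' := M + eps). assert (HM' : 0 <= M' < Cmod (f z0)) by (unfold M', eps; lra).
  set (eta := (Cmod (f z0) ^ 2 - M' ^ 2) / 2).
  assert (Heta : 0 < eta) by (unfold eta; nra).
  pose proof (Rmax_l rho (Cmod z0)) as L1. pose proof (Rmax_r rho (Cmod z0)) as L2.
  assert (L3 : Rmax rho (Cmod z0) < 1) by (apply Rmax_lub_lt; [exact Hr | exact Hz0]).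
  set (rho1 := (Rmax rho (Cmod z0) + 1) / 2).
  assert (Hr1 : rho < rho1 < 1 /\ Cmod z0 < rho1) by (unfold rho1; lra).
  pose proof (Cmod_ge_0 z0) as Hz0p.
  set (h := fun z => Cmod (f z) ^ 2 + eta * Cmod z ^ 2).
  destruct (max_on_closed_ball h rho1) as [z1 [Bz1 Hmax]]; [lra | |].
  { intros z Hz e Hep. assert (Dz : disc z) by (unfold disc; lra).
    destruct (Cmod_sqr_continuous f z (proj1 (Hf z Dz)) (e / 2) ltac:(lra)) as [d1 [D1 K1]].
    destruct (Cmod_sqr_continuous (fun w => w) z (ccont_id z) (e / 2 / eta)
      (Rdiv_lt_0_compat _ _ (Rdiv_lt_0_compat _ _ Hep Rlt_0_2) Heta)) as [d2 [D2 K2]].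
    exists (Rmin d1 d2). split; [now apply Rmin_pos |]. intros w Hw.
    pose proof (Rmin_l d1 d2). pose proof (Rmin_r d1 d2).
    specialize (K1 w ltac:(lra)). specialize (K2 w ltac:(lra)). simpl in K2.
    unfold h.
    replace (Cmod (f w) ^ 2 + eta * Cmod w ^ 2 - (Cmod (f z) ^ 2 + eta * Cmod z ^ 2))
      with ((Cmod (f w) ^ 2 - Cmod (f z) ^ 2) + eta * (Cmod w ^ 2 - Cmod z ^ 2)) by ring.
    eapply Rle_lt_trans; [apply Rabs_triang |].
    rewrite (Rabs_mult eta), (Rabs_pos_eq eta) by lra.
    apply (Rmult_lt_compat_l eta) in K2; [|exact Heta].
    replace (eta * (e / 2 / eta)) with (e / 2) in K2 by (field; lra).
    simpl in K2 |- *. simpl in K1. lra. }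
  assert (Dz1 : disc z1) by (unfold disc; lra).
  pose proof (Hmax z0 ltac:(lra)) as H0. unfold h in H0.
  pose proof (Cmod_ge_0 z1) as Hz1p. pose proof (Cmod_ge_0 (f z1)) as Hfz1p.
  assert (Hint : Cmod z1 < rho1).
  { destruct Bz1 as [|E]; [assumption | exfalso].
    specialize (K z1 Dz1 ltac:(lra)). fold M' in K.
    assert (Cmod (f z1) ^ 2 <= M' ^ 2) by nra.
    assert (Cmod z1 ^ 2 <= 1) by nra.
    assert (0 <= eta * Cmod z0 ^ 2) by (apply Rmult_le_pos; nra).
    assert (Cmod (f z0) ^ 2 = M' ^ 2 + 2 * eta) by (unfold eta; field).
    nra. }
  destruct (isolated_in_list F z1) as [r0 [Hr0 Kr0]].
  set (r := Rmin r0 (rho1 - Cmod z1) / 2).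
  assert (Hr' : 0 < r /\ r < r0 /\ r < rho1 - Cmod z1).
  { unfold r. pose proof (Rmin_l r0 (rho1 - Cmod z1)). pose proof (Rmin_r r0 (rho1 - Cmod z1)).
    assert (0 < Rmin r0 (rho1 - Cmod z1)) by (apply Rmin_pos; lra). lra. }
  set (c := f z1).
  set (g := fun z => (RtoC 2 * (Cconj c * f z) + RtoC (2 * eta) * (Cconj z1 * z))%C).
  assert (Hball : forall z, Cmod (z - z1)%C <= r -> Cmod z <= rho1).
  { intros z Hz. pose proof (Cmod_triangle_rev z z1). lra. }
  assert (Hg : Re (g z1) <= Re (g z1) - eta * r ^ 2).
  { apply (Re_le_of_circle g z1 r); [lra | | |].
    - apply ccont_plus; apply ccont_mult; try apply ccont_const;
        apply ccont_mult; try apply ccont_const; [apply Hf, Dz1 | apply ccont_id].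
    - intros z [Hz1 Hz2].
      apply cdiff_plus; apply cdiff_mult; try apply cdiff_const;
        apply cdiff_mult; try apply cdiff_const; [|apply cdiff_id].
      assert (Dz : disc z) by (unfold disc; specialize (Hball z Hz2); lra).
      apply (proj2 (Hf z Dz)). intros Hin.
      assert (z <> z1).
      { intros ->. replace (z1 - z1)%C with (RtoC 0) in Hz1 by ring. rewrite Cmod_0 in Hz1. lra. }
      specialize (Kr0 z Hin ltac:(assumption)). lra.
    - intros z Hz. specialize (Hmax z (Hball z ltac:(lra))). unfold h in Hmax.
      rewrite (Cmod_sqr_expand c (f z)), (Cmod_sqr_expand z1 z), Hz in Hmax.
      fold c in Hmax. pose proof (pow2_ge_0 (Cmod (f z - c)%C)).
      assert (E : Re (g z) - Re (g z1)
        = 2 * Re (Cconj c * (f z - c))%C + eta * (2 * Re (Cconj z1 * (z - z1))%C)).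
      { unfold g. fold c. destruct c, z, z1, (f (r1, r2)). simpl. ring. }
      nra. }
  assert (0 < eta * r ^ 2) by (apply Rmult_lt_0_compat; [lra | apply pow_lt; lra]).
  lra.
Qed.

Lemma near_boundary (c : R) : 0 < c ->
  exists rho, 0 <= rho < 1 /\ forall z, disc z -> rho < Cmod z -> 1 - Cmod z ^ 2 < c.
Proof.
  intros Hc. exists (1 - Rmin 1 (c / 2)).
  assert (0 < Rmin 1 (c / 2)) by (apply Rmin_pos; lra).
  pose proof (Rmin_l 1 (c / 2)). pose proof (Rmin_r 1 (c / 2)).
  split; [lra |]. unfold disc. intros z Hz Hr. nra.
Qed.

Definition beta (a z : C) : C := ((z - a) / (1 - Cconj a * z))%C.

(** The pseudo-hyperbolic distance. *)
Definition pdist (a z : C) : R := Cmod (beta a z).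

Lemma pdist_ge_0 (a z : C) : 0 <= pdist a z.
Proof. apply Cmod_ge_0. Qed.

Lemma Cmod_beta (a z : C) : Cmod a <= 1 -> disc z ->
  pdist a z * Cmod (1 - Cconj a * z)%C = Cmod (z - a)%C.
Proof.
  intros Ha Hz. pose proof (one_sub_conj_mul_neq a z Ha Hz) as N. pose proof (Cmod_pos _ N).
  unfold pdist, beta. rewrite Cmod_div by exact N. field. lra.
Qed.

Lemma one_sub_pdist_sqr (a z : C) : Cmod a <= 1 -> disc z ->
  (1 - pdist a z ^ 2) * Cmod (1 - Cconj a * z)%C ^ 2 = (1 - Cmod a ^ 2) * (1 - Cmod z ^ 2).
Proof.
  intros Ha Hz. pose proof (Cmod_beta a z Ha Hz) as E.
  pose proof (Cmod_one_sub_conj_mul a z) as I. rewrite <- E in I. rewrite <- I. ring.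
Qed.

Lemma pdist_lt_1 (a z : C) : disc a -> disc z -> pdist a z < 1.
Proof.
  intros Ha Hz. unfold disc in Ha. pose proof (one_sub_pdist_sqr a z ltac:(lra) Hz) as E.
  pose proof (disc_sqr a Ha). pose proof (disc_sqr z Hz).
  pose proof (one_sub_conj_mul_pos a z ltac:(lra) Hz) as P.
  apply pow_lt with (n := 2%nat) in P. pose proof (pdist_ge_0 a z).
  assert (0 < 1 - pdist a z ^ 2).
  { apply Rmult_lt_reg_r with (1 := P). rewrite E, Rmult_0_l. now apply Rmult_lt_0_compat. }
  nra.
Qed.

Lemma holo_off_beta (F : list C) (a : C) : disc a -> holo_off F (beta a).
Proof.
  intros Ha. unfold disc in Ha. unfold beta. apply holo_off_div.
  - intros z Hz. apply one_sub_conj_mul_neq; [lra | exact Hz].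
  - apply holo_off_minus; [apply holo_off_id | apply holo_off_const].
  - apply holo_off_minus; [apply holo_off_const |].
    apply holo_off_mult; [apply holo_off_const | apply holo_off_id].
Qed.

Lemma pdist_near_boundary (a : C) (t : R) : disc a -> t < 1 ->
  exists rho, 0 <= rho < 1 /\ forall z, disc z -> rho < Cmod z -> t < pdist a z.
Proof.
  intros Ha Ht. unfold disc in Ha. pose proof (Cmod_ge_0 a) as Hap.
  assert (Hmain : 0 <= t -> exists rho, 0 <= rho < 1 /\
    forall z, disc z -> rho < Cmod z -> t < pdist a z).
  { intros Ht0.
    assert (Hc : 0 < (1 - t ^ 2) * (1 - Cmod a) ^ 2).
    { apply Rmult_lt_0_compat; [nra | apply pow_lt; lra]. }
    destruct (near_boundary _ Hc) as [rho [Hr K]]. exists rho. split; [exact Hr |].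
    intros z Hz Hrz. specialize (K z Hz Hrz).
    pose proof (one_sub_pdist_sqr a z ltac:(lra) Hz) as E.
    pose proof (Cmod_one_sub_conj_mul_ge a z) as L. unfold disc in Hz.
    pose proof (Cmod_ge_0 z). pose proof (pdist_ge_0 a z).
    assert (L' : 1 - Cmod a <= Cmod (1 - Cconj a * z)%C) by nra.
    set (D := Cmod (1 - Cconj a * z)%C) in *.
    assert (HD : (1 - Cmod a) ^ 2 <= D ^ 2) by nra.
    assert (0 < (1 - Cmod a) ^ 2) by (apply pow_lt; lra).
    destruct (Rlt_le_dec t (pdist a z)) as [|Hle]; [assumption | exfalso].
    assert (1 - t ^ 2 <= 1 - pdist a z ^ 2) by nra.
    assert ((1 - t ^ 2) * (1 - Cmod a) ^ 2 <= (1 - pdist a z ^ 2) * D ^ 2).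
    { apply Rmult_le_compat; nra. }
    assert (0 <= Cmod a ^ 2) by nra. assert (0 <= 1 - Cmod z ^ 2) by nra. nra. }
  destruct (Rle_lt_dec 0 t) as [H | H]; [now apply Hmain |].
  exists 0. split; [lra |]. intros z _ _. pose proof (pdist_ge_0 a z). lra.
Qed.

(** The slope at the zero provides the quotient. The factor removed has modulus
    tending to one at the circle, so the maximum principle gives the quotient the
    same bound. *)
Lemma schwarz_division (F : list C) (f : C -> C) (a : C) (s : R) :
  holo_off F f -> (forall z, disc z -> Cmod (f z) <= s) ->
  disc a -> ~ In a F -> f a = RtoC 0 ->
  exists f1, holo_off (a :: F) f1 /\ (forall z, disc z -> Cmod (f1 z) <= s) /\
    forall z, disc z -> f z = (beta a z * f1 z)%C.
Proof.
  intros Hf Hs Ha Hin H0. pose proof Ha as Ha'. unfold disc in Ha'.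
  destruct (proj2 (Hf a Ha) Hin) as [q [Hq E]].
  assert (E' : forall z, f z = (q z * (z - a))%C).
  { intros z. rewrite <- E, H0. ring. }
  assert (Hs0 : 0 <= s) by (pose proof (Hs a Ha); pose proof (Cmod_ge_0 (f a)); lra).
  assert (Hden : holo_off (a :: F) (fun z => 1 - Cconj a * z)%C).
  { apply holo_off_minus; [apply holo_off_const |].
    apply holo_off_mult; [apply holo_off_const | apply holo_off_id]. }
  assert (Hq' : holo_off (a :: F) q).
  { intros z Hz. destruct (Ceq_dec z a) as [-> | N].
    - split; [exact Hq |]. intros K. elim K. now left.
    - pose proof (Csub_neq_0 _ _ N) as N'. pose proof (Cmod_pos _ N') as P.
      assert (Hloc : forall w, Cmod (w - z)%C < Cmod (z - a)%C -> (f w / (w - a))%C = q w).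
      { intros w Hw. rewrite E'. field. apply Csub_neq_0. intros ->.
        rewrite Cmod_sub_sym in Hw. lra. }
      split.
      + apply (ccont_local _ q z _ P Hloc). apply ccont_div; [exact N' | apply Hf, Hz |].
        apply ccont_minus; [apply ccont_id | apply ccont_const].
      + intros K. apply (cdiff_local _ q z _ P Hloc). apply cdiff_div; [exact N' | |].
        * apply (proj2 (Hf z Hz)). intros I. apply K. now right.
        * apply cdiff_minus; [apply cdiff_id | apply cdiff_const]. }
  assert (Hfac : forall z, disc z -> f z = (beta a z * (q z * (1 - Cconj a * z)))%C).
  { intros z Hz. rewrite E'. unfold beta. field. apply one_sub_conj_mul_neq; [lra | exact Hz]. }
  assert (Hh : holo_off (a :: F) (fun z => q z * (1 - Cconj a * z))%C) by now apply holo_off_mult.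
  exists (fun z => q z * (1 - Cconj a * z))%C. split; [exact Hh |]. split; [|exact Hfac].
  apply (max_principle _ _ s Hh Hs0). intros eps He.
  assert (Ht : s / (s + eps) < 1).
  { apply Rmult_lt_reg_r with (s + eps); [lra |].
    unfold Rdiv. rewrite Rmult_assoc, Rinv_l by lra. lra. }
  destruct (pdist_near_boundary a _ Ha Ht) as [rho [Hr K]]. exists rho. split; [lra |].
  intros z Hz Hrz. specialize (K z Hz Hrz). specialize (Hs z Hz).
  rewrite (Hfac z Hz), Cmod_mult in Hs. fold (pdist a z) in Hs.
  set (X := Cmod (q z * (1 - Cconj a * z))%C) in *.
  assert (HX : 0 <= X) by apply Cmod_ge_0.
  destruct (Rle_lt_dec X (s + eps)) as [|Hlt]; [assumption | exfalso].
  assert (s = s / (s + eps) * (s + eps)) by (field; lra).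
  assert (0 <= s / (s + eps)) by (apply Rdiv_le_0_compat; lra). nra.
Qed.

Lemma Cmod_sub_le_one_sub_conj_mul (a z : C) : disc a -> Cmod z <= 1 -> Cmod (z - a)%C <= Cmod (1 - Cconj a * z)%C.
Proof.
  intros Ha Hz. apply Cmod_le_sqr.
  pose proof (Cmod_one_sub_conj_mul a z) as I. pose proof (disc_sqr a Ha).
  pose proof (Cmod_ge_0 z). assert (0 <= 1 - Cmod z ^ 2) by nra.
  assert (0 <= (1 - Cmod a ^ 2) * (1 - Cmod z ^ 2)) by (apply Rmult_le_pos; lra). lra.
Qed.

Lemma one_sub_conj_mul_neq_closed (a z : C) :
  disc a -> Cmod z <= 1 -> (1 - Cconj a * z)%C <> RtoC 0.
Proof.
  unfold disc. intros Ha Hz. apply Cmod_pos_neq.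
  pose proof (Cmod_one_sub_conj_mul_ge a z). pose proof (Cmod_ge_0 a). nra.
Qed.

(** A Moebius map moves the value [f a] to [0], and division by the zero at [a]
    does the rest. *)
Lemma schwarz_pick_strict (F : list C) (f : C -> C) (s : R) (a z : C) :
  holo_off F f -> s < 1 -> (forall z, disc z -> Cmod (f z) <= s) ->
  disc a -> ~ In a F -> disc z ->
  Cmod (f z - f a)%C <= pdist a z * Cmod (1 - Cconj (f a) * f z)%C.
Proof.
  intros Hf Hs1 Hs Ha Hin Hz.
  assert (Hfa : disc (f a)) by (unfold disc; specialize (Hs a Ha); lra).
  assert (Hden : forall w, disc w -> (1 - Cconj (f a) * f w)%C <> RtoC 0).
  { intros w Hw. apply one_sub_conj_mul_neq_closed; [exact Hfa | specialize (Hs w Hw); lra]. }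
  set (g := fun w => ((f w - f a) / (1 - Cconj (f a) * f w))%C).
  destruct (schwarz_division F g a 1) as [f1 [_ [B1 E1]]]; [| |exact Ha|exact Hin| |].
  - apply holo_off_div; [exact Hden | |].
    + apply holo_off_minus; [exact Hf | apply holo_off_const].
    + apply holo_off_minus; [apply holo_off_const |].
      apply holo_off_mult; [apply holo_off_const | exact Hf].
  - intros w Hw. unfold g. rewrite Cmod_div by now apply Hden.
    pose proof (Cmod_pos _ (Hden w Hw)) as P.
    apply Rmult_le_reg_r with (Cmod (1 - Cconj (f a) * f w)%C); [exact P |].
    unfold Rdiv. rewrite Rmult_assoc, Rinv_l, Rmult_1_r, Rmult_1_l by lra.
    apply Cmod_sub_le_one_sub_conj_mul; [exact Hfa | specialize (Hs w Hw); lra].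
  - unfold g. replace (f a - f a)%C with (RtoC 0) by ring. unfold Cdiv. ring.
  - specialize (E1 z Hz). specialize (B1 z Hz).
    replace (f z - f a)%C with (g z * (1 - Cconj (f a) * f z))%C
      by (unfold g; field; now apply Hden).
    rewrite E1, !Cmod_mult. fold (pdist a z).
    apply Rmult_le_compat_r; [apply Cmod_ge_0 |].
    pose proof (pdist_ge_0 a z). nra.
Qed.

(** The strict form, applied to [t f] with [t < 1], passes to the limit. Without
    quotients, the inequality also makes sense for unimodular values of [f]. *)
Lemma schwarz_pick (F : list C) (f : C -> C) (a z : C) :
  holo_off F f -> (forall z, disc z -> Cmod (f z) <= 1) ->
  disc a -> ~ In a F -> disc z ->
  Cmod (f z - f a)%C <= pdist a z * Cmod (1 - Cconj (f a) * f z)%C.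
Proof.
  intros Hf H1 Ha Hin Hz.
  set (p := pdist a z). set (A := Cmod (f z - f a)%C). set (x := (Cconj (f a) * f z)%C).
  assert (Hp : 0 <= p) by apply pdist_ge_0. assert (HA : 0 <= A) by apply Cmod_ge_0.
  assert (Hx : Cmod x <= 1).
  { unfold x. rewrite Cmod_mult, Cmod_conj. pose proof (H1 a Ha). pose proof (H1 z Hz).
    pose proof (Cmod_ge_0 (f a)). pose proof (Cmod_ge_0 (f z)). nra. }
  apply le_epsilon. intros eps He.
  set (d := Rmin (1 / 2) (eps / (2 * p + A + 1))).
  assert (Hd : 0 < d).
  { apply Rmin_pos; [lra |]. apply Rdiv_lt_0_compat; lra. }
  assert (Hd2 : d <= 1 / 2) by apply Rmin_l.
  assert (Hde : d * (2 * p + A + 1) <= eps).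
  { apply Rle_trans with (eps / (2 * p + A + 1) * (2 * p + A + 1)).
    - apply Rmult_le_compat_r; [lra | apply Rmin_r].
    - right. field. lra. }
  set (t := 1 - d).
  assert (K : Cmod (RtoC t * f z - RtoC t * f a)%C
    <= p * Cmod (1 - Cconj (RtoC t * f a) * (RtoC t * f z))%C).
  { apply (schwarz_pick_strict F (fun w => RtoC t * f w)%C t); auto.
    - apply holo_off_mult; [apply holo_off_const | exact Hf].
    - unfold t. lra.
    - intros w Hw. rewrite Cmod_mult, Cmod_RtoC_pos by (unfold t; lra).
      specialize (H1 w Hw). unfold t. nra. }
  replace (RtoC t * f z - RtoC t * f a)%C with (RtoC t * (f z - f a))%C in K by ring.
  rewrite Cmod_mult, Cmod_RtoC_pos in K by (unfold t; lra). fold A in K.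
  rewrite Cmult_conj, Cconj_RtoC in K.
  replace (1 - RtoC t * Cconj (f a) * (RtoC t * f z))%C
    with ((1 - x) + RtoC (1 - t * t) * x)%C in K
    by (unfold x; rewrite RtoC_minus, RtoC_mult; ring).
  pose proof (Cmod_triangle (1 - x)%C (RtoC (1 - t * t) * x)%C) as T.
  rewrite Cmod_mult, Cmod_RtoC_pos in T by (unfold t; nra).
  pose proof (Cmod_ge_0 x). pose proof (Cmod_ge_0 (1 - x)%C).
  assert ((1 - t * t) * Cmod x <= 2 * d) by (unfold t; nra).
  assert (p * Cmod (1 - x + RtoC (1 - t * t) * x)%C <= p * (Cmod (1 - x)%C + 2 * d)) by nra.
  unfold t in K at 1. nra.
Qed.

(** * Isometries of the pseudo-hyperbolic distance *)

Lemma Cconj_1 : Cconj (RtoC 1) = RtoC 1.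
Proof. apply Cconj_RtoC. Qed.

Lemma pdist_0_l (z : C) : pdist 0 z = Cmod z.
Proof.
  unfold pdist, beta. rewrite Cconj_RtoC.
  replace ((z - 0) / (1 - 0 * z))%C with z; [reflexivity |].
  replace (1 - 0 * z)%C with (RtoC 1) by ring. unfold Cdiv.
  replace (/ RtoC 1)%C with (RtoC 1) by (field; apply C1_nz). ring.
Qed.

Lemma pdist_sym (a z : C) : disc a -> disc z -> pdist a z = pdist z a.
Proof.
  intros Ha Hz. pose proof Ha as Ha'. pose proof Hz as Hz'. unfold disc in Ha', Hz'.
  unfold pdist, beta.
  rewrite !Cmod_div by (apply one_sub_conj_mul_neq; trivial; lra).
  rewrite Cmod_sub_sym. f_equal. rewrite <- (Cmod_conj (1 - Cconj z * a)%C).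
  f_equal. rewrite Cminus_conj, Cmult_conj, Cconj_conj, Cconj_1. ring.
Qed.

Lemma beta_disc (c z : C) : disc c -> disc z -> disc (beta c z).
Proof. intros Hc Hz. now apply pdist_lt_1. Qed.

Lemma one_sub_mul_conj_neq (a z : C) :
  disc a -> Cmod z <= 1 -> (1 - a * Cconj z)%C <> RtoC 0.
Proof.
  intros Ha Hz. replace (1 - a * Cconj z)%C with (1 - Cconj z * a)%C by ring.
  now apply one_sub_conj_mul_neq.
Qed.

Lemma pdist_beta (c z w : C) : disc c -> disc z -> disc w ->
  pdist (beta c z) (beta c w) = pdist z w.
Proof.
  intros Hc Hz Hw. pose proof Hc as Hc'. pose proof Hz as Hz'. pose proof Hw as Hw'.
  unfold disc in Hc', Hz', Hw'.
  assert (N1 : (1 - Cconj c * z)%C <> RtoC 0) by (apply one_sub_conj_mul_neq; trivial; lra).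
  assert (N2 : (1 - Cconj c * w)%C <> RtoC 0) by (apply one_sub_conj_mul_neq; trivial; lra).
  assert (N3 : (1 - c * Cconj z)%C <> RtoC 0) by (apply one_sub_mul_conj_neq; trivial; lra).
  assert (N4 : (1 - Cconj c * c)%C <> RtoC 0) by (apply one_sub_conj_mul_neq; trivial; lra).
  assert (N5 : (1 - Cconj z * w)%C <> RtoC 0) by (apply one_sub_conj_mul_neq; trivial; lra).
  unfold pdist. unfold beta at 1.
  assert (E1 : (beta c w - beta c z)%C =
    ((1 - Cconj c * c) * (w - z) / ((1 - Cconj c * w) * (1 - Cconj c * z)))%C).
  { unfold beta. field. auto. }
  assert (E2 : (1 - Cconj (beta c z) * beta c w)%C =
    ((1 - Cconj c * c) * (1 - Cconj z * w) / ((1 - c * Cconj z) * (1 - Cconj c * w)))%C).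
  { unfold beta. rewrite Cdiv_conj by exact N1.
    rewrite !Cminus_conj, Cmult_conj, Cconj_conj, Cconj_1. field. auto. }
  rewrite E1, E2.
  replace ((1 - Cconj c * c) * (w - z) / ((1 - Cconj c * w) * (1 - Cconj c * z)) /
   ((1 - Cconj c * c) * (1 - Cconj z * w) / ((1 - c * Cconj z) * (1 - Cconj c * w))))%C
   with (beta z w * ((1 - c * Cconj z) / (1 - Cconj c * z)))%C
   by (unfold beta; field; auto).
  rewrite Cmod_mult, Cmod_div by exact N1.
  assert (E3 : Cmod (1 - c * Cconj z)%C = Cmod (1 - Cconj c * z)%C).
  { rewrite <- (Cmod_conj (1 - Cconj c * z)%C). f_equal.
    now rewrite Cminus_conj, Cmult_conj, Cconj_conj, Cconj_1. }
  rewrite E3. field. pose proof (Cmod_pos _ N1). lra.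
Qed.

Lemma self_map_contracts (phi : C -> C) (z w : C) :
  holomorphic_self_map phi -> disc z -> disc w ->
  pdist (phi z) (phi w) <= pdist z w.
Proof.
  intros [Hh Hd] Hz Hw.
  pose proof (schwarz_pick nil phi z w (holo_off_of_holomorphic phi Hh)
    (fun v Hv => Rlt_le _ _ (Hd v Hv)) Hz (fun H => H) Hw) as K.
  pose proof (Hd z Hz) as Dz. pose proof (Hd w Hw) as Dw.
  rewrite <- Cmod_beta in K by (unfold disc in *; trivial; lra).
  apply Rmult_le_reg_r with (2 := K). apply one_sub_conj_mul_pos; trivial.
  unfold disc in Dz. lra.
Qed.

Definition mobius (phi : C -> C) (u a : C) : Prop :=
  Cmod u = 1 /\ disc a /\ forall z, disc z -> phi z = (u * beta a z)%C.

(** The slopes of the conjugation at the origin are [1] along the real axis and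
    [-1] along the imaginary one. *)
Lemma conj_not_cdiff (k : C -> C) :
  cdiff k 0 -> exists z, disc z /\ k z <> Cconj z.
Proof.
  intros [q [Hq E]]. apply NNPP. intros Hno.
  assert (K : forall z, disc z -> k z = Cconj z).
  { intros z Hz. apply NNPP. intros N. apply Hno. now exists z. }
  destruct (Hq 1 Rlt_0_1) as [d [Hd Q]].
  set (t := Rmin d 1 / 2).
  assert (Ht : 0 < t /\ t < d /\ t < 1).
  { unfold t. pose proof (Rmin_l d 1). pose proof (Rmin_r d 1).
    assert (0 < Rmin d 1) by (apply Rmin_pos; lra). lra. }
  assert (Ct : RtoC t <> RtoC 0) by (apply Cmod_pos_neq; rewrite Cmod_RtoC_pos; lra).
  assert (M1 : Cmod (RtoC t) = t) by (apply Cmod_RtoC_pos; lra).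
  assert (M2 : Cmod (Ci * RtoC t)%C = t) by (rewrite Cmod_mult, Cmod_Ci, M1; ring).
  assert (K0 : k 0 = RtoC 0) by (rewrite K by apply disc_0; apply Cconj_RtoC).
  assert (Ci_conj : Cconj Ci = (- Ci)%C).
  { unfold Cconj, Ci, Copp. simpl. f_equal; ring. }
  assert (q1 : q (RtoC t) = RtoC 1).
  { pose proof (E (RtoC t)) as F. rewrite K0, K, Cconj_RtoC in F by (unfold disc; lra).
    replace (q (RtoC t)) with (q (RtoC t) * (RtoC t - 0) / RtoC t)%C by (now field).
    rewrite <- F. now field. }
  assert (q2 : q (Ci * RtoC t)%C = (- RtoC 1)%C).
  { pose proof (E (Ci * RtoC t)%C) as F.
    rewrite K0, K, Cmult_conj, Cconj_RtoC, Ci_conj in F by (unfold disc; lra).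
    replace (q (Ci * RtoC t)%C) with (q (Ci * RtoC t) * (Ci * RtoC t - 0) / (Ci * RtoC t))%C
      by (field; split; [exact Ct | exact Ci_nz]).
    rewrite <- F. field. split; [exact Ct | exact Ci_nz]. }
  pose proof (Q (RtoC t)) as B1. pose proof (Q (Ci * RtoC t)%C) as B2.
  replace (RtoC t - 0)%C with (RtoC t) in B1 by ring.
  replace (Ci * RtoC t - 0)%C with (Ci * RtoC t)%C in B2 by ring.
  specialize (B1 ltac:(lra)). specialize (B2 ltac:(lra)). rewrite q1 in B1. rewrite q2 in B2.
  rewrite Cmod_sub_sym in B2.
  pose proof (Cmod_triangle (1 - q 0)%C (q 0 - - (1))%C) as T.
  replace (1 - q 0 + (q 0 - - (1)))%C with (RtoC 2) in T.
  - rewrite Cmod_RtoC_pos in T by lra. lra.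
  - replace (RtoC 2) with (RtoC 1 + RtoC 1)%C by (rewrite <- RtoC_plus; f_equal; ring). ring.
Qed.

(** An isometry fixing the origin preserves the real inner product, so it is
    linear over the reals, a rotation or a rotated conjugation; being
    holomorphic leaves only the rotation. *)
Lemma isometry_fixing_0 (g : C -> C) :
  cdiff g 0 -> g 0 = RtoC 0 -> (forall z, disc z -> disc (g z)) ->
  (forall z w, disc z -> disc w -> pdist (g z) (g w) = pdist z w) ->
  exists u, Cmod u = 1 /\ forall z, disc z -> g z = (u * z)%C.
Proof.
  intros Hg H0 Hd Hiso.
  assert (Hmod : forall z, disc z -> Cmod (g z) = Cmod z).
  { intros z Hz. pose proof (Hiso 0 z disc_0 Hz) as E. rewrite H0, !pdist_0_l in E. exact E. }
  assert (Hre : forall w z, disc w -> disc z ->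
    Re (Cconj (g w) * g z)%C = Re (Cconj w * z)%C).
  { intros w z Hw Hz.
    pose proof (one_sub_pdist_sqr w z ltac:(unfold disc in Hw; lra) Hz) as E1.
    pose proof (one_sub_pdist_sqr (g w) (g z)
      ltac:(pose proof (Hd w Hw) as K; unfold disc in K; lra) (Hd z Hz)) as E2.
    rewrite Hiso, !Hmod in E2 by assumption. rewrite <- E1 in E2.
    pose proof (pdist_lt_1 w z Hw Hz) as Hp. pose proof (pdist_ge_0 w z).
    apply Rmult_eq_reg_l in E2; [|nra].
    assert (X : forall x : C, Cmod (1 - x)%C ^ 2 = 1 - 2 * Re x + Cmod x ^ 2).
    { intros [x y]. rewrite !Cmod_sqr. simpl. ring. }
    rewrite !X, !Cmod_mult, !Cmod_conj, !Hmod in E2 by assumption. lra. }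
  assert (Hh : disc (RtoC (1 / 2))) by (unfold disc; rewrite Cmod_RtoC_pos; lra).
  assert (Hih : disc (0, 1 / 2)).
  { unfold disc. replace ((0, 1 / 2) : C) with (Ci * RtoC (1 / 2))%C
      by (unfold Ci, RtoC, Cmult; simpl; f_equal; ring).
    rewrite Cmod_mult, Cmod_Ci, Cmod_RtoC_pos; lra. }
  set (b := (RtoC 2 * g (RtoC (1 / 2)))%C).
  assert (Hb : Cmod b = 1).
  { unfold b. rewrite Cmod_mult, Hmod by exact Hh. rewrite !Cmod_RtoC_pos; lra. }
  pose proof (Cconj_unit b Hb) as Hbb.
  set (k := fun z => (Cconj b * g z)%C).
  assert (Hk1 : forall z, disc z -> Re (k z) = Re z).
  { intros z Hz. pose proof (Hre _ z Hh Hz) as E. unfold k, b.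
    rewrite Cmult_conj, Cconj_RtoC.
    destruct (g (RtoC (1 / 2))), (g z), z. simpl in E |- *. lra. }
  assert (Hk2 : forall w z, disc w -> disc z -> Re (Cconj (k w) * k z)%C = Re (Cconj w * z)%C).
  { intros w z Hw Hz. rewrite <- (Hre w z) by assumption. unfold k. f_equal.
    rewrite Cmult_conj, Cconj_conj.
    transitivity (Cconj b * b * (Cconj (g w) * g z))%C; [ring | rewrite Hbb; ring]. }
  assert (Hs : exists sg, (sg = 1 \/ sg = -1) /\
    forall z, disc z -> Im (k z) = sg * Im z).
  { pose proof (Hk1 _ Hih) as K1. pose proof (Hk2 _ _ Hih Hih) as K2.
    exists (2 * Im (k (0, 1 / 2))).
    assert (Hsq : (2 * Im (k (0, 1 / 2))) ^ 2 = 1).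
    { destruct (k (0, 1 / 2)). simpl in K1, K2 |- *. nra. }
    assert (Hsg : 2 * Im (k (0, 1 / 2)) = 1 \/ 2 * Im (k (0, 1 / 2)) = -1).
    { assert (E : (2 * Im (k (0, 1 / 2)) - 1) * (2 * Im (k (0, 1 / 2)) + 1) = 0) by nra.
      apply Rmult_integral in E. destruct E; [left | right]; lra. }
    split; [exact Hsg |]. intros z Hz. pose proof (Hk2 _ _ Hih Hz) as K3.
    destruct (k (0, 1 / 2)) as [k1 k2], (k z) as [z1 z2], z as [x y].
    simpl in K1, K3, Hsg |- *. rewrite K1 in K3. destruct Hsg; nra. }
  destruct Hs as [sg [[-> | ->] Him]].
  - exists b. split; [exact Hb |]. intros z Hz.
    assert (Ek : k z = z).
    { specialize (Hk1 z Hz). specialize (Him z Hz). destruct (k z), z.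
      simpl in Hk1, Him. f_equal; lra. }
    rewrite <- Ek at 2. unfold k. rewrite Cmult_assoc, (Cmult_comm b), Hbb. ring.
  - exfalso. destruct (conj_not_cdiff k) as [z [Hz N]].
    + apply cdiff_mult; [apply cdiff_const | exact Hg].
    + apply N. specialize (Hk1 z Hz). specialize (Him z Hz). destruct (k z), z.
      unfold Cconj. simpl in Hk1, Him |- *. f_equal; lra.
Qed.

Lemma isometry_mobius (phi : C -> C) :
  holomorphic_self_map phi ->
  (forall z w, disc z -> disc w -> pdist z w <= pdist (phi z) (phi w)) ->
  exists u a, mobius phi u a.
Proof.
  intros Hphi Hge. pose proof Hphi as [Hh Hd].
  set (c := phi 0). assert (Hc : disc c) by apply Hd, disc_0.
  pose proof Hc as Hc'. unfold disc in Hc'.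
  destruct (isometry_fixing_0 (fun z => beta c (phi z))) as [b [Hb Eb]].
  - apply (cdiff_comp (beta c) phi).
    + now apply holomorphic_cdiff; [|apply disc_0].
    + apply (proj2 (holo_off_beta nil c Hc (phi 0) Hc)). intros [].
  - unfold beta. fold c. replace (c - c)%C with (RtoC 0) by ring. unfold Cdiv. ring.
  - intros z Hz. apply beta_disc; auto.
  - intros z w Hz Hw. rewrite pdist_beta by auto.
    apply Rle_antisym; [now apply self_map_contracts | now apply Hge].
  - exists b, (- (Cconj b * c))%C. split; [exact Hb |]. split.
    + unfold disc. rewrite Cmod_opp, Cmod_mult, Cmod_conj, Hb. lra.
    + intros z Hz. specialize (Eb z Hz). pose proof (Cconj_unit b Hb) as Hbb.
      assert (N : (1 - Cconj c * phi z)%C <> RtoC 0)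
        by (apply one_sub_conj_mul_neq; [lra | now apply Hd]).
      assert (N2 : (1 - Cconj (- (Cconj b * c)) * z)%C <> RtoC 0).
      { apply one_sub_conj_mul_neq; [|exact Hz].
        rewrite Cmod_opp, Cmod_mult, Cmod_conj, Hb. lra. }
      assert (E1 : (phi z - c)%C = (b * z * (1 - Cconj c * phi z))%C).
      { rewrite <- Eb. unfold beta. now field. }
      unfold beta. rewrite Copp_conj, Cmult_conj, Cconj_conj in *.
      assert (E2 : (phi z * (1 - - (b * Cconj c) * z))%C = (b * (z - - (Cconj b * c)))%C).
      { transitivity (phi z - c + c + b * Cconj c * z * phi z)%C; [ring |]. rewrite E1.
        transitivity (b * z + (Cconj b * b) * c)%C; [rewrite Hbb; ring | ring]. }
      replace (phi z) with (phi z * (1 - - (b * Cconj c) * z) / (1 - - (b * Cconj c) * z))%C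
        by (now field).
      rewrite E2. unfold Cdiv. ring.
Qed.

Lemma pdist_rotation (u x y : C) :
  Cmod u = 1 -> disc x -> disc y -> pdist (u * x)%C (u * y)%C = pdist x y.
Proof.
  intros Hu Hx Hy. unfold pdist, beta.
  replace (u * y - u * x)%C with (u * (y - x))%C by ring.
  rewrite Cmult_conj.
  replace (Cconj u * Cconj x * (u * y))%C with ((Cconj u * u) * (Cconj x * y))%C by ring.
  rewrite (Cconj_unit u Hu), Cmult_1_l.
  rewrite !Cmod_div by (apply one_sub_conj_mul_neq; [unfold disc in Hx; lra | exact Hy]).
  rewrite Cmod_mult, Hu. f_equal. ring.
Qed.

Lemma mobius_isometry (phi : C -> C) (u a z w : C) :
  mobius phi u a -> disc z -> disc w -> pdist (phi z) (phi w) = pdist z w.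
Proof.
  intros [Hu [Ha E]] Hz Hw. rewrite !E by assumption. rewrite <- (pdist_beta a z w) by assumption.
  apply pdist_rotation; [exact Hu | now apply beta_disc | now apply beta_disc].
Qed.

Lemma mobius_self_map (phi : C -> C) (u a : C) : mobius phi u a -> holomorphic_self_map phi.
Proof.
  intros [Hu [Ha E]]. split.
  - apply holomorphic_cdiff. intros z Hz.
    apply (cdiff_disc_ext (fun z => u * beta a z)%C); [|exact Hz|].
    + intros w Hw. symmetry. now apply E.
    + apply cdiff_mult; [apply cdiff_const |].
      apply (proj2 (holo_off_beta nil a Ha z Hz)). intros [].
  - intros z Hz. unfold disc. rewrite E by exact Hz.
    rewrite Cmod_mult, Hu, Rmult_1_l. now apply beta_disc.
Qed.

Lemma mobius_inverse (phi : C -> C) (u a : C) : mobius phi u a ->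
  exists psi v b, mobius psi v b /\ inverse_on_disc phi psi.
Proof.
  intros Hm. pose proof Hm as [Hu [Ha E]]. pose proof Ha as Ha'. unfold disc in Ha'.
  pose proof (Cconj_unit u Hu) as Huu.
  assert (Hb : disc (- (u * a))%C).
  { unfold disc. rewrite Cmod_opp, Cmod_mult, Hu. lra. }
  set (psi := fun z => (Cconj u * beta (- (u * a)) z)%C).
  assert (Hpsi : mobius psi (Cconj u) (- (u * a))%C).
  { split; [now rewrite Cmod_conj | split; [exact Hb | reflexivity]]. }
  exists psi, (Cconj u), (- (u * a))%C. split; [exact Hpsi |].
  assert (N0 : (1 - Cconj a * a)%C <> RtoC 0) by (apply one_sub_conj_mul_neq; trivial; lra).
  assert (Hu0 : u <> RtoC 0) by (apply Cmod_pos_neq; lra).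
  assert (Eu : Cconj u = (/ u)%C).
  { replace (Cconj u) with (Cconj u * u * / u)%C by (field; exact Hu0). rewrite Huu. ring. }
  split; [exact (mobius_self_map psi _ _ Hpsi) |]. split; intros z Hz.
  - assert (N1 : (1 - Cconj a * z)%C <> RtoC 0) by (apply one_sub_conj_mul_neq; trivial; lra).
    pose proof (proj2 (mobius_self_map phi u a Hm) z Hz) as Dz.
    assert (N2 : (1 - Cconj (- (u * a)) * phi z)%C <> RtoC 0)
      by (apply one_sub_conj_mul_neq; [unfold disc in Hb; lra | exact Dz]).
    rewrite E in N2 |- * by exact Hz. unfold psi, beta in *.
    rewrite Copp_conj, Cmult_conj, Eu in *. field. repeat split; auto.
    + intros K. apply N0. rewrite <- K. ring.
  - assert (Db : disc (psi z)) by (now apply (mobius_self_map psi _ _ Hpsi)).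
    rewrite E by exact Db.
    assert (N1 : (1 - Cconj (- (u * a)) * z)%C <> RtoC 0)
      by (apply one_sub_conj_mul_neq; [unfold disc in Hb; lra | exact Hz]).
    assert (N2 : (1 - Cconj a * psi z)%C <> RtoC 0) by (apply one_sub_conj_mul_neq; trivial; lra).
    unfold psi, beta in *.
    rewrite Copp_conj, Cmult_conj, Eu in *.
    assert (N3 : (u + Cconj a * z)%C <> RtoC 0).
    { intros K. apply N1. replace (1 - - (/ u * Cconj a) * z)%C with ((u + Cconj a * z) / u)%C
        by (field; exact Hu0). rewrite K. unfold Cdiv. ring. }
    field. repeat split; auto.
    + intros K. apply N3. rewrite <- K. ring.
    + intros K. apply N0.
      replace (1 - Cconj a * a)%C with ((u - - Cconj a * z - Cconj a * (z - - (u * a))) / u)%C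
        by (field; exact Hu0).
      rewrite K. unfold Cdiv. ring.
Qed.

Lemma automorphism_mobius (phi : C -> C) : automorphism phi -> exists u a, mobius phi u a.
Proof.
  intros [Hphi [psi [Hpsi [E1 _]]]]. apply isometry_mobius; [exact Hphi |].
  intros z w Hz Hw. rewrite <- (E1 z Hz) at 1. rewrite <- (E1 w Hw) at 1.
  apply self_map_contracts; [exact Hpsi | now apply Hphi | now apply Hphi].
Qed.

Lemma mobius_automorphism (phi : C -> C) (u a : C) : mobius phi u a -> automorphism phi.
Proof.
  intros H. split; [now apply (mobius_self_map phi u a) |].
  destruct (mobius_inverse phi u a H) as [psi [v [b [_ Hi]]]]. now exists psi.
Qed.

(** * Normal form in a half-plane *)

(** The map of the disc onto the right half-plane that sends [p] to infinity. *)
Definition cayley (p z : C) : C := ((p + z) / (p - z))%C.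

Lemma unit_sub_neq (p z : C) : Cmod p = 1 -> disc z -> (p - z)%C <> RtoC 0.
Proof.
  unfold disc. intros Hp Hz. apply Cmod_pos_neq. pose proof (Cmod_triangle_rev p z). lra.
Qed.

Lemma unit_neq_0 (p : C) : Cmod p = 1 -> p <> RtoC 0.
Proof. intros H. apply Cmod_pos_neq. lra. Qed.

Lemma Cconj_unit_inv (p : C) : Cmod p = 1 -> Cconj p = (/ p)%C.
Proof.
  intros H. pose proof (unit_neq_0 p H).
  replace (Cconj p) with (Cconj p * p * / p)%C by (now field).
  rewrite (Cconj_unit p H). ring.
Qed.

Lemma Re_cayley (p z : C) : Cmod p = 1 -> z <> p ->
  Re (cayley p z) * Cmod (p - z)%C ^ 2 = 1 - Cmod z ^ 2.
Proof.
  intros Hp Hn. assert (N : (p - z)%C <> RtoC 0) by (now apply Csub_neq_0; apply not_eq_sym).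
  assert (E : ((p + z) * Cconj (p - z))%C = (cayley p z * RtoC (Cmod (p - z)%C ^ 2))%C).
  { rewrite <- Cmod_conj_mul. unfold cayley. now field. }
  assert (E2 : Re (cayley p z * RtoC (Cmod (p - z)%C ^ 2))%C
    = Re (cayley p z) * Cmod (p - z)%C ^ 2) by apply re_scal_r.
  rewrite <- E2, <- E. replace 1 with (Cmod p ^ 2) by (rewrite Hp; ring).
  rewrite !Cmod_sqr. destruct p, z. simpl. ring.
Qed.

Lemma unit_disc_neq (p z : C) : Cmod p = 1 -> disc z -> z <> p.
Proof. unfold disc. intros Hp Hz ->. lra. Qed.

Lemma Re_cayley_pos (p z : C) : Cmod p = 1 -> disc z -> 0 < Re (cayley p z).
Proof.
  intros Hp Hz. pose proof (Re_cayley p z Hp (unit_disc_neq p z Hp Hz)) as E.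
  pose proof (disc_sqr z Hz) as D. rewrite <- E in D.
  pose proof (Cmod_pos _ (unit_sub_neq p z Hp Hz)) as P.
  apply Rmult_lt_reg_r with (Cmod (p - z)%C ^ 2); [now apply pow_lt | lra].
Qed.

Lemma cayley_0 (p : C) : Cmod p = 1 -> cayley p 0 = RtoC 1.
Proof. intros Hp. pose proof (unit_neq_0 p Hp). unfold cayley. now field. Qed.

Lemma Re_ge_0_add_1 (s : C) : 0 <= Re s -> (s + 1)%C <> RtoC 0.
Proof.
  intros H E. assert (K : Re (s + 1)%C = 0) by (rewrite E; reflexivity).
  destruct s. simpl in *. lra.
Qed.

Lemma RtoC_2 : RtoC 2 = (RtoC 1 + RtoC 1)%C.
Proof. now rewrite <- RtoC_plus. Qed.

Lemma RtoC_2_neq : RtoC 2 <> RtoC 0.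
Proof. apply Cmod_pos_neq. rewrite Cmod_RtoC_pos; lra. Qed.

Lemma cayley_add_1 (p z : C) : z <> p -> ((cayley p z + 1) * (p - z))%C = (RtoC 2 * p)%C.
Proof.
  intros Hn. assert (N : (p - z)%C <> RtoC 0) by (now apply Csub_neq_0; apply not_eq_sym).
  unfold cayley. rewrite RtoC_2. now field.
Qed.

Lemma Cmod_cayley_add_1 (p z : C) : Cmod p = 1 -> z <> p ->
  Cmod (cayley p z + 1)%C * Cmod (p - z)%C = 2.
Proof.
  intros Hp Hn. rewrite <- Cmod_mult, cayley_add_1, Cmod_mult, Hp, Cmod_RtoC_pos by (trivial; lra).
  ring.
Qed.

Lemma cayley_inv (p z : C) : Cmod p = 1 -> z <> p ->
  z = (p * (cayley p z - 1) / (cayley p z + 1))%C.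
Proof.
  intros Hp Hn. assert (N : (p - z)%C <> RtoC 0) by (now apply Csub_neq_0; apply not_eq_sym).
  pose proof (unit_neq_0 p Hp) as Np. pose proof (cayley_add_1 p z Hn) as E.
  assert (N1 : (cayley p z + 1)%C <> RtoC 0).
  { intros K. rewrite K in E. apply (Cmult_neq_0 _ _ RtoC_2_neq Np). rewrite <- E. ring. }
  assert (E2 : ((cayley p z - 1) * (p - z))%C = (RtoC 2 * z)%C)
    by (unfold cayley; rewrite RtoC_2; now field).
  replace (p * (cayley p z - 1) / (cayley p z + 1))%C
    with (p * ((cayley p z - 1) * (p - z)) / ((cayley p z + 1) * (p - z)))%C by (now field).
  rewrite E, E2. now field.
Qed.

Lemma cayley_of_inv (p s : C) : Cmod p = 1 -> (s + 1)%C <> RtoC 0 ->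
  cayley p (p * (s - 1) / (s + 1))%C = s.
Proof.
  intros Hp Hs. pose proof (unit_neq_0 p Hp) as Np.
  unfold cayley.
  replace (p + p * (s - 1) / (s + 1))%C with (RtoC 2 * p * s / (s + 1))%C
    by (rewrite RtoC_2; now field).
  replace (p - p * (s - 1) / (s + 1))%C with (RtoC 2 * p / (s + 1))%C
    by (rewrite RtoC_2; now field).
  field. repeat split; trivial; try apply RtoC_2_neq.
Qed.

Lemma cayley_inj (p z w : C) : Cmod p = 1 -> z <> p -> w <> p ->
  cayley p z = cayley p w -> z = w.
Proof.
  intros Hp Hz Hw E. rewrite (cayley_inv p z Hp Hz), (cayley_inv p w Hp Hw). now rewrite E.
Qed.

(** In the half-plane with [p] at infinity, [phi] is the affine map
    [s |-> mu s + i tau]. *)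
Definition normal_form (phi : C -> C) (p : C) (mu tau : R) : Prop :=
  Cmod p = 1 /\ 0 < mu /\
  forall z, disc z -> disc (phi z) /\
    cayley p (phi z) = (RtoC mu * cayley p z + Ci * RtoC tau)%C.

Lemma Csqrt_exists (w : C) : exists s : C, (s * s)%C = w.
Proof.
  destruct w as [a b]. pose proof (Cmod_sqr (a, b)) as E. simpl Re in E. simpl Im in E.
  pose proof (re_le_Cmod (a, b)) as H. simpl in H. apply Rabs_le_between in H.
  set (m := Cmod (a, b)) in *.
  pose proof (sqrt_sqrt ((m + a) / 2) ltac:(lra)) as Ex.
  pose proof (sqrt_sqrt ((m - a) / 2) ltac:(lra)) as Ey.
  pose proof (sqrt_pos ((m + a) / 2)) as Px. pose proof (sqrt_pos ((m - a) / 2)) as Py.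
  set (x := sqrt ((m + a) / 2)) in *. set (y := sqrt ((m - a) / 2)) in *.
  assert (Exy : (2 * (x * y)) ^ 2 = b ^ 2).
  { replace ((2 * (x * y)) ^ 2) with (4 * ((x * x) * (y * y))) by ring.
    rewrite Ex, Ey. nra. }
  assert (K : 2 * (x * y) = b \/ 2 * (x * y) = - b).
  { assert (Z : (2 * (x * y) - b) * (2 * (x * y) + b) = 0) by nra.
    apply Rmult_integral in Z. destruct Z; [left | right]; lra. }
  destruct K as [K | K].
  - exists (x, y). unfold Cmult. simpl. f_equal; nra.
  - exists (x, - y). unfold Cmult. simpl. f_equal; nra.
Qed.

Lemma quadratic_roots (A B D : C) : A <> RtoC 0 -> exists z1 z2 : C,
  forall z, (A * z * z + B * z + D)%C = (A * (z - z1) * (z - z2))%C.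
Proof.
  intros HA. destruct (Csqrt_exists (B * B - RtoC 4 * A * D)%C) as [s Hs].
  exists ((- B + s) / (RtoC 2 * A))%C, ((- B - s) / (RtoC 2 * A))%C. intros z.
  assert (E4 : RtoC 4 = (RtoC 2 * RtoC 2)%C) by (rewrite <- RtoC_mult; f_equal; ring).
  replace (A * (z - (- B + s) / (RtoC 2 * A)) * (z - (- B - s) / (RtoC 2 * A)))%C
    with (A * z * z + B * z + (B * B - s * s) / (RtoC 2 * RtoC 2 * A))%C.
  - rewrite Hs, E4. now field.
  - now field.
Qed.

(** The fixed points of a Moebius map of the disc solve a quadratic equation
    whose roots have a product of modulus one, so a map without fixed points in
    the disc has one on the circle. *)
Lemma mobius_boundary_fixed (phi : C -> C) (u a : C) :
  mobius phi u a -> (forall z, disc z -> phi z <> z) ->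
  exists p, Cmod p = 1 /\ (p * (1 - Cconj a * p))%C = (u * (p - a))%C.
Proof.
  intros [Hu [Ha E]] Hno. pose proof Ha as Ha'. unfold disc in Ha'.
  assert (Na : a <> RtoC 0).
  { intros ->. apply (Hno 0 disc_0). rewrite (E 0 disc_0). unfold beta. rewrite Cconj_RtoC.
    unfold Cdiv. ring. }
  assert (NA : Cconj a <> RtoC 0).
  { apply Cmod_pos_neq. rewrite Cmod_conj. now apply Cmod_pos. }
  destruct (quadratic_roots (Cconj a) (u - 1)%C (- (u * a))%C NA) as [z1 [z2 Hq]].
  assert (Hprod : Cmod z1 * Cmod z2 = 1).
  { pose proof (Hq 0) as H. apply (f_equal Cmod) in H.
    replace (Cconj a * 0 * 0 + (u - 1) * 0 + - (u * a))%C with (- (u * a))%C in H by ring.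
    replace (Cconj a * (0 - z1) * (0 - z2))%C with (Cconj a * (z1 * z2))%C in H by ring.
    rewrite Cmod_opp, !Cmod_mult, Hu, Cmod_conj in H. pose proof (Cmod_pos a Na).
    apply Rmult_eq_reg_l with (Cmod a); lra. }
  assert (Hroot : forall z, (z = z1 \/ z = z2) ->
    (z * (1 - Cconj a * z))%C = (u * (z - a))%C).
  { intros z Hz. symmetry. apply Csub_eq_0.
    transitivity (Cconj a * z * z + (u - 1) * z + - (u * a))%C; [ring |].
    rewrite Hq. destruct Hz as [-> | ->]; ring. }
  assert (Hunit : forall z, (z = z1 \/ z = z2) -> Cmod z <= 1 -> Cmod z = 1).
  { intros z Hz [Hlt | Heq]; [exfalso | exact Heq].
    apply (Hno z Hlt). rewrite (E z Hlt). unfold beta.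
    pose proof (one_sub_conj_mul_neq a z ltac:(lra) Hlt) as N.
    replace (u * ((z - a) / (1 - Cconj a * z)))%C with (u * (z - a) / (1 - Cconj a * z))%C
      by (now field).
    rewrite <- (Hroot z Hz). now field. }
  pose proof (Cmod_ge_0 z1). pose proof (Cmod_ge_0 z2).
  destruct (Rle_lt_dec (Cmod z1) 1) as [H1 | H1].
  - exists z1. split; [apply Hunit; auto | apply Hroot; auto].
  - exists z2. split; [apply Hunit; auto; nra | apply Hroot; auto].
Qed.

(** The fixed-point equation expresses the rotation factor through [p] and [a],
    which makes the slope of the conjugated map positive and its translation
    imaginary. *)
Lemma normal_form_of_fixed (phi : C -> C) (u a p : C) :
  mobius phi u a -> Cmod p = 1 -> (p * (1 - Cconj a * p))%C = (u * (p - a))%C ->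
  exists mu tau, normal_form phi p mu tau.
Proof.
  intros Hm Hp Hfix. pose proof Hm as [Hu [Ha E]]. pose proof Ha as Ha'. unfold disc in Ha'.
  pose proof (disc_sqr a Ha) as Da.
  pose proof (unit_neq_0 p Hp) as Np. pose proof (unit_sub_neq p a Hp Ha) as Npa.
  assert (Pfix : 0 < Cmod (1 - Cconj a * p)%C).
  { pose proof (Cmod_one_sub_conj_mul_ge a p). rewrite Hp in *. lra. }
  set (mu := Cmod (1 - Cconj a * p)%C ^ 2 / (1 - Cmod a ^ 2)).
  set (tau := 2 * Im (Cconj a * p)%C / (1 - Cmod a ^ 2)).
  exists mu, tau. split; [exact Hp |]. split.
  { unfold mu. apply Rdiv_lt_0_compat; [now apply pow_lt | exact Da]. }
  intros z Hz. split; [now apply (mobius_self_map phi u a Hm) |].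
  assert (ND : RtoC (1 - Cmod a ^ 2) <> RtoC 0).
  { apply Cmod_pos_neq. rewrite Cmod_RtoC_pos; lra. }
  assert (EA : RtoC (1 - Cmod a ^ 2) = (1 - Cconj a * a)%C)
    by (rewrite RtoC_minus, Cmod_conj_mul; reflexivity).
  assert (Emu : RtoC mu = ((1 - Cconj a * p) * (1 - a * / p) / (1 - Cconj a * a))%C).
  { unfold mu. rewrite RtoC_div by lra. rewrite EA, <- Cmod_conj_mul.
    rewrite Cminus_conj, Cmult_conj, Cconj_conj, Cconj_1, (Cconj_unit_inv p Hp).
    unfold Cdiv. ring. }
  assert (Etau : (Ci * RtoC tau)%C = ((Cconj a * p - a * / p) / (1 - Cconj a * a))%C).
  { unfold tau. rewrite RtoC_div by lra. rewrite EA, <- (Cconj_unit_inv p Hp).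
    replace (a * Cconj p)%C with (Cconj (Cconj a * p))%C by (rewrite Cmult_conj, Cconj_conj; ring).
    rewrite im_alt'. rewrite RtoC_mult. unfold Cdiv. ring. }
  rewrite Emu, Etau, (E z Hz). rewrite EA in ND.
  assert (Nz : (1 - Cconj a * z)%C <> RtoC 0) by (apply one_sub_conj_mul_neq; trivial; lra).
  assert (Npz : (p - z)%C <> RtoC 0) by (now apply unit_sub_neq).
  assert (Eu : u = (p * (1 - Cconj a * p) / (p - a))%C).
  { rewrite Hfix. now field. }
  unfold cayley, beta. rewrite Eu.
  assert (E1 : (p + p * (1 - Cconj a * p) / (p - a) * ((z - a) / (1 - Cconj a * z)))%C
    = (p * ((p + z) * (1 + Cconj a * a) - RtoC 2 * a - RtoC 2 * Cconj a * p * z)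
       / ((p - a) * (1 - Cconj a * z)))%C) by (rewrite RtoC_2; field; auto).
  assert (E2 : (p - p * (1 - Cconj a * p) / (p - a) * ((z - a) / (1 - Cconj a * z)))%C
    = (p * ((p - z) * (1 - Cconj a * a)) / ((p - a) * (1 - Cconj a * z)))%C) by (field; auto).
  rewrite E1, E2, RtoC_2. field. repeat split; auto.
Qed.

Lemma Ci_sqr : (Ci * Ci)%C = (- RtoC 1)%C.
Proof. unfold Ci, Cmult, Copp, RtoC. simpl. f_equal; ring. Qed.

Lemma Cconj_Ci : Cconj Ci = (- Ci)%C.
Proof. unfold Cconj, Ci, Copp. simpl. f_equal; ring. Qed.

Lemma imaginary_add_1_neq (sg : R) : (Ci * RtoC sg + 1)%C <> RtoC 0.
Proof. apply Re_ge_0_add_1. simpl. lra. Qed.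

(** The point of the circle that [cayley p] sends to [i sg]. *)
Definition imaginary_point (p : C) (sg : R) : C :=
  (p * (Ci * RtoC sg - 1) / (Ci * RtoC sg + 1))%C.

Lemma imaginary_point_unit (p : C) (sg : R) : Cmod p = 1 -> Cmod (imaginary_point p sg) = 1.
Proof.
  intros Hp. pose proof (imaginary_add_1_neq sg) as N.
  unfold imaginary_point. rewrite Cmod_div by exact N. rewrite Cmod_mult, Hp.
  replace (Cmod (Ci * RtoC sg - 1)%C) with (Cmod (Ci * RtoC sg + 1)%C).
  - field. pose proof (Cmod_pos _ N). lra.
  - rewrite <- (Cmod_conj (Ci * RtoC sg - 1)%C), <- Cmod_opp. f_equal.
    rewrite Cminus_conj, Cmult_conj, Cconj_RtoC, Cconj_Ci, Cconj_1. ring.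
Qed.

Lemma imaginary_point_neq (p : C) (sg : R) : Cmod p = 1 -> imaginary_point p sg <> p.
Proof.
  intros Hp E. pose proof (imaginary_add_1_neq sg) as N. pose proof (unit_neq_0 p Hp) as Np.
  unfold imaginary_point in E.
  assert (K : (p - p * (Ci * RtoC sg - 1) / (Ci * RtoC sg + 1))%C
    = (RtoC 2 * p / (Ci * RtoC sg + 1))%C) by (rewrite RtoC_2; now field).
  rewrite E in K. replace (p - p)%C with (RtoC 0) in K by ring.
  apply (Cmult_neq_0 _ _ RtoC_2_neq Np).
  replace (RtoC 2 * p)%C with (RtoC 2 * p / (Ci * RtoC sg + 1) * (Ci * RtoC sg + 1))%C
    by (now field).
  rewrite <- K. ring.
Qed.

Lemma cayley_imaginary_point (p : C) (sg : R) : Cmod p = 1 ->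
  cayley p (imaginary_point p sg) = (Ci * RtoC sg)%C.
Proof. intros Hp. apply cayley_of_inv; [exact Hp | apply imaginary_add_1_neq]. Qed.

(** Moving the second fixed point [i sigma] of the affine map to infinity
    inverts the multiplier. *)
Lemma normal_form_flip (phi : C -> C) (p : C) (mu tau : R) :
  normal_form phi p mu tau -> mu <> 1 ->
  exists tau', normal_form phi (imaginary_point p (tau / (1 - mu))) (/ mu) tau'.
Proof.
  intros [Hp [Hmu E]] Hn. set (sg := tau / (1 - mu)). set (q := imaginary_point p sg).
  assert (Hq : Cmod q = 1) by (now apply imaginary_point_unit).
  exists (sg / mu - sg). split; [exact Hq |]. split; [now apply Rinv_0_lt_compat |].
  assert (Key : forall z, disc z -> (cayley p z - Ci * RtoC sg)%C <> RtoC 0 /\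
    cayley q z = (RtoC (1 + sg * sg) / (cayley p z - Ci * RtoC sg) - Ci * RtoC sg)%C).
  { intros z Hz. pose proof (Re_cayley_pos p z Hp Hz) as Rp.
    pose proof (cayley_inv p z Hp (unit_disc_neq p z Hp Hz)) as Ez.
    set (s := cayley p z) in *.
    assert (N1 : (s - Ci * RtoC sg)%C <> RtoC 0).
    { intros K. assert (K' : Re (s - Ci * RtoC sg)%C = 0) by (rewrite K; reflexivity).
      destruct s. simpl in *. lra. }
    split; [exact N1 |].
    assert (N2 : (s + 1)%C <> RtoC 0) by (apply Re_ge_0_add_1; lra).
    pose proof (imaginary_add_1_neq sg) as N3. pose proof (unit_neq_0 p Hp) as Np.
    unfold cayley. rewrite Ez. unfold q, imaginary_point.
    set (t := (Ci * RtoC sg)%C) in *.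
    assert (Et : RtoC (1 + sg * sg) = (1 - t * t)%C).
    { unfold t. rewrite RtoC_plus, RtoC_mult.
      transitivity (1 - (Ci * Ci) * RtoC sg * RtoC sg)%C; [rewrite Ci_sqr; ring | ring]. }
    rewrite Et.
    assert (E1 : (p * (t - 1) / (t + 1) + p * (s - 1) / (s + 1))%C
      = (RtoC 2 * p * (s * t - 1) / ((s + 1) * (t + 1)))%C) by (rewrite RtoC_2; field; auto).
    assert (E2 : (p * (t - 1) / (t + 1) - p * (s - 1) / (s + 1))%C
      = (- (RtoC 2 * p * (s - t)) / ((s + 1) * (t + 1)))%C) by (rewrite RtoC_2; field; auto).
    rewrite E1, E2. field. repeat split; auto using RtoC_2_neq. }
  intros z Hz. destruct (E z Hz) as [Dz Ephi]. split; [exact Dz |].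
  destruct (Key z Hz) as [N1 K1]. destruct (Key (phi z) Dz) as [N2 K2].
  rewrite K1, K2.
  assert (Nmu : RtoC mu <> RtoC 0) by (apply Cmod_pos_neq; rewrite Cmod_RtoC_pos; lra).
  assert (Es : (cayley p (phi z) - Ci * RtoC sg)%C = (RtoC mu * (cayley p z - Ci * RtoC sg))%C).
  { rewrite Ephi. assert (Et : tau = sg - mu * sg) by (unfold sg; field; lra).
    rewrite Et at 1. rewrite RtoC_minus, RtoC_mult. ring. }
  rewrite Es, RtoC_minus, RtoC_div, RtoC_inv by lra. field. auto.
Qed.

(** A slope above one, or a nonzero translation with slope one, drives every
    orbit to infinity, that is to [p]. *)
Definition attracting_form (phi : C -> C) (p : C) (mu tau : R) : Prop :=
  normal_form phi p mu tau /\ 1 <= mu /\ (mu = 1 -> tau <> 0).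

(** If infinity repels, exchange it with the other fixed point. *)
Lemma attracting_form_exists (phi : C -> C) (u a : C) :
  mobius phi u a -> (forall z, disc z -> phi z <> z) ->
  exists p mu tau, attracting_form phi p mu tau.
Proof.
  intros Hm Hno. destruct (mobius_boundary_fixed phi u a Hm Hno) as [p [Hp Hfix]].
  destruct (normal_form_of_fixed phi u a p Hm Hp Hfix) as [mu [tau Hnf]].
  destruct (Rtotal_order mu 1) as [Hlt | [Heq | Hgt]].
  - destruct (normal_form_flip phi p mu tau Hnf ltac:(lra)) as [tau' Hnf'].
    destruct Hnf as [_ [Hmu _]].
    assert (1 < / mu) by (rewrite <- Rinv_1; apply Rinv_lt_contravar; lra).
    exists (imaginary_point p (tau / (1 - mu))), (/ mu), tau'. split; [exact Hnf' | lra].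
  - exists p, mu, tau. split; [exact Hnf |]. split; [lra |]. intros _ ->.
    destruct Hnf as [_ [_ E]]. destruct (E 0 disc_0) as [D0 E0].
    apply (Hno 0 disc_0). apply (cayley_inj p); auto using unit_disc_neq, disc_0.
    rewrite E0, Heq. ring.
  - exists p, mu, tau. split; [exact Hnf | lra].
Qed.

Fixpoint geometric_sum (mu : R) (n : nat) : R :=
  match n with O => 0 | S k => mu * geometric_sum mu k + 1 end.

Lemma geometric_sum_1 (n : nat) : geometric_sum 1 n = INR n.
Proof. induction n as [|n IH]; [reflexivity |]. rewrite S_INR. simpl. rewrite IH. ring. Qed.

Lemma geometric_sum_mul (mu : R) (n : nat) : (mu - 1) * geometric_sum mu n = mu ^ n - 1.
Proof. induction n as [|n IH]; simpl; [ring | nra]. Qed.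

Lemma normal_form_iterate (phi : C -> C) (p : C) (mu tau : R) (n : nat) :
  normal_form phi p mu tau ->
  normal_form (iterate phi n) p (mu ^ n) (tau * geometric_sum mu n).
Proof.
  intros [Hp [Hmu E]]. split; [exact Hp |]. split; [now apply pow_lt |].
  induction n as [|n IH]; intros z Hz.
  - split; [exact Hz |]. simpl. rewrite Rmult_0_r. unfold iterate. simpl. ring.
  - destruct (IH z Hz) as [D1 E1]. change (iterate phi (S n) z) with (phi (iterate phi n z)).
    destruct (E _ D1) as [D2 E2]. split; [exact D2 |]. rewrite E2, E1. simpl.
    rewrite !RtoC_mult, RtoC_plus, RtoC_mult. ring.
Qed.

(** The real part grows geometrically when [mu > 1], and the imaginary part
    linearly when [mu = 1]. *)
Lemma iterates_to_infinity (phi : C -> C) (p : C) (mu tau : R) (z : C) :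
  attracting_form phi p mu tau -> disc z ->
  forall M, exists N, forall n, (N <= n)%nat -> M < Cmod (cayley p (iterate phi n z)).
Proof.
  intros [Hnf [H1 Ht]] Hz M. pose proof Hnf as [Hp _].
  pose proof (Re_cayley_pos p z Hp Hz) as Rp.
  set (s := cayley p z) in *.
  destruct (Req_dec mu 1) as [-> | Hn].
  - specialize (Ht eq_refl). apply Rabs_pos_lt in Ht as Ht'.
    destruct (INR_unbounded ((M + Rabs (Im s)) / Rabs tau)) as [N HN].
    exists N. intros n Hle. apply le_INR in Hle.
    destruct (normal_form_iterate phi p 1 tau n Hnf) as [_ [_ E]].
    rewrite (proj2 (E z Hz)), geometric_sum_1, pow1. fold s.
    eapply Rlt_le_trans; [|apply im_le_Cmod].
    replace (Im (RtoC 1 * s + Ci * RtoC (tau * INR n))%C) with (tau * INR n - - Im s)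
      by (destruct s; simpl; ring).
    pose proof (Rabs_triang_inv (tau * INR n) (- Im s)) as T.
    rewrite Rabs_Ropp, Rabs_mult, (Rabs_pos_eq (INR n)) in T by apply pos_INR.
    assert ((M + Rabs (Im s)) / Rabs tau * Rabs tau < INR n * Rabs tau)
      by (apply Rmult_lt_compat_r; lra).
    unfold Rdiv in *. rewrite Rmult_assoc, Rinv_l in * by lra. lra.
  - destruct (Pow_x_infinity mu ltac:(rewrite Rabs_pos_eq; lra) ((Rabs M + 1) / Re s)) as [N HN].
    exists N. intros n Hle. specialize (HN n Hle).
    rewrite Rabs_pos_eq in HN by (apply pow_le; lra).
    destruct (normal_form_iterate phi p mu tau n Hnf) as [_ [_ E]].
    rewrite (proj2 (E z Hz)). fold s.
    eapply Rlt_le_trans; [|apply Re_le_Cmod].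
    replace (Re (RtoC (mu ^ n) * s + Ci * RtoC (tau * geometric_sum mu n))%C) with (mu ^ n * Re s)
      by (destruct s; simpl; ring).
    assert ((Rabs M + 1) / Re s * Re s <= mu ^ n * Re s) by (apply Rmult_le_compat_r; lra).
    unfold Rdiv in *. rewrite Rmult_assoc, Rinv_l in * by lra. pose proof (Rle_abs M). lra.
Qed.

Lemma near_of_large_cayley (p z : C) (eps : R) : Cmod p = 1 -> z <> p -> 0 < eps ->
  1 + 2 / eps < Cmod (cayley p z) -> Cmod (z - p)%C < eps.
Proof.
  intros Hp Hz He H. pose proof (Cmod_cayley_add_1 p z Hp Hz) as E.
  pose proof (Cmod_triangle_rev (cayley p z + 1)%C (RtoC 1)) as T.
  pose proof (Cmod_triangle_sub (cayley p z + 1)%C (RtoC 1)) as T2.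
  replace (cayley p z + 1 - 1)%C with (cayley p z) in T, T2 by ring.
  rewrite Cmod_1 in T, T2. rewrite Cmod_sub_sym. pose proof (Cmod_ge_0 (p - z)%C).
  destruct (Rlt_le_dec (Cmod (p - z)%C) eps) as [|Hle]; [assumption | exfalso].
  assert (2 / eps * eps = 2) by (field; lra).
  assert (0 < 2 / eps) by (apply Rdiv_lt_0_compat; lra). nra.
Qed.

Lemma iterates_tend (phi : C -> C) (p : C) (mu tau : R) (z : C) :
  attracting_form phi p mu tau -> disc z ->
  forall eps, 0 < eps -> exists N, forall n, (N <= n)%nat ->
  Cmod (iterate phi n z - p)%C < eps.
Proof.
  intros H Hz eps He. pose proof H as [Hnf _]. pose proof Hnf as [Hp _].
  destruct (iterates_to_infinity phi p mu tau z H Hz (1 + 2 / eps)) as [N HN].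
  exists N. intros n Hn. apply near_of_large_cayley; auto.
  apply unit_disc_neq; [exact Hp |].
  now apply (normal_form_iterate phi p mu tau n Hnf).
Qed.

(** * Parabolic and hyperbolic automorphisms *)

Lemma ball_of_Cmod (x y : C) (eps : R) :
  Cmod (y - x)%C < eps -> ball (M := C_UniformSpace) x eps y.
Proof. exact (C_NormedModule_mixin_compat1 x y eps). Qed.

Lemma Cmod_of_ball (x y : C) (eps : R) :
  ball (M := C_UniformSpace) x (eps / 2) y -> Cmod (y - x)%C < eps.
Proof.
  intros [H1 H2]. eapply Rle_lt_trans; [apply Cmod_le_Re_Im |].
  change (Rabs (Re (y - x)%C) < eps / 2) in H1.
  change (Rabs (Im (y - x)%C) < eps / 2) in H2. lra.
Qed.

Lemma filterlim_C_iff (T : Type) (F : (T -> Prop) -> Prop) (FF : Filter F) (f : T -> C) (l : C) :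
  filterlim f F (locally (T := C_UniformSpace) l) <->
  forall eps, 0 < eps -> F (fun x => Cmod (f x - l)%C < eps).
Proof.
  split.
  - intros H eps He. apply (H (fun y => Cmod (y - l)%C < eps)).
    exists (mkposreal (eps / 2) ltac:(lra)). intros y Hy. now apply Cmod_of_ball.
  - intros H. apply filterlim_locally. intros eps.
    eapply filter_imp; [|exact (H eps (cond_pos eps))].
    intros x Hx. now apply ball_of_Cmod.
Qed.

Lemma filterlim_seq_iff (u : nat -> C) (l : C) :
  filterlim u eventually (locally (T := C_UniformSpace) l) <->
  forall eps, 0 < eps -> exists N, forall n, (N <= n)%nat -> Cmod (u n - l)%C < eps.
Proof. apply filterlim_C_iff, eventually_filter. Qed.

Lemma locally_C_iff (P : C -> Prop) (z : C) :
  locally (T := C_UniformSpace) z P <->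
  exists del, 0 < del /\ forall w, Cmod (w - z)%C < del -> P w.
Proof.
  split.
  - intros [d H]. exists d. split; [apply cond_pos |]. intros w Hw. now apply H, ball_of_Cmod.
  - intros [d [Hd H]]. exists (mkposreal (d / 2) ltac:(lra)). intros w Hw.
    now apply H, Cmod_of_ball.
Qed.

Lemma fixed_point_iff (phi : C -> C) (q : C) :
  fixed_point phi q <-> Cmod q <= 1 /\
  forall eps, 0 < eps -> exists del, 0 < del /\
  forall w, disc w -> Cmod (w - q)%C < del -> Cmod (phi w - q)%C < eps.
Proof.
  unfold fixed_point. rewrite filterlim_C_iff by (apply within_filter, locally_filter).
  split; intros [Hq H]; (split; [exact Hq |]); intros eps He; specialize (H eps He).
  - apply locally_C_iff in H. destruct H as [d [Hd K]]. exists d. split; [exact Hd |]. auto.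
  - apply locally_C_iff. destruct H as [d [Hd K]]. exists d. split; [exact Hd |]. auto.
Qed.

Lemma disc_adherent (q : C) (del : R) : Cmod q <= 1 -> 0 < del ->
  exists w, disc w /\ Cmod (w - q)%C < del.
Proof.
  intros Hq Hd. set (t := Rmin (1 / 2) (del / 2)).
  assert (Ht : 0 < t) by (apply Rmin_pos; lra).
  assert (Ht1 : t <= 1 / 2) by apply Rmin_l. assert (Ht2 : t <= del / 2) by apply Rmin_r.
  pose proof (Cmod_ge_0 q).
  exists (RtoC (1 - t) * q)%C. split.
  - unfold disc. rewrite Cmod_mult, Cmod_RtoC_pos by lra. nra.
  - rewrite RtoC_minus. replace ((1 - RtoC t) * q - q)%C with (- (RtoC t * q))%C by ring.
    rewrite Cmod_opp, Cmod_mult, Cmod_RtoC_pos by lra. nra.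
Qed.

Lemma ccont_cayley (p q : C) : q <> p -> ccont (cayley p) q.
Proof.
  intros Hn. unfold cayley. apply ccont_div.
  - now apply Csub_neq_0, not_eq_sym.
  - apply ccont_plus; [apply ccont_const | apply ccont_id].
  - apply ccont_minus; [apply ccont_const | apply ccont_id].
Qed.

Lemma Re_cayley_ge_0 (p q : C) : Cmod p = 1 -> Cmod q <= 1 -> q <> p -> 0 <= Re (cayley p q).
Proof.
  intros Hp Hq Hn. pose proof (Re_cayley p q Hp Hn) as E.
  assert (P : 0 < Cmod (p - q)%C) by (now apply Cmod_pos, Csub_neq_0, not_eq_sym).
  apply pow_lt with (n := 2%nat) in P. pose proof (Cmod_ge_0 q).
  destruct (Rle_lt_dec 0 (Re (cayley p q))); [assumption | exfalso]. nra.
Qed.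

(** An affine map with nonzero slope extends continuously to infinity. *)
Lemma normal_form_fixed_p (phi : C -> C) (p : C) (mu tau : R) :
  normal_form phi p mu tau -> fixed_point phi p.
Proof.
  intros [Hp [Hmu E]]. apply fixed_point_iff. split; [lra |]. intros eps He.
  set (M := (1 + 2 / eps + Rabs tau) / mu + 1).
  assert (HM : 0 < M).
  { unfold M. assert (0 < 2 / eps) by (apply Rdiv_lt_0_compat; lra). pose proof (Rabs_pos tau).
    assert (0 < (1 + 2 / eps + Rabs tau) / mu) by (apply Rdiv_lt_0_compat; lra). lra. }
  exists (2 / (M + 1)). split; [apply Rdiv_lt_0_compat; lra |].
  intros w Hw Hd. destruct (E w Hw) as [Dw Ew].
  pose proof (unit_disc_neq p w Hp Hw) as Nw.
  apply near_of_large_cayley; [exact Hp | now apply unit_disc_neq | exact He |].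
  rewrite Ew.
  pose proof (Cmod_cayley_add_1 p w Hp Nw) as E1. rewrite (Cmod_sub_sym p w) in E1.
  pose proof (Cmod_triangle (cayley p w) (RtoC 1)) as T. rewrite Cmod_1 in T.
  assert (HS : M < Cmod (cayley p w)).
  { pose proof (Cmod_ge_0 (cayley p w + 1)%C). pose proof (Cmod_ge_0 (w - p)%C).
    assert (2 / (M + 1) * (M + 1) = 2) by (field; lra).
    destruct (Rlt_le_dec M (Cmod (cayley p w))) as [|Hle]; [assumption | exfalso].
    nra. }
  pose proof (Cmod_triangle_rev (RtoC mu * cayley p w)%C (- (Ci * RtoC tau))%C) as T2.
  replace (RtoC mu * cayley p w - - (Ci * RtoC tau))%C
    with (RtoC mu * cayley p w + Ci * RtoC tau)%C in T2 by ring.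
  rewrite Cmod_opp, !Cmod_mult, Cmod_Ci, (Cmod_R tau), (Cmod_RtoC_pos mu) in T2 by lra.
  assert (mu * M = 1 + 2 / eps + Rabs tau + mu) by (unfold M; field; lra).
  assert (mu * M < mu * Cmod (cayley p w)) by (apply Rmult_lt_compat_l; lra). lra.
Qed.

(** Away from [p], the affine form extends [phi] continuously to the closed
    disc. *)
Lemma normal_form_fixed_iff (phi : C -> C) (p q : C) (mu tau : R) :
  normal_form phi p mu tau -> q <> p ->
  (fixed_point phi q <->
   Cmod q <= 1 /\ (RtoC mu * cayley p q + Ci * RtoC tau)%C = cayley p q).
Proof.
  intros [Hp [Hmu E]] Hn. rewrite fixed_point_iff.
  set (L := fun w => (RtoC mu * cayley p w + Ci * RtoC tau)%C).
  set (g := fun w => (p * (L w - 1) / (L w + 1))%C).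
  assert (Hg : forall w, disc w -> phi w = g w).
  { intros w Hw. destruct (E w Hw) as [Dw Ew]. unfold g, L. rewrite <- Ew.
    apply cayley_inv; [exact Hp | now apply unit_disc_neq]. }
  assert (HL : Cmod q <= 1 -> (L q + 1)%C <> RtoC 0).
  { intros Hq. apply Re_ge_0_add_1. pose proof (Re_cayley_ge_0 p q Hp Hq Hn).
    unfold L. destruct (cayley p q). simpl in *. nra. }
  assert (Hc : Cmod q <= 1 -> ccont g q).
  { intros Hq. assert (CL : ccont L q).
    { apply ccont_plus; [|apply ccont_const]. apply ccont_mult; [apply ccont_const |].
      now apply ccont_cayley. }
    apply ccont_div; [now apply HL | |].
    - apply ccont_mult; [apply ccont_const |]. apply ccont_minus; [exact CL | apply ccont_const].
    - apply ccont_plus; [exact CL | apply ccont_const]. }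
  split; intros [Hq H]; (split; [exact Hq |]).
  - change (L q = cayley p q).
    assert (Eg : g q = q).
    { apply Cmod_sub_0. apply Rle_antisym; [|apply Cmod_ge_0]. apply le_epsilon. intros eps He.
      destruct (H (eps / 2) ltac:(lra)) as [d1 [D1 K1]].
      destruct (Hc Hq (eps / 2) ltac:(lra)) as [d2 [D2 K2]].
      destruct (disc_adherent q (Rmin d1 d2) Hq ltac:(now apply Rmin_pos)) as [w [Dw Hw]].
      pose proof (Rmin_l d1 d2). pose proof (Rmin_r d1 d2).
      specialize (K1 w Dw ltac:(lra)). specialize (K2 w ltac:(lra)).
      rewrite (Hg w Dw) in K1. pose proof (Cmod_triangle_mid (g q) (g w) q) as T.
      rewrite (Cmod_sub_sym (g q) (g w)) in T. lra. }
    rewrite <- Eg. unfold g. rewrite cayley_of_inv; [|exact Hp | now apply HL].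
    fold (g q). now rewrite Eg.
  - assert (Eg : g q = q).
    { unfold g. change (L q = cayley p q) in H. rewrite H. symmetry. now apply cayley_inv. }
    intros eps He. destruct (Hc Hq eps He) as [d [Hd K]]. exists d. split; [exact Hd |].
    intros w Dw Hw. rewrite (Hg w Dw). rewrite <- Eg. now apply K.
Qed.

Lemma attractive_of_form (phi : C -> C) (p : C) (mu tau : R) :
  attracting_form phi p mu tau -> attractive phi p.
Proof.
  intros H. split; [exact (normal_form_fixed_p phi p mu tau (proj1 H)) |].
  intros z Hz. apply filterlim_seq_iff. intros eps He. now apply (iterates_tend phi p mu tau).
Qed.

Lemma attractive_unique (phi : C -> C) (p q : C) :
  attractive phi p -> attractive phi q -> p = q.
Proof.
  intros [_ Hp] [_ Hq]. apply Cmod_sub_0. apply Rle_antisym; [|apply Cmod_ge_0].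
  apply le_epsilon. intros eps He.
  pose proof (proj1 (filterlim_seq_iff _ _) (Hp 0 disc_0) (eps / 2) ltac:(lra)) as [N1 K1].
  pose proof (proj1 (filterlim_seq_iff _ _) (Hq 0 disc_0) (eps / 2) ltac:(lra)) as [N2 K2].
  specialize (K1 (max N1 N2) (Nat.le_max_l N1 N2)).
  specialize (K2 (max N1 N2) (Nat.le_max_r N1 N2)).
  pose proof (Cmod_triangle_mid p (iterate phi (max N1 N2) 0) q) as T.
  rewrite (Cmod_sub_sym p (iterate phi (max N1 N2) 0)) in T. lra.
Qed.

Lemma parabolic_of_form (phi : C -> C) (p : C) (tau : R) :
  automorphism phi -> attracting_form phi p 1 tau -> parabolic phi.
Proof.
  intros Ha [Hnf [_ Ht]]. specialize (Ht eq_refl). pose proof Hnf as [Hp [_ E]].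
  assert (Nt : (Ci * RtoC tau)%C <> RtoC 0).
  { apply Cmult_neq_0; [exact Ci_nz |]. intros K. apply Ht. now apply RtoC_inj. }
  split; [exact Ha |]. split.
  - intros Hid. destruct (E 0 disc_0) as [_ E0]. rewrite (Hid 0 disc_0), Cmult_1_l in E0.
    apply Nt. replace (Ci * RtoC tau)%C with (cayley p 0 + Ci * RtoC tau - cayley p 0)%C by ring.
    rewrite <- E0. ring.
  - exists p. split; [exact Hp |]. intros q. split.
    + intros Hq. apply NNPP. intros Hn.
      apply (normal_form_fixed_iff phi p q 1 tau Hnf Hn) in Hq. destruct Hq as [_ Eq].
      apply Nt. rewrite Cmult_1_l in Eq.
      replace (Ci * RtoC tau)%C with (cayley p q + Ci * RtoC tau - cayley p q)%C by ring.
      rewrite Eq. ring.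
    + intros ->. exact (normal_form_fixed_p phi p 1 tau Hnf).
Qed.

Lemma normal_form_inverse (phi psi : C -> C) (p : C) (mu tau : R) :
  normal_form phi p mu tau -> inverse_on_disc phi psi ->
  normal_form psi p (/ mu) (- tau / mu).
Proof.
  intros [Hp [Hmu E]] [[_ Hd] [_ E2]]. split; [exact Hp |]. split; [now apply Rinv_0_lt_compat |].
  intros z Hz. pose proof (Hd z Hz) as Dz. split; [exact Dz |].
  destruct (E (psi z) Dz) as [_ Ep]. rewrite (E2 z Hz) in Ep. rewrite Ep.
  assert (Nmu : RtoC mu <> RtoC 0) by (apply Cmod_pos_neq; rewrite Cmod_RtoC_pos; lra).
  rewrite RtoC_div, RtoC_inv, RtoC_opp by lra. now field.
Qed.

Lemma hyperbolic_of_form (phi : C -> C) (p : C) (mu tau : R) :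
  automorphism phi -> normal_form phi p mu tau -> 1 < mu ->
  hyperbolic_with phi p (imaginary_point p (tau / (1 - mu))).
Proof.
  intros Ha Hnf Hmu. pose proof Hnf as [Hp [_ E]].
  set (sg := tau / (1 - mu)). set (q := imaginary_point p sg).
  assert (Hsg : tau = sg - mu * sg) by (unfold sg; field; lra).
  split; [exact Ha |]. split; [exact Hp |]. split; [now apply imaginary_point_unit |].
  split; [apply not_eq_sym; now apply imaginary_point_neq |].
  split; [|split].
  - intros r. split.
    + intros Hr. destruct (classic (r = p)) as [|Hn]; [now left | right].
      apply (normal_form_fixed_iff phi p r mu tau Hnf Hn) in Hr. destruct Hr as [_ Er].
      apply (cayley_inj p); trivial; [now apply imaginary_point_neq |].
      unfold q. rewrite cayley_imaginary_point by exact Hp.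
      rewrite Hsg, RtoC_minus, RtoC_mult in Er.
      assert (K : ((RtoC mu - 1) * (cayley p r - Ci * RtoC sg))%C = RtoC 0).
      { transitivity (RtoC mu * cayley p r + Ci * (RtoC sg - RtoC mu * RtoC sg) - cayley p r)%C;
          [ring | rewrite Er; ring]. }
      apply NNPP. intros N. apply Csub_neq_0 in N. revert K. apply Cmult_neq_0; [|exact N].
      rewrite <- RtoC_minus. apply Cmod_pos_neq. rewrite Cmod_RtoC_pos; lra.
    + intros [-> | ->]; [exact (normal_form_fixed_p phi p mu tau Hnf) |].
      apply (normal_form_fixed_iff phi p q mu tau Hnf); [now apply imaginary_point_neq |].
      split; [right; now apply imaginary_point_unit |].
      unfold q. rewrite cayley_imaginary_point by exact Hp. rewrite Hsg at 1.
      rewrite RtoC_minus, RtoC_mult. ring.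
  - apply (attractive_of_form phi p mu tau). split; [exact Hnf | lra].
  - destruct Ha as [_ [psi Hpsi]]. exists psi. split; [exact Hpsi |].
    pose proof (normal_form_inverse phi psi p mu tau Hnf Hpsi) as Hn1.
    assert (Hlt : / mu < 1) by (rewrite <- Rinv_1; apply Rinv_lt_contravar; lra).
    destruct (normal_form_flip psi p _ _ Hn1 ltac:(lra)) as [tau' Hn2].
    rewrite Rinv_inv in Hn2.
    replace (- tau / mu / (1 - / mu)) with sg in Hn2 by (unfold sg; field; lra).
    apply (attractive_of_form psi q mu tau'). split; [exact Hn2 | lra].
Qed.

Lemma classification (phi : C -> C) (p : C) (mu tau : R) :
  automorphism phi -> attracting_form phi p mu tau -> parabolic phi \/ hyperbolic phi.
Proof.
  intros Ha Hf. pose proof Hf as [Hnf [[Hmu | <-] _]].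
  - right. exists p, (imaginary_point p (tau / (1 - mu))). now apply hyperbolic_of_form.
  - left. now apply (parabolic_of_form phi p tau).
Qed.

Lemma attracting_form_of_type (phi : C -> C) :
  parabolic phi \/ hyperbolic phi -> exists p mu tau, attracting_form phi p mu tau.
Proof.
  intros H.
  assert (Ha : automorphism phi).
  { destruct H as [[Ha _] | [a [b [Ha _]]]]; exact Ha. }
  assert (Hfix : forall q, fixed_point phi q -> Cmod q = 1).
  { destruct H as [[_ [_ [p [Hp Hq]]]] | [a [b [_ [H1 [H2 [_ [Hq _]]]]]]]]; intros q Hf;
      apply Hq in Hf.
    - now subst q.
    - destruct Hf; now subst q. }
  destruct (automorphism_mobius phi Ha) as [u [a Hm]].
  apply (attracting_form_exists phi u a Hm). intros z Hz Ez.
  enough (K : Cmod z = 1) by (unfold disc in Hz; lra).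
  apply Hfix. apply fixed_point_iff. split; [unfold disc in Hz; lra |].
  intros eps He. pose proof (proj1 (mobius_self_map phi u a Hm)) as Hh.
  pose proof (cdiff_ccont phi z (proj1 (holomorphic_cdiff phi) Hh z Hz)) as Hc.
  destruct (Hc eps He) as [d [Hd K]]. exists d. split; [exact Hd |].
  intros w _ Hw. rewrite Ez in K. now apply K.
Qed.

Lemma type_automorphism (phi : C -> C) : parabolic phi \/ hyperbolic phi -> automorphism phi.
Proof. intros [[Ha _] | [a [b [Ha _]]]]; exact Ha. Qed.

Lemma Cmod_sub_1_lt (s : C) : 0 < Re s -> Cmod (s - 1)%C < Cmod (s + 1)%C.
Proof.
  intros H. pose proof (Cmod_ge_0 (s - 1)%C). pose proof (Cmod_ge_0 (s + 1)%C).
  assert (E : Cmod (s + 1)%C ^ 2 = Cmod (s - 1)%C ^ 2 + 4 * Re s).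
  { rewrite !Cmod_sqr. destruct s. simpl. ring. }
  nra.
Qed.

Lemma cayley_onto (p s : C) : Cmod p = 1 -> 0 < Re s -> disc (p * (s - 1) / (s + 1))%C.
Proof.
  intros Hp Hs. assert (N : (s + 1)%C <> RtoC 0) by (apply Re_ge_0_add_1; lra).
  pose proof (Cmod_pos _ N) as P. pose proof (Cmod_sub_1_lt s Hs).
  unfold disc. rewrite Cmod_div, Cmod_mult, Hp, Rmult_1_l by exact N.
  apply Rmult_lt_reg_r with (1 := P). unfold Rdiv. rewrite Rmult_assoc, Rinv_l by lra. lra.
Qed.

(** The map [i (s - i sigma)] sends the right half-plane, with second fixed point
    [i sigma], to the upper one, with second fixed point [0]. *)
Lemma multiplier_of_form (phi : C -> C) (p : C) (mu tau : R) :
  automorphism phi -> normal_form phi p mu tau -> 1 < mu -> is_multiplier phi mu.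
Proof.
  intros Ha Hnf Hmu. pose proof Hnf as [Hp [_ E]].
  set (sg := tau / (1 - mu)). set (q := imaginary_point p sg).
  assert (Hsg : tau = sg - mu * sg) by (unfold sg; field; lra).
  pose proof (unit_neq_0 p Hp) as Np.
  split; [exact Hmu |]. exists p, q. split; [now apply hyperbolic_of_form |].
  exists (Ci - RtoC sg)%C, (p * (Ci + RtoC sg))%C, (- RtoC 1)%C, p.
  assert (HT : forall z, z <> p ->
    linear_fractional (Ci - RtoC sg) (p * (Ci + RtoC sg)) (- RtoC 1) p z
    = (Ci * (cayley p z - Ci * RtoC sg))%C).
  { intros z Hz. assert (N : (p - z)%C <> RtoC 0) by (now apply Csub_neq_0, not_eq_sym).
    unfold linear_fractional, cayley.
    replace (- RtoC 1 * z + p)%C with (p - z)%C by ring.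
    replace (Ci * ((p + z) / (p - z) - Ci * RtoC sg))%C
      with ((Ci * (p + z) - (Ci * Ci) * RtoC sg * (p - z)) / (p - z))%C by (now field).
    rewrite Ci_sqr. unfold Cdiv. ring. }
  split; [|split; [|split]].
  - split; [|split].
    + replace ((Ci - RtoC sg) * p - p * (Ci + RtoC sg) * - (1))%C with (RtoC 2 * (Ci * p))%C
        by (rewrite RtoC_2; ring).
      apply Cmult_neq_0; [exact RtoC_2_neq | apply Cmult_neq_0; [exact Ci_nz | exact Np]].
    + intros z Hz. split.
      * replace (- RtoC 1 * z + p)%C with (p - z)%C by ring. now apply unit_sub_neq.
      * rewrite HT by now apply unit_disc_neq. pose proof (Re_cayley_pos p z Hp Hz).
        unfold upper_half_plane. destruct (cayley p z). simpl in *. lra.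
    + intros w Hw. unfold upper_half_plane in Hw.
      set (s := (- (Ci * w) + Ci * RtoC sg)%C).
      assert (Hs : 0 < Re s) by (unfold s; destruct w; simpl in *; lra).
      exists (p * (s - 1) / (s + 1))%C. pose proof (cayley_onto p s Hp Hs) as D.
      split; [exact D |]. rewrite HT by now apply unit_disc_neq.
      rewrite cayley_of_inv; [|exact Hp | apply Re_ge_0_add_1; lra].
      unfold s. transitivity (- (Ci * Ci) * w)%C; [ring | rewrite Ci_sqr; ring].
  - ring.
  - assert (Nq : q <> p) by (now apply imaginary_point_neq).
    assert (N : (p - q)%C <> RtoC 0) by (now apply Csub_neq_0, not_eq_sym).
    pose proof (HT q Nq) as Hq. unfold q in Hq at 2.
    rewrite cayley_imaginary_point in Hq by exact Hp.
    replace ((Ci - RtoC sg) * q + p * (Ci + RtoC sg))%C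
      with (linear_fractional (Ci - RtoC sg) (p * (Ci + RtoC sg)) (- RtoC 1) p q * (p - q))%C.
    + rewrite Hq. ring.
    + unfold linear_fractional. replace (- RtoC 1 * q + p)%C with (p - q)%C by ring. now field.
  - intros z Hz. destruct (E z Hz) as [Dz Ez].
    rewrite !HT by (now apply unit_disc_neq). rewrite Ez, Hsg, RtoC_minus, RtoC_mult. ring.
Qed.

(** A linear fractional map with its pole at the attracting point is an affine
    function of [cayley p], so it conjugates [phi] to an affine map of the same
    slope. *)
Lemma multiplier_eq (phi : C -> C) (p : C) (mu tau lam : R) :
  attracting_form phi p mu tau -> is_multiplier phi lam -> lam = mu.
Proof.
  intros Hf [_ [a [b [Hh [al [be [ga [de [[Hdet _] [Ea [_ Hc]]]]]]]]]]].
  pose proof Hf as [[Hp [Hmu E]] _].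
  assert (a = p).
  { apply (attractive_unique phi); [apply Hh | now apply (attractive_of_form phi p mu tau)]. }
  subst a.
  assert (Ede : de = (- (ga * p))%C).
  { replace de with (ga * p + de - ga * p)%C by ring. rewrite Ea. ring. }
  subst de.
  assert (Nga : ga <> RtoC 0).
  { intros ->. apply Hdet. ring. }
  set (A := (al * p + be)%C).
  assert (NA : A <> RtoC 0).
  { intros K. apply Hdet. transitivity (- (ga * A))%C; [unfold A; ring | rewrite K; ring]. }
  pose proof (unit_neq_0 p Hp) as Np.
  assert (HT : forall z, disc z -> linear_fractional al be ga (- (ga * p)) z
    = (al / ga - A * (cayley p z + 1) / (RtoC 2 * p * ga))%C).
  { intros z Hz. pose proof (unit_disc_neq p z Hp Hz) as Nz.
    assert (N : (p - z)%C <> RtoC 0) by (now apply unit_sub_neq).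
    replace (A * (cayley p z + 1) / (RtoC 2 * p * ga))%C
      with (A * ((cayley p z + 1) * (p - z)) / ((p - z) * (RtoC 2 * p * ga)))%C
      by (field; auto using RtoC_2_neq).
    rewrite cayley_add_1 by exact Nz. unfold linear_fractional, A.
    replace (ga * z + - (ga * p))%C with (- (ga * (p - z)))%C by ring.
    field. repeat split; auto using RtoC_2_neq. }
  set (k := fun s : C => ((RtoC mu - RtoC lam) * s)%C).
  assert (Hk : forall z, disc z -> k (cayley p z) =
    ((RtoC lam - 1) * (RtoC 1 - RtoC 2 * p * al / A) - Ci * RtoC tau)%C).
  { intros z Hz. destruct (E z Hz) as [Dz Ez]. pose proof (Hc z Hz) as K.
    rewrite !HT, Ez in K by assumption. unfold k.
    set (s := cayley p z) in *.
    assert (K2 : ((al / ga - A * (RtoC mu * s + Ci * RtoC tau + 1) / (RtoC 2 * p * ga))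
       * (RtoC 2 * p * ga) / A)%C
       = (RtoC lam * (al / ga - A * (s + 1) / (RtoC 2 * p * ga)) * (RtoC 2 * p * ga) / A)%C)
      by (now rewrite K).
    apply Csub_eq_0.
    transitivity ((RtoC lam * (al / ga - A * (s + 1) / (RtoC 2 * p * ga)) * (RtoC 2 * p * ga) / A)
      - ((al / ga - A * (RtoC mu * s + Ci * RtoC tau + 1) / (RtoC 2 * p * ga))
       * (RtoC 2 * p * ga) / A))%C.
    - field. repeat split; auto using RtoC_2_neq.
    - rewrite K2. ring. }
  set (z1 := (p * (RtoC 2 - 1) / (RtoC 2 + 1))%C).
  assert (D1 : disc z1) by (apply cayley_onto; [exact Hp | simpl; lra]).
  assert (E1 : cayley p z1 = RtoC 2).
  { apply cayley_of_inv; [exact Hp | apply Re_ge_0_add_1; simpl; lra]. }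
  pose proof (Hk 0 disc_0) as K0. pose proof (Hk z1 D1) as K1.
  rewrite <- K0, E1, cayley_0 in K1 by exact Hp. unfold k in K1.
  assert (K2 : (RtoC mu - RtoC lam)%C = RtoC 0).
  { transitivity ((RtoC mu - RtoC lam) * RtoC 2 - (RtoC mu - RtoC lam) * 1)%C;
      [rewrite RtoC_2; ring | rewrite K1; ring]. }
  apply RtoC_inj. symmetry. now apply Csub_eq_0.
Qed.

(** The half-plane form of [one_sub_pdist_sqr]; the distances between the two
    orbits are estimated through it. *)
Lemma pdist_cayley (p z w : C) : Cmod p = 1 -> disc z -> disc w ->
  (1 - pdist z w ^ 2) * Cmod (cayley p z + Cconj (cayley p w))%C ^ 2
  = 4 * (Re (cayley p z) * Re (cayley p w)).
Proof.
  intros Hp Hz Hw.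
  pose proof (Re_cayley p z Hp (unit_disc_neq p z Hp Hz)) as Ez.
  pose proof (Re_cayley p w Hp (unit_disc_neq p w Hp Hw)) as Ew.
  pose proof (one_sub_pdist_sqr z w ltac:(unfold disc in Hz; lra) Hw) as E.
  pose proof (unit_sub_neq p z Hp Hz) as Nz. pose proof (unit_sub_neq p w Hp Hw) as Nw.
  pose proof (Cmod_pos _ Nz) as Pz. pose proof (Cmod_pos _ Nw) as Pw.
  assert (Nw' : (Cconj p - Cconj w)%C <> RtoC 0).
  { apply Cmod_pos_neq. rewrite <- Cminus_conj, Cmod_conj. exact Pw. }
  assert (K : ((cayley p z + Cconj (cayley p w)) * ((p - z) * (Cconj p - Cconj w)))%C
    = (RtoC 2 * Cconj (1 - Cconj z * w))%C).
  { unfold cayley. rewrite Cdiv_conj by exact Nw.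
    rewrite !Cminus_conj, Cplus_conj, Cmult_conj, Cconj_conj, Cconj_1.
    transitivity (RtoC 2 * (Cconj p * p - z * Cconj w))%C; [rewrite RtoC_2; field; auto |].
    now rewrite Cconj_unit. }
  apply (f_equal Cmod) in K.
  rewrite !Cmod_mult, <- Cminus_conj, !Cmod_conj, (Cmod_RtoC_pos 2) in K by lra.
  set (X := Cmod (cayley p z + Cconj (cayley p w))%C) in *.
  set (D := Cmod (1 - Cconj z * w)%C) in *.
  set (dz := Cmod (p - z)%C) in *. set (dw := Cmod (p - w)%C) in *.
  apply Rmult_eq_reg_r with (dz ^ 2 * dw ^ 2);
    [|apply Rgt_not_eq, Rmult_lt_0_compat; now apply pow_lt].
  transitivity ((1 - pdist z w ^ 2) * (X * (dz * dw)) ^ 2); [ring |].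
  rewrite K. transitivity (4 * ((1 - pdist z w ^ 2) * D ^ 2)); [ring |].
  rewrite E, <- Ez, <- Ew. ring.
Qed.

(** * Necessity *)

Lemma finite_compact (l : list C) : compact (fun z => In z l).
Proof.
  intros I U _ Hc. induction l as [|a l IH].
  - exists nil. intros z [].
  - destruct IH as [is His]; [intros z Hz; apply Hc; now right |].
    destruct (Hc a (or_introl eq_refl)) as [i Hi].
    exists (i :: is). intros z [<- | Hz].
    + exists i. split; [now left | exact Hi].
    + destruct (His z Hz) as [j [Hj Uj]]. exists j. split; [now right | exact Uj].
Qed.

Lemma iterate_disc (phi : C -> C) (n : nat) (z : C) :
  (forall w, disc w -> disc (phi w)) -> disc z -> disc (iterate phi n z).
Proof. intros H Hz. induction n as [|n IH]; [exact Hz | now apply H]. Qed.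

Lemma universal_pointwise (phi1 phi2 f g1 g2 : C -> C) (l : list C) (eps : R) :
  disjointly_universal phi1 phi2 f -> unit_ball g1 -> unit_ball g2 ->
  (forall z, In z l -> disc z) -> 0 < eps ->
  exists n, forall z, In z l ->
    Cmod (f (iterate phi1 n z) - g1 z)%C < eps /\ Cmod (f (iterate phi2 n z) - g2 z)%C < eps.
Proof.
  intros [_ Hd] H1 H2 Hl He.
  destruct (Hd g1 g2 H1 H2 (fun p => forall z, In z l ->
    Cmod (fst p z - g1 z)%C < eps /\ Cmod (snd p z - g2 z)%C < eps)) as [p [[n ->] Hn]].
  - assert (Hu : forall g : C -> C, ucc_locally g (fun h => forall z, In z l ->
      Cmod (h z - g z)%C < eps)).
    { intros g. exists (fun z => In z l), (mkposreal eps He).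
      split; [apply finite_compact | split; [exact Hl | auto]]. }
    eapply Filter_prod; [apply Hu | apply Hu |]. intros h1 h2 K1 K2 z Hz. simpl. auto.
  - exists n. exact Hn.
Qed.

Lemma unit_ball_const (c : C) : Cmod c <= 1 -> unit_ball (fun _ => c).
Proof.
  intros Hc. split; [|auto]. apply holomorphic_cdiff. intros z _. apply cdiff_const.
Qed.

Lemma unit_ball_scaled_id (c : C) : Cmod c = 1 -> unit_ball (fun z => c * z)%C.
Proof.
  intros Hc. split.
  - apply holomorphic_cdiff. intros z _. apply cdiff_mult; [apply cdiff_const | apply cdiff_id].
  - intros z Hz. rewrite Cmod_mult, Hc. unfold disc in Hz. lra.
Qed.

Lemma unit_ball_schwarz_pick (f : C -> C) (a z : C) : unit_ball f -> disc a -> disc z ->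
  Cmod (f z - f a)%C <= pdist a z * Cmod (1 - Cconj (f a) * f z)%C.
Proof.
  intros [Hh Hb] Ha Hz. apply (schwarz_pick nil); auto. now apply holo_off_of_holomorphic.
Qed.

Lemma iterate_contracts (phi : C -> C) (n : nat) (z w : C) :
  holomorphic_self_map phi -> disc z -> disc w ->
  pdist (iterate phi (S n) z) (iterate phi (S n) w) <= pdist (phi z) (phi w).
Proof.
  intros Hphi Hz Hw. induction n as [|n IH]; [apply Rle_refl |].
  eapply Rle_trans; [|exact IH].
  change (iterate phi (S (S n)) z) with (phi (iterate phi (S n) z)).
  change (iterate phi (S (S n)) w) with (phi (iterate phi (S n) w)).
  apply self_map_contracts; [exact Hphi | |]; apply iterate_disc; trivial; apply Hphi.
Qed.

Lemma one_sub_conj_mul_lipschitz (x y x' y' : C) (e : R) :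
  Cmod x <= 1 -> Cmod y' <= 1 -> Cmod (x - x')%C <= e -> Cmod (y - y')%C <= e ->
  Cmod (1 - Cconj x * y)%C <= Cmod (1 - Cconj x' * y')%C + 2 * e.
Proof.
  intros Hx Hy' H1 H2.
  replace (1 - Cconj x * y)%C
    with ((1 - Cconj x' * y') + (- (Cconj x * (y - y')) + - (Cconj (x - x') * y')))%C
    by (rewrite Cminus_conj; ring).
  eapply Rle_trans; [apply Cmod_triangle |].
  apply Rplus_le_compat_l. eapply Rle_trans; [apply Cmod_triangle |].
  rewrite !Cmod_opp, !Cmod_mult, !Cmod_conj.
  pose proof (Cmod_ge_0 x). pose proof (Cmod_ge_0 y'). pose proof (Cmod_ge_0 (y - y')%C).
  pose proof (Cmod_ge_0 (x - x')%C). nra.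
Qed.

(** Some [f o phi^n] with [n > 0] comes as close as desired to the identity or
    to its opposite, so [phi] cannot contract the distance of any two points.
    Two targets are needed to exclude that [n = 0] did the work. *)
Lemma universal_isometry (phi f : C -> C) :
  holomorphic_self_map phi -> unit_ball f ->
  (forall g l eps, unit_ball g -> (forall z, In z l -> disc z) -> 0 < eps ->
     exists n, forall z, In z l -> Cmod (f (iterate phi n z) - g z)%C < eps) ->
  forall z w, disc z -> disc w -> pdist z w <= pdist (phi z) (phi w).
Proof.
  intros Hphi Hf Hu z w Hz Hw. apply Rnot_lt_le. intros Hlt.
  assert (Hx : exists x, (x = z \/ x = w) /\ x <> RtoC 0).
  { destruct (classic (z = RtoC 0)) as [-> | N]; [|now exists z; auto].
    destruct (classic (w = RtoC 0)) as [-> | N]; [|now exists w; auto].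
    rewrite pdist_0_l, Cmod_0 in Hlt. pose proof (pdist_ge_0 (phi 0) (phi 0)). lra. }
  destruct Hx as [x [Hx Nx]].
  assert (Hc : exists c, Cmod c = 1 /\ (c * x)%C <> f x).
  { destruct (classic ((RtoC 1 * x)%C = f x)) as [E | N].
    - exists (- RtoC 1)%C. split; [rewrite Cmod_opp; apply Cmod_1 |]. intros E'.
      apply (Cmult_neq_0 _ _ RtoC_2_neq Nx). rewrite <- E in E'.
      transitivity (RtoC 1 * x - - (1) * x)%C; [rewrite RtoC_2; ring | rewrite E'; ring].
    - exists (RtoC 1). split; [apply Cmod_1 | exact N]. }
  destruct Hc as [c [Hc Nc]].
  set (D := Cmod (1 - Cconj z * w)%C).
  assert (HD : 0 < D) by (apply one_sub_conj_mul_pos; [unfold disc in Hz; lra | exact Hw]).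
  set (r := pdist (phi z) (phi w)) in *.
  assert (Hr : 0 <= r) by apply pdist_ge_0.
  set (e := Rmin ((pdist z w - r) * D / 8) (Cmod (f x - c * x)%C)).
  assert (He : 0 < e).
  { apply Rmin_pos.
    - apply Rdiv_lt_0_compat; [|lra]. apply Rmult_lt_0_compat; lra.
    - apply Cmod_pos, Csub_neq_0. now apply not_eq_sym. }
  assert (He1 : e <= (pdist z w - r) * D / 8) by apply Rmin_l.
  assert (He2 : e <= Cmod (f x - c * x)%C) by apply Rmin_r.
  destruct (Hu (fun z => c * z)%C (z :: w :: nil) e) as [n Hn].
  - now apply unit_ball_scaled_id.
  - intros v [<- | [<- | []]]; assumption.
  - exact He.
  - destruct n as [|n].
    { assert (K : Cmod (f x - c * x)%C < e).
      { apply (Hn x). destruct Hx as [-> | ->]; simpl; auto. }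
      lra. }
    pose proof (Hn z (or_introl eq_refl)) as K1.
    pose proof (Hn w (or_intror (or_introl eq_refl))) as K2.
    pose proof (iterate_disc phi (S n) z (proj2 Hphi) Hz) as D1.
    pose proof (iterate_disc phi (S n) w (proj2 Hphi) Hw) as D2.
    pose proof (unit_ball_schwarz_pick f _ _ Hf D1 D2) as SP.
    pose proof (iterate_contracts phi n z w Hphi Hz Hw) as Hp. fold r in Hp.
    pose proof (pdist_lt_1 (phi z) (phi w) (proj2 Hphi z Hz) (proj2 Hphi w Hw)) as Hr1.
    fold r in Hr1. pose proof (pdist_ge_0 (iterate phi (S n) z) (iterate phi (S n) w)).
    set (X := f (iterate phi (S n) z)) in *. set (Y := f (iterate phi (S n) w)) in *.
    assert (B : Cmod (1 - Cconj X * Y)%C <= D + 2 * e).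
    { assert (E : D = Cmod (1 - Cconj (c * z) * (c * w))%C).
      { unfold D. f_equal. rewrite Cmult_conj.
        transitivity (1 - (Cconj c * c) * (Cconj z * w))%C;
          [rewrite (Cconj_unit c Hc); ring | ring]. }
      rewrite E. apply one_sub_conj_mul_lipschitz; try lra.
      - apply Hf, D1.
      - rewrite Cmod_mult, Hc. unfold disc in Hw. lra. }
    assert (A : Cmod (w - z)%C <= Cmod (Y - X)%C + 2 * e).
    { replace (Cmod (w - z)%C) with (Cmod (c * w - c * z)%C).
      - pose proof (Cmod_triangle_mid (c * w)%C Y (c * z)%C) as T1.
        pose proof (Cmod_triangle_mid Y X (c * z)%C) as T2.
        rewrite (Cmod_sub_sym (c * w)%C Y) in T1. lra.
      - replace (c * w - c * z)%C with (c * (w - z))%C by ring.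
        rewrite Cmod_mult, Hc. ring. }
    rewrite <- (Cmod_beta z w) in A by (trivial; unfold disc in Hz; lra). fold D in A.
    pose proof (Cmod_ge_0 (1 - Cconj X * Y)%C). nra.
Qed.

(** At a fixed point of [phi] in the disc, all [f o phi^n] would take the same
    value. *)
Lemma universal_attracting_form (phi f : C -> C) :
  holomorphic_self_map phi -> unit_ball f ->
  (forall g l eps, unit_ball g -> (forall z, In z l -> disc z) -> 0 < eps ->
     exists n, forall z, In z l -> Cmod (f (iterate phi n z) - g z)%C < eps) ->
  automorphism phi /\ exists p mu tau, attracting_form phi p mu tau.
Proof.
  intros Hphi Hf Hu.
  destruct (isometry_mobius phi Hphi (universal_isometry phi f Hphi Hf Hu)) as [u [a Hm]].
  split; [now apply (mobius_automorphism phi u a) |].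
  apply (attracting_form_exists phi u a Hm). intros z Hz Ez.
  assert (Eit : forall n, iterate phi n z = z).
  { induction n as [|n IH]; [reflexivity |].
    change (iterate phi (S n) z) with (phi (iterate phi n z)). now rewrite IH. }
  assert (Hc : exists c, Cmod c <= 1 /\ f z <> c).
  { destruct (classic (f z = RtoC 0)) as [E | N].
    - exists (RtoC 1). rewrite Cmod_1, E. split; [lra | apply not_eq_sym, C1_nz].
    - exists (RtoC 0). rewrite Cmod_0. split; [lra | exact N]. }
  destruct Hc as [c [Hc Nc]].
  destruct (Hu (fun _ => c) (z :: nil) (Cmod (f z - c)%C)) as [n Hn].
  - now apply unit_ball_const.
  - now intros v [<- | []].
  - now apply Cmod_pos, Csub_neq_0.
  - specialize (Hn z (or_introl eq_refl)). rewrite Eit in Hn. lra.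
Qed.

(** In the half-plane, both orbits have real part [mu^n], and their imaginary
    parts differ by a bounded multiple of [mu^n]. A function bounded by one can
    then not be close to [0] on one orbit and to [1] on the other. *)
Lemma same_form_bounded (phi1 phi2 : C -> C) (p : C) (mu tau1 tau2 : R) :
  normal_form phi1 p mu tau1 -> normal_form phi2 p mu tau2 -> 1 < mu ->
  exists c, 0 <= c < 1 /\ forall n, pdist (iterate phi1 n 0) (iterate phi2 n 0) <= c.
Proof.
  intros H1 H2 Hmu. pose proof H1 as [Hp _].
  set (K := ((tau1 - tau2) / (mu - 1)) ^ 2). assert (HK : 0 <= K) by apply pow2_ge_0.
  set (c2 := K / (4 + K)).
  assert (Hc2 : 0 <= c2 < 1).
  { unfold c2. split; [apply Rdiv_le_0_compat; lra |].
    apply Rmult_lt_reg_r with (4 + K); [lra |].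
    unfold Rdiv. rewrite Rmult_assoc, Rinv_l by lra. lra. }
  pose proof (sqrt_sqrt c2 (proj1 Hc2)) as Es. pose proof (sqrt_pos c2).
  exists (sqrt c2). split; [nra |]. intros n.
  destruct (normal_form_iterate phi1 p mu tau1 n H1) as [_ [Hm E1]].
  destruct (normal_form_iterate phi2 p mu tau2 n H2) as [_ [_ E2]].
  destruct (E1 0 disc_0) as [D1 F1]. destruct (E2 0 disc_0) as [D2 F2].
  rewrite (cayley_0 p Hp) in F1, F2.
  pose proof (pdist_cayley p _ _ Hp D1 D2) as E. rewrite F1, F2 in E.
  pose proof (geometric_sum_mul mu n) as G.
  set (m := mu ^ n) in *. set (g := geometric_sum mu n) in *.
  assert (Hg : 0 <= g * (mu - 1) <= m).
  { split; [|nra]. rewrite Rmult_comm, G. pose proof (pow_R1_Rle mu n ltac:(lra)) as R1.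
    fold m in R1. lra. }
  set (pd := pdist (iterate phi1 n 0) (iterate phi2 n 0)) in *.
  assert (Hpd : 0 <= pd) by apply pdist_ge_0.
  rewrite Cmod_sqr in E. simpl in E.
  replace (m * 1 - 0 * 0 + (0 * (tau1 * g) - 1 * 0) + (m * 1 - 0 * 0 + (0 * (tau2 * g) - 1 * 0)))
    with (2 * m) in E by ring.
  assert (E' : (1 - pd ^ 2) * (4 * m ^ 2 + ((tau1 - tau2) * g) ^ 2) = 4 * m ^ 2).
  { simpl. nra. }
  assert (Hk : ((tau1 - tau2) * g) ^ 2 <= K * m ^ 2).
  { unfold K. replace ((tau1 - tau2) * g) with ((tau1 - tau2) / (mu - 1) * (g * (mu - 1)))
      by (field; lra).
    rewrite Rpow_mult_distr. apply Rmult_le_compat_l; [exact HK |].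
    apply pow_incr. exact Hg. }
  assert (Hm2 : 0 < m ^ 2) by (now apply pow_lt).
  assert (Hpd1 : 0 <= 1 - pd ^ 2).
  { pose proof (pdist_lt_1 _ _ D1 D2) as L. fold pd in L. nra. }
  assert (L : 4 * m ^ 2 <= (1 - pd ^ 2) * ((4 + K) * m ^ 2)).
  { rewrite <- E'. apply Rmult_le_compat_l; [exact Hpd1 | lra]. }
  assert (L2 : 4 <= (1 - pd ^ 2) * (4 + K)).
  { apply Rmult_le_reg_r with (m ^ 2); [exact Hm2 |]. lra. }
  assert (L3 : pd ^ 2 <= c2).
  { apply Rmult_le_reg_r with (4 + K); [lra |]. unfold c2, Rdiv.
    rewrite Rmult_assoc, Rinv_l by lra. lra. }
  destruct (Rle_lt_dec pd (sqrt c2)); [assumption | nra].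
Qed.

Lemma universal_necessary (phi1 phi2 f : C -> C) :
  holomorphic_self_map phi1 -> holomorphic_self_map phi2 ->
  disjointly_universal phi1 phi2 f ->
  ~ eq_on_disc phi1 phi2 /\
  (parabolic phi1 \/ hyperbolic phi1) /\ (parabolic phi2 \/ hyperbolic phi2) /\
  ((exists a, attractive phi1 a /\ attractive phi2 a) ->
   forall lam1 lam2, is_multiplier phi1 lam1 -> is_multiplier phi2 lam2 -> lam1 <> lam2).
Proof.
  intros h1 h2 Hu. pose proof Hu as [Hf _].
  assert (U0 : unit_ball (fun _ => RtoC 0)) by (apply unit_ball_const; rewrite Cmod_0; lra).
  assert (U1 : unit_ball (fun _ => RtoC 1)) by (apply unit_ball_const; rewrite Cmod_1; lra).
  assert (S0 : forall z, In z (RtoC 0 :: nil) -> disc z)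
    by (intros z [<- | []]; apply disc_0).
  destruct (universal_attracting_form phi1 f h1 Hf) as [A1 [p1 [mu1 [tau1 F1]]]].
  { intros g l e Hg Hl He. destruct (universal_pointwise phi1 phi2 f g g l e) as [n Hn]; auto.
    exists n. intros z Hz. now apply Hn. }
  destruct (universal_attracting_form phi2 f h2 Hf) as [A2 [p2 [mu2 [tau2 F2]]]].
  { intros g l e Hg Hl He. destruct (universal_pointwise phi1 phi2 f g g l e) as [n Hn]; auto.
    exists n. intros z Hz. now apply Hn. }
  split; [|split; [|split]].
  - intros Heq.
    assert (Eit : forall n, iterate phi1 n 0 = iterate phi2 n 0).
    { induction n as [|n IH]; [reflexivity |].
      change (phi1 (iterate phi1 n 0) = phi2 (iterate phi2 n 0)). rewrite IH. apply Heq.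
      apply iterate_disc; [apply h2 | apply disc_0]. }
    destruct (universal_pointwise phi1 phi2 f (fun _ => RtoC 0) (fun _ => RtoC 1)
      (RtoC 0 :: nil) (1 / 2) Hu U0 U1 S0 ltac:(lra)) as [n Hn].
    destruct (Hn 0 (or_introl eq_refl)) as [K1 K2]. rewrite Eit in K1.
    pose proof (Cmod_triangle_mid 1 (f (iterate phi2 n 0)) 0) as T.
    rewrite (Cmod_sub_sym 1 (f (iterate phi2 n 0))) in T. replace (1 - 0)%C with (RtoC 1) in T by ring.
    rewrite Cmod_1 in T. lra.
  - now apply (classification phi1 p1 mu1 tau1).
  - now apply (classification phi2 p2 mu2 tau2).
  - intros [a [Ha1 Ha2]] lam1 lam2 M1 M2 Heq. subst lam2.
    pose proof (attractive_unique phi1 p1 a (attractive_of_form _ _ _ _ F1) Ha1).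
    pose proof (attractive_unique phi2 p2 a (attractive_of_form _ _ _ _ F2) Ha2).
    subst p1 p2.
    pose proof (multiplier_eq phi1 a mu1 tau1 lam1 F1 M1).
    pose proof (multiplier_eq phi2 a mu2 tau2 lam1 F2 M2). subst mu1 mu2.
    destruct (same_form_bounded phi1 phi2 a lam1 tau1 tau2 (proj1 F1) (proj1 F2) (proj1 M1))
      as [c [Hc K]].
    set (e := (1 - c) / 4).
    destruct (universal_pointwise phi1 phi2 f (fun _ => RtoC 0) (fun _ => RtoC 1)
      (RtoC 0 :: nil) e Hu U0 U1 S0 ltac:(unfold e; lra)) as [n Hn].
    destruct (Hn 0 (or_introl eq_refl)) as [K1 K2].
    pose proof (iterate_disc phi1 n 0 (proj2 h1) disc_0) as D1.
    pose proof (iterate_disc phi2 n 0 (proj2 h2) disc_0) as D2.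
    pose proof (unit_ball_schwarz_pick f _ _ Hf D1 D2) as SP.
    specialize (K n). pose proof (pdist_ge_0 (iterate phi1 n 0) (iterate phi2 n 0)).
    set (X := f (iterate phi1 n 0)) in *. set (Y := f (iterate phi2 n 0)) in *.
    assert (HY : Cmod Y <= 1) by apply Hf, D2. pose proof (Cmod_ge_0 Y). pose proof (Cmod_ge_0 X).
    replace (X - 0)%C with X in K1 by ring.
    pose proof (Cmod_triangle_sub 1 (Cconj X * Y)%C) as T1.
    rewrite Cmod_1, Cmod_mult, Cmod_conj in T1.
    pose proof (Cmod_triangle_mid 1 Y X) as T2. rewrite (Cmod_sub_sym 1 Y) in T2.
    pose proof (Cmod_triangle_rev 1 X) as T3. rewrite Cmod_1 in T3.
    pose proof (Cmod_ge_0 (1 - Cconj X * Y)%C).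
    assert (Cmod X * Cmod Y <= e) by nra.
    assert (B : Cmod (Y - X)%C <= c * (1 + e)) by nra.
    unfold e in *. nra.
Qed.

(** * Approximation by finite Blaschke products *)

(** Interpolation nodes; they are distinct because [holo_off] records nothing
    about the differentiability of a quotient at the zero divided out. *)
Definition node (j : nat) : C := RtoC (/ (INR j + 2)).

Lemma node_bounds (j : nat) : 0 < / (INR j + 2) <= / 2.
Proof.
  pose proof (pos_INR j). split; [apply Rinv_0_lt_compat; lra |].
  apply Rinv_le_contravar; lra.
Qed.

Lemma Cmod_node (j : nat) : Cmod (node j) <= / 2.
Proof. pose proof (node_bounds j). unfold node. rewrite Cmod_RtoC_pos; lra. Qed.

Lemma node_disc (j : nat) : disc (node j).
Proof. pose proof (Cmod_node j). unfold disc. lra. Qed.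

Lemma node_inj (j k : nat) : node j = node k -> j = k.
Proof.
  intros H. apply RtoC_inj in H. pose proof (pos_INR j). pose proof (pos_INR k).
  apply Rinv_eq_reg in H. apply INR_eq. lra.
Qed.

(** The functions obtained from the constant [1] by inverting the steps of the
    Schur-Nevanlinna algorithm. *)
Fixpoint schur (l : list C) (j : nat) (z : C) : C :=
  match l with
  | nil => RtoC 1
  | g :: l' => beta (- g)%C (beta (node j) z * schur l' (S j) z)%C
  end.

Definition in_disc (l : list C) : Prop := forall a, In a l -> disc a.

Lemma disc_opp (z : C) : disc z -> disc (- z)%C.
Proof. unfold disc. now rewrite Cmod_opp. Qed.

Lemma disc_mul (z w : C) : disc z -> Cmod w <= 1 -> disc (z * w)%C.
Proof.
  unfold disc. intros Hz Hw. rewrite Cmod_mult. pose proof (Cmod_ge_0 z).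
  pose proof (Cmod_ge_0 w). nra.
Qed.

Lemma schur_bound (l : list C) : in_disc l -> forall j z, disc z -> Cmod (schur l j z) <= 1.
Proof.
  induction l as [|g l IH]; intros Hl j z Hz; simpl.
  - rewrite Cmod_1. lra.
  - left. apply beta_disc.
    + apply disc_opp, Hl. now left.
    + apply disc_mul; [apply beta_disc; [apply node_disc | exact Hz] |].
      apply IH; [|exact Hz]. intros a Ha. apply Hl. now right.
Qed.

Lemma node_factor_disc (l : list C) (j k : nat) (z : C) : in_disc l -> disc z ->
  disc (beta (node j) z * schur l k z)%C.
Proof.
  intros Hl Hz. apply disc_mul; [apply beta_disc; [apply node_disc | exact Hz] |].
  now apply schur_bound.
Qed.

Lemma pdist_node_bound (j : nat) (r : R) (z : C) : r < 1 -> Cmod z <= r ->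
  pdist (node j) z <= sqrt (1 - 3 / 16 * (1 - r ^ 2)).
Proof.
  intros Hr Hz. pose proof (Cmod_node j) as Hn. pose proof (Cmod_ge_0 (node j)).
  pose proof (Cmod_ge_0 z). assert (Dz : disc z) by (unfold disc; lra).
  pose proof (one_sub_pdist_sqr (node j) z ltac:(lra) Dz) as E.
  pose proof (Cmod_triangle_sub 1 (Cconj (node j) * z)%C) as T.
  rewrite Cmod_1, Cmod_mult, Cmod_conj in T.
  pose proof (one_sub_conj_mul_pos (node j) z ltac:(lra) Dz) as P.
  pose proof (pdist_lt_1 (node j) z (node_disc j) Dz).
  pose proof (pdist_ge_0 (node j) z).
  set (D := Cmod (1 - Cconj (node j) * z)%C) in *.
  assert (HD2 : D <= 2) by nra. assert (HD : D ^ 2 <= 4) by nra.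
  assert (A : 3 / 4 <= 1 - Cmod (node j) ^ 2) by nra.
  assert (B : 1 - r ^ 2 <= 1 - Cmod z ^ 2) by nra.
  assert (B0 : 0 <= 1 - r ^ 2) by nra.
  assert (L : 3 / 4 * (1 - r ^ 2) <= (1 - pdist (node j) z ^ 2) * 4).
  { apply Rle_trans with ((1 - Cmod (node j) ^ 2) * (1 - Cmod z ^ 2)).
    - apply Rmult_le_compat; lra.
    - rewrite <- E. apply Rmult_le_compat_l; nra. }
  apply Rsqr_incr_0; [|lra|apply sqrt_pos].
  rewrite Rsqr_sqrt by nra. unfold Rsqr. lra.
Qed.

Definition contraction_factor (t : R) : R := 2 * t / (1 + t ^ 2).

Lemma contraction_factor_bounds (t : R) : 0 <= t < 1 -> 0 <= contraction_factor t < 1.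
Proof.
  intros Ht. unfold contraction_factor. split.
  - apply Rdiv_le_0_compat; nra.
  - apply Rmult_lt_reg_r with (1 + t ^ 2); [nra |].
    unfold Rdiv. rewrite Rmult_assoc, Rinv_l by nra. nra.
Qed.

(** Multiplication by [b], with [|b| <= t0 < 1], contracts pseudo-hyperbolic
    distances by a uniform factor; here [x] stands for [conj(u) v]. *)
Lemma scaling_contracts (t t0 : R) (x : C) : 0 <= t <= t0 -> t0 < 1 -> Cmod x <= 1 ->
  t * Cmod (1 - x)%C <= contraction_factor t0 * Cmod (1 - RtoC (t ^ 2) * x)%C.
Proof.
  intros Ht Ht0 Hx.
  assert (L : (1 + t ^ 2) * Cmod (1 - x)%C <= 2 * Cmod (1 - RtoC (t ^ 2) * x)%C).
  { replace ((1 + t ^ 2) * Cmod (1 - x)%C) with (Cmod (RtoC (1 + t ^ 2) * (1 - x))%C)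
      by (rewrite Cmod_mult, Cmod_RtoC_pos; nra).
    replace (2 * Cmod (1 - RtoC (t ^ 2) * x)%C)
      with (Cmod (RtoC 2 * (1 - RtoC (t ^ 2) * x))%C)
      by (rewrite Cmod_mult, Cmod_RtoC_pos; lra).
    apply Cmod_le_sqr.
    assert (Hm : Re x ^ 2 + Im x ^ 2 <= 1).
    { rewrite <- Cmod_sqr. pose proof (Cmod_ge_0 x). nra. }
    rewrite !Cmod_sqr. destruct x as [a b]. simpl Re in *. simpl Im in *.
    assert (0 <= t ^ 2 <= 1) by nra.
    assert (Ha : -1 <= a) by nra.
    assert (0 <= (1 - t ^ 2) ^ 2 * (1 + a)) by (apply Rmult_le_pos; [apply pow2_ge_0 | lra]).
    assert (0 <= (1 - t ^ 2) * (1 + 3 * t ^ 2) * (1 - (a ^ 2 + b ^ 2))).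
    { apply Rmult_le_pos; [apply Rmult_le_pos; lra | lra]. }
    apply Rminus_le_0.
    match goal with |- 0 <= ?X => replace X with
      (2 * ((1 - t ^ 2) ^ 2 * (1 + a)) + (1 - t ^ 2) * (1 + 3 * t ^ 2) * (1 - (a ^ 2 + b ^ 2)))
      by (simpl; ring) end.
    lra. }
  assert (K : t * (1 + t0 ^ 2) <= t0 * (1 + t ^ 2)).
  { assert (0 <= (t0 - t) * (1 - t * t0)) by (apply Rmult_le_pos; nra). lra. }
  pose proof (Cmod_ge_0 (1 - x)%C). pose proof (Cmod_ge_0 (1 - RtoC (t ^ 2) * x)%C).
  set (A := Cmod (1 - x)%C) in *. set (B := Cmod (1 - RtoC (t ^ 2) * x)%C) in *.
  unfold contraction_factor. apply Rmult_le_reg_r with (1 + t0 ^ 2); [nra |].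
  replace (2 * t0 / (1 + t0 ^ 2) * B * (1 + t0 ^ 2)) with (t0 * (2 * B)) by (field; nra).
  apply Rle_trans with (t0 * ((1 + t ^ 2) * A)); [|apply Rmult_le_compat_l; lra].
  replace (t * A * (1 + t0 ^ 2)) with (t * (1 + t0 ^ 2) * A) by ring.
  replace (t0 * ((1 + t ^ 2) * A)) with (t0 * (1 + t ^ 2) * A) by ring.
  now apply Rmult_le_compat_r.
Qed.

Lemma beta_strict_bound (g w : C) (s : R) : Cmod g <= s -> Cmod w <= s -> s < 1 ->
  Cmod (beta g w) <= sqrt (1 - (1 - s ^ 2) ^ 2 / 4).
Proof.
  intros Hg Hw Hs. fold (pdist g w).
  pose proof (Cmod_ge_0 g). pose proof (Cmod_ge_0 w).
  assert (Dg : disc g) by (unfold disc; lra). assert (Dw : disc w) by (unfold disc; lra).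
  pose proof (one_sub_pdist_sqr g w ltac:(lra) Dw) as E.
  pose proof (Cmod_triangle_sub 1 (Cconj g * w)%C) as T.
  rewrite Cmod_1, Cmod_mult, Cmod_conj in T.
  pose proof (one_sub_conj_mul_pos g w ltac:(lra) Dw) as P.
  pose proof (pdist_lt_1 g w Dg Dw). pose proof (pdist_ge_0 g w).
  set (D := Cmod (1 - Cconj g * w)%C) in *.
  assert (HD2 : D <= 2) by nra. assert (HD : D ^ 2 <= 4) by nra.
  assert (L : (1 - s ^ 2) * (1 - s ^ 2) <= (1 - pdist g w ^ 2) * 4).
  { apply Rle_trans with ((1 - Cmod g ^ 2) * (1 - Cmod w ^ 2)).
    - apply Rmult_le_compat; nra.
    - rewrite <- E. apply Rmult_le_compat_l; nra. }
  assert (0 <= 1 - s ^ 2 <= 1) by nra.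
  apply Rsqr_incr_0; [|lra|apply sqrt_pos].
  rewrite Rsqr_sqrt by nra. unfold Rsqr. lra.
Qed.

Lemma beta_opp_inv (g w : C) : disc g -> Cmod w <= 1 -> beta (- g)%C (beta g w) = w.
Proof.
  intros Hg Hw. pose proof Hg as Hg'. unfold disc in Hg'.
  assert (N : (1 - Cconj g * w)%C <> RtoC 0) by (now apply one_sub_conj_mul_neq_closed).
  assert (N0 : (1 - Cconj g * g)%C <> RtoC 0) by (apply one_sub_conj_mul_neq_closed; [exact Hg | lra]).
  unfold beta. rewrite Copp_conj.
  replace ((w - g) / (1 - Cconj g * w) - - g)%C
    with (w * (1 - Cconj g * g) / (1 - Cconj g * w))%C by (now field).
  replace (1 - - Cconj g * ((w - g) / (1 - Cconj g * w)))%C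
    with ((1 - Cconj g * g) / (1 - Cconj g * w))%C by (now field).
  field. auto.
Qed.

(** Divide out the value at a node with a Moebius map, and the zero created
    there with a Blaschke factor; the error in the remaining function enters
    contracted. *)
Lemma schur_approximation (r : R) (n : nat) : 0 <= r < 1 ->
  forall (j : nat) (F : list C) (f : C -> C) (s : R),
  holo_off F f -> s < 1 -> (forall z, disc z -> Cmod (f z) <= s) ->
  (forall k, (j <= k)%nat -> ~ In (node k) F) ->
  exists l, in_disc l /\ forall z, Cmod z <= r ->
    Cmod (schur l j z - f z)%C <=
    contraction_factor (sqrt (1 - 3 / 16 * (1 - r ^ 2))) ^ n
    * Cmod (1 - Cconj (f z) * schur l j z)%C.
Proof.
  intros Hr. set (t0 := sqrt (1 - 3 / 16 * (1 - r ^ 2))).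
  assert (Ht0 : 0 <= t0 < 1).
  { split; [apply sqrt_pos |]. rewrite <- sqrt_1. apply sqrt_lt_1_alt. nra. }
  pose proof (contraction_factor_bounds t0 Ht0) as Hka.
  induction n as [|n IH]; intros j F f s Hf Hs1 Hs HF.
  - exists nil. split; [intros a [] |]. intros z Hz. simpl.
    rewrite Rmult_1_l. right. rewrite <- (Cmod_conj (1 - f z)%C). f_equal.
    rewrite Cminus_conj, Cconj_1. ring.
  - set (a := node j). pose proof (node_disc j) as Da. fold a in Da.
    set (g := f a). pose proof (Hs a Da) as Hg. fold g in Hg.
    assert (Dg : disc g) by (unfold disc; lra).
    set (s' := sqrt (1 - (1 - s ^ 2) ^ 2 / 4)).
    pose proof (Cmod_ge_0 g).
    assert (Hs' : s' < 1).
    { assert (X0 : 0 < 1 - s ^ 2) by nra. assert (X1 : 1 - s ^ 2 <= 1) by nra.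
      rewrite <- sqrt_1. apply sqrt_lt_1_alt.
      assert (0 < (1 - s ^ 2) ^ 2) by (now apply pow_lt).
      assert ((1 - s ^ 2) ^ 2 <= 1 ^ 2) by (apply pow_incr; lra). lra. }
    destruct (schwarz_division F (fun z => beta g (f z)) a s') as [f1 [Hf1 [B1 E1]]].
    + unfold beta. apply holo_off_div.
      * intros z Hz. apply one_sub_conj_mul_neq_closed; [exact Dg | specialize (Hs z Hz); lra].
      * apply holo_off_minus; [exact Hf | apply holo_off_const].
      * apply holo_off_minus; [apply holo_off_const |].
        apply holo_off_mult; [apply holo_off_const | exact Hf].
    + intros z Hz. now apply beta_strict_bound; [|apply Hs|].
    + exact Da.
    + apply HF. lia.
    + fold g. unfold beta. replace (g - g)%C with (RtoC 0) by ring. unfold Cdiv. ring.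
    + destruct (IH (S j) (a :: F) f1 s' Hf1 Hs' B1) as [l [Hl K]].
      { intros k Hk [Ek | Hin].
        - apply node_inj in Ek. lia.
        - apply (HF k); [lia | exact Hin]. }
      exists (g :: l). split; [intros b [<- | Hb]; auto |].
      intros z Hz. assert (Dz : disc z) by (unfold disc; lra).
      specialize (K z Hz). specialize (B1 z Dz). simpl. fold a.
      set (S1 := schur l (S j) z) in *.
      assert (HS1 : Cmod S1 <= 1) by (now apply schur_bound).
      set (b := beta a z) in *. assert (Db : disc b) by (now apply beta_disc).
      assert (Ef : f z = beta (- g)%C (b * f1 z)%C).
      { unfold b. rewrite <- E1 by exact Dz. rewrite beta_opp_inv; [reflexivity | exact Dg |].
        specialize (Hs z Dz). lra. }
      assert (Du : disc (b * f1 z)%C) by (apply disc_mul; [exact Db | lra]).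
      assert (Dv : disc (b * S1)%C) by (now apply disc_mul).
      pose proof (disc_opp g Dg) as Dg'.
      pose proof (beta_disc _ _ Dg' Du) as Du'. pose proof (beta_disc _ _ Dg' Dv) as Dv'.
      rewrite Ef.
      rewrite <- Cmod_beta by (trivial; unfold disc in Du'; lra).
      rewrite pdist_beta by assumption.
      apply Rmult_le_compat_r; [apply Cmod_ge_0 |].
      set (ka := contraction_factor t0) in *.
      assert (P : 0 < Cmod (1 - Cconj (b * f1 z) * (b * S1))%C)
        by (apply one_sub_conj_mul_pos; trivial; unfold disc in Du; lra).
      apply Rmult_le_reg_r with (1 := P).
      rewrite Cmod_beta by (trivial; unfold disc in Du; lra).
      replace (b * S1 - b * f1 z)%C with (b * (S1 - f1 z))%C by ring.
      rewrite Cmod_mult.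
      pose proof (scaling_contracts (Cmod b) t0 (Cconj (f1 z) * S1)%C) as SC.
      replace (Cconj (b * f1 z) * (b * S1))%C with (RtoC (Cmod b ^ 2) * (Cconj (f1 z) * S1))%C
        by (rewrite <- Cmod_conj_mul, Cmult_conj; ring).
      specialize (SC (conj (Cmod_ge_0 b) (pdist_node_bound j r z (proj2 Hr) Hz)) (proj2 Ht0)).
      assert (Hx : Cmod (Cconj (f1 z) * S1)%C <= 1).
      { rewrite Cmod_mult, Cmod_conj. pose proof (Cmod_ge_0 (f1 z)).
        pose proof (Cmod_ge_0 S1). nra. }
      specialize (SC Hx). fold ka in SC. simpl.
      assert (0 <= ka ^ n) by (apply pow_le; lra).
      pose proof (Cmod_ge_0 b).
      apply Rle_trans with (Cmod b * (ka ^ n * Cmod (1 - Cconj (f1 z) * S1)%C));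
        [now apply Rmult_le_compat_l |].
      replace (Cmod b * (ka ^ n * Cmod (1 - Cconj (f1 z) * S1)%C))
        with (ka ^ n * (Cmod b * Cmod (1 - Cconj (f1 z) * S1)%C)) by ring.
      rewrite (Rmult_comm ka (ka ^ n)), Rmult_assoc. now apply Rmult_le_compat_l.
Qed.

Lemma schur_dense (f : C -> C) (r eps : R) : unit_ball f -> 0 <= r < 1 -> 0 < eps ->
  exists l, in_disc l /\ forall z, Cmod z <= r -> Cmod (schur l 0 z - f z)%C <= eps.
Proof.
  intros [Hh Hb] Hr He.
  set (t0 := sqrt (1 - 3 / 16 * (1 - r ^ 2))).
  assert (Ht0 : 0 <= t0 < 1).
  { split; [apply sqrt_pos |]. rewrite <- sqrt_1. apply sqrt_lt_1_alt. nra. }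
  pose proof (contraction_factor_bounds t0 Ht0) as Hka.
  destruct (pow_lt_1_zero (contraction_factor t0)) with (y := eps / 4) as [n Hn].
  { rewrite Rabs_pos_eq; lra. }
  { lra. }
  specialize (Hn n (Nat.le_refl n)). rewrite Rabs_pos_eq in Hn by (apply pow_le; lra).
  (* Scaling by [1 - d] keeps all quotients of the algorithm strictly below one. *)
  set (d := Rmin (1 / 2) (eps / 2)).
  assert (Hd : 0 < d) by (apply Rmin_pos; lra).
  assert (Hd1 : d <= 1 / 2) by apply Rmin_l. assert (Hd2 : d <= eps / 2) by apply Rmin_r.
  assert (Hsb : forall z, disc z -> Cmod (RtoC (1 - d) * f z)%C <= 1 - d).
  { intros z Hz. rewrite Cmod_mult, Cmod_RtoC_pos by lra. specialize (Hb z Hz).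
    pose proof (Cmod_ge_0 (f z)). nra. }
  destruct (schur_approximation r n Hr 0 nil (fun z => RtoC (1 - d) * f z)%C (1 - d))
    as [l [Hl K]]; auto.
  { apply holo_off_mult; [apply holo_off_const | now apply holo_off_of_holomorphic]. }
  { lra. }
  exists l. split; [exact Hl |]. intros z Hz. assert (Dz : disc z) by (unfold disc; lra).
  specialize (K z Hz). fold t0 in K. specialize (Hsb z Dz).
  pose proof (schur_bound l Hl 0 z Dz) as HS.
  pose proof (Cmod_triangle_mid (schur l 0 z) (RtoC (1 - d) * f z)%C (f z)) as T.
  assert (T2 : Cmod (RtoC (1 - d) * f z - f z)%C <= eps / 2).
  { rewrite RtoC_minus. replace ((1 - RtoC d) * f z - f z)%C with (- (RtoC d * f z))%C by ring.
    rewrite Cmod_opp, Cmod_mult, Cmod_RtoC_pos by lra. specialize (Hb z Dz).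
    pose proof (Cmod_ge_0 (f z)). nra. }
  pose proof (Cmod_triangle_sub 1 (Cconj (RtoC (1 - d) * f z) * schur l 0 z)%C) as T3.
  rewrite Cmod_1, (Cmod_mult (Cconj _)), Cmod_conj in T3.
  pose proof (Cmod_ge_0 (RtoC (1 - d) * f z)%C). pose proof (Cmod_ge_0 (schur l 0 z)).
  assert (T4 : Cmod (1 - Cconj (RtoC (1 - d) * f z) * schur l 0 z)%C <= 2) by nra.
  pose proof (Cmod_ge_0 (1 - Cconj (RtoC (1 - d) * f z) * schur l 0 z)%C).
  assert (0 <= contraction_factor t0 ^ n) by (apply pow_le; lra).
  nra.
Qed.

(** * Rational inner functions are finite Blaschke products *)

(** As a predicate on functions, which leaves no representation to manipulate:
    dividing out a root is an induction on the construction. *)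
Inductive polynomial : (C -> C) -> Prop :=
| poly_const c : polynomial (fun _ => c)
| poly_id : polynomial (fun z => z)
| poly_plus p q : polynomial p -> polynomial q -> polynomial (fun z => p z + q z)%C
| poly_mult p q : polynomial p -> polynomial q -> polynomial (fun z => p z * q z)%C.

Lemma polynomial_cdiff (p : C -> C) (z : C) : polynomial p -> cdiff p z.
Proof.
  induction 1; [apply cdiff_const | apply cdiff_id | now apply cdiff_plus | now apply cdiff_mult].
Qed.

Lemma polynomial_slope (p : C -> C) (a : C) : polynomial p ->
  exists q, polynomial q /\ forall z, p z = (p a + (z - a) * q z)%C.
Proof.
  induction 1 as [c | | p q Hp [p' [Hp' Ep]] Hq [q' [Hq' Eq]]
    | p q Hp [p' [Hp' Ep]] Hq [q' [Hq' Eq]]].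
  - exists (fun _ => RtoC 0). split; [constructor | intros z; ring].
  - exists (fun _ => RtoC 1). split; [constructor | intros z; ring].
  - exists (fun z => p' z + q' z)%C. split; [now constructor |].
    intros z. rewrite (Ep z), (Eq z). ring.
  - exists (fun z => p z * q' z + p' z * q a)%C.
    split; [repeat constructor; assumption |].
    intros z. rewrite (Eq z). rewrite (Ep z) at 1. rewrite (Ep z). ring.
Qed.

Definition rational (f : C -> C) : Prop :=
  exists N D, polynomial N /\ polynomial D /\
  forall z, disc z -> D z <> RtoC 0 /\ f z = (N z / D z)%C.

Lemma rational_cdiff (f : C -> C) (z : C) : rational f -> disc z -> cdiff f z.
Proof.
  intros [N [D [HN [HD E]]]] Hz.
  apply (cdiff_disc_ext (fun z => N z / D z)%C); [|exact Hz|].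
  - intros w Hw. symmetry. now apply E.
  - apply cdiff_div; [now apply E | |]; now apply polynomial_cdiff.
Qed.

Lemma rational_holo_off (f : C -> C) : rational f -> holo_off nil f.
Proof.
  intros H z Hz. pose proof (rational_cdiff f z H Hz).
  split; [now apply cdiff_ccont | auto].
Qed.

Lemma polynomial_affine (a b : C) : polynomial (fun z => a + b * z)%C.
Proof. repeat constructor. Qed.

Lemma rational_beta (f : C -> C) (g : C) :
  rational f -> disc g -> (forall z, disc z -> Cmod (f z) <= 1) ->
  rational (fun z => beta g (f z)).
Proof.
  intros [N [D [HN [HD E]]]] Hg Hb.
  exists (fun z => N z + (- g) * D z)%C, (fun z => D z + (- Cconj g) * N z)%C.
  split; [repeat constructor; assumption |]. split; [repeat constructor; assumption |].
  intros z Hz. destruct (E z Hz) as [ND Ef]. specialize (Hb z Hz).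
  pose proof (one_sub_conj_mul_neq_closed g (f z) Hg Hb) as N1. rewrite Ef in N1.
  assert (E1 : (D z + - Cconj g * N z)%C = (D z * (1 - Cconj g * (N z / D z)))%C)
    by (now field).
  split.
  - rewrite E1. now apply Cmult_neq_0.
  - rewrite E1, Ef. unfold beta. field. split; [exact ND |].
    intros K. apply (Cmult_neq_0 _ _ ND N1). rewrite <- E1, <- K. ring.
Qed.

Lemma rational_mult (f g : C -> C) :
  rational f -> rational g -> rational (fun z => f z * g z)%C.
Proof.
  intros [N [D [HN [HD E]]]] [N' [D' [HN' [HD' E']]]].
  exists (fun z => N z * N' z)%C, (fun z => D z * D' z)%C.
  split; [now constructor |]. split; [now constructor |].
  intros z Hz. destruct (E z Hz) as [H1 ->]. destruct (E' z Hz) as [H2 ->].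
  split; [now apply Cmult_neq_0 | field; auto].
Qed.

Lemma rational_schur (l : list C) : in_disc l -> forall j, rational (schur l j).
Proof.
  induction l as [|g l IH]; intros Hl j; simpl.
  - exists (fun _ => RtoC 1), (fun _ => RtoC 1). split; [constructor |]. split; [constructor |].
    intros z _. split; [apply C1_nz | field; apply C1_nz].
  - assert (Hl' : in_disc l) by (intros a Ha; apply Hl; now right).
    apply (rational_beta (fun z => beta (node j) z * schur l (S j) z)%C).
    + apply rational_mult; [|now apply IH].
      exists (fun z => - node j + RtoC 1 * z)%C, (fun z => RtoC 1 + - Cconj (node j) * z)%C.
      split; [apply polynomial_affine |]. split; [apply polynomial_affine |].
      intros z Hz. pose proof (node_disc j) as Dn. unfold disc in Dn.
      pose proof (one_sub_conj_mul_neq (node j) z ltac:(lra) Hz) as N1.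
      replace (1 + - Cconj (node j) * z)%C with (1 - Cconj (node j) * z)%C by ring.
      split; [exact N1 | unfold beta; now field].
    + apply disc_opp, Hl. now left.
    + intros z Hz. left. now apply node_factor_disc.
Qed.

Definition unimodular_at_boundary (f : C -> C) : Prop :=
  forall t, t < 1 -> exists rho, 0 <= rho < 1 /\
  forall z, disc z -> rho < Cmod z -> t < Cmod (f z).

Lemma unimodular_at_boundary_mult (f g : C -> C) :
  unimodular_at_boundary f -> unimodular_at_boundary g -> unimodular_at_boundary (fun z => f z * g z)%C.
Proof.
  intros Hf Hg t Ht. set (t' := Rmax (1 / 2) (1 - (1 - t) / 2)).
  assert (H1 : 1 / 2 <= t') by apply Rmax_l. assert (H2 : 1 - (1 - t) / 2 <= t') by apply Rmax_r.
  assert (H3 : t' < 1) by (apply Rmax_lub_lt; lra).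
  destruct (Hf t' H3) as [r1 [R1 K1]]. destruct (Hg t' H3) as [r2 [R2 K2]].
  pose proof (Rmax_l r1 r2). pose proof (Rmax_r r1 r2).
  exists (Rmax r1 r2). split; [split; [lra | apply Rmax_lub_lt; lra] |].
  intros z Hz Hr. specialize (K1 z Hz ltac:(lra)). specialize (K2 z Hz ltac:(lra)).
  rewrite Cmod_mult. nra.
Qed.

Lemma unimodular_at_boundary_beta (f : C -> C) (g : C) :
  unimodular_at_boundary f -> disc g -> (forall z, disc z -> Cmod (f z) <= 1) ->
  unimodular_at_boundary (fun z => beta g (f z)).
Proof.
  intros Hf Hg Hb t Ht. destruct (pdist_near_boundary g t Hg Ht) as [r1 [R1 K1]].
  destruct (Hf r1 (proj2 R1)) as [r2 [R2 K2]]. exists r2. split; [exact R2 |].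
  intros z Hz Hr. specialize (K2 z Hz Hr). specialize (Hb z Hz).
  destruct Hb as [Hlt | Heq]; [now apply K1 |].
  assert (E : Cmod (beta g (f z)) = 1); [|lra].
  unfold beta. rewrite Cmod_div by (apply one_sub_conj_mul_neq_closed; trivial; lra).
  pose proof (Cmod_pos _ (one_sub_conj_mul_neq_closed g (f z) Hg ltac:(lra))) as P.
  assert (E2 : Cmod (f z - g)%C = Cmod (1 - Cconj g * f z)%C).
  { pose proof (Cmod_one_sub_conj_mul g (f z)) as I. rewrite Heq in I.
    apply Rle_antisym; apply Cmod_le_sqr; lra. }
  rewrite E2. field. lra.
Qed.

Lemma unimodular_at_boundary_schur (l : list C) : in_disc l -> forall j, unimodular_at_boundary (schur l j).
Proof.
  induction l as [|g l IH]; intros Hl j; simpl.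
  - intros t Ht. exists 0. split; [lra |]. intros z _ _. now rewrite Cmod_1.
  - assert (Hl' : in_disc l) by (intros a Ha; apply Hl; now right).
    apply (unimodular_at_boundary_beta (fun z => beta (node j) z * schur l (S j) z)%C).
    + apply unimodular_at_boundary_mult; [|now apply IH].
      intros t Ht. apply (pdist_near_boundary (node j) t (node_disc j) Ht).
    + apply disc_opp, Hl. now left.
    + intros z Hz. left. now apply node_factor_disc.
Qed.

Definition blaschke_zeros (l : list C) : Prop := forall a, In a l -> disc a /\ a <> RtoC 0.

Fixpoint bprod (l : list C) (z : C) : C :=
  match l with nil => RtoC 1 | a :: l' => (blaschke_factor a z * bprod l' z)%C end.

Lemma blaschke_factor_beta (a z : C) :
  blaschke_factor a z = (- (RtoC (Cmod a) / a) * beta a z)%C.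
Proof. unfold blaschke_factor, beta, Cdiv. ring. Qed.

Lemma Cmod_normalizer (a : C) : a <> RtoC 0 -> Cmod (RtoC (Cmod a) / a)%C = 1.
Proof.
  intros Ha. pose proof (Cmod_pos a Ha). rewrite Cmod_div by exact Ha.
  rewrite Cmod_RtoC_pos by lra. field. lra.
Qed.

Lemma Cmod_blaschke_factor (a z : C) : a <> RtoC 0 -> Cmod (blaschke_factor a z) = pdist a z.
Proof.
  intros Ha. rewrite blaschke_factor_beta, Cmod_mult, Cmod_opp, Cmod_normalizer by exact Ha.
  unfold pdist. ring.
Qed.

Lemma blaschke_factor_0 (a : C) : a <> RtoC 0 -> blaschke_factor a 0 = RtoC (Cmod a).
Proof.
  intros Ha. unfold blaschke_factor. replace (1 - Cconj a * 0)%C with (RtoC 1) by ring.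
  field. exact Ha.
Qed.

Lemma blaschke_factor_near_1 (a z : C) : disc a -> a <> RtoC 0 -> disc z ->
  Cmod (blaschke_factor a z - 1)%C <= 2 / (1 - Cmod z) * (1 - Cmod a).
Proof.
  intros Da Na Dz. pose proof Da as Da'. pose proof Dz as Dz'. unfold disc in Da', Dz'.
  pose proof (one_sub_conj_mul_neq a z ltac:(lra) Dz) as N.
  assert (Ea : (a * Cconj a)%C = RtoC (Cmod a * Cmod a)).
  { rewrite Cmult_comm, Cmod_conj_mul. f_equal. ring. }
  assert (E : (blaschke_factor a z - 1)%C
    = (- (RtoC (1 - Cmod a) * ((a + RtoC (Cmod a) * z) / a)) / (1 - Cconj a * z))%C).
  { apply Csub_eq_0. unfold blaschke_factor. rewrite RtoC_minus. rewrite RtoC_mult in Ea.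
    transitivity (z * (a * Cconj a - RtoC (Cmod a) * RtoC (Cmod a)) / (a * (1 - Cconj a * z)))%C.
    - field. auto.
    - rewrite Ea. field. auto. }
  rewrite E, Cmod_div, Cmod_opp, Cmod_mult by exact N.
  rewrite Cmod_div by exact Na. rewrite Cmod_RtoC_pos by lra.
  pose proof (Cmod_one_sub_conj_mul_ge a z) as L. pose proof (Cmod_pos a Na).
  pose proof (Cmod_ge_0 z).
  assert (T : Cmod (a + RtoC (Cmod a) * z)%C / Cmod a <= 2).
  { apply Rmult_le_reg_r with (Cmod a); [lra |]. unfold Rdiv.
    rewrite Rmult_assoc, Rinv_l by lra.
    pose proof (Cmod_triangle a (RtoC (Cmod a) * z)%C) as T.
    rewrite Cmod_mult, Cmod_RtoC_pos in T by lra. nra. }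
  assert (L2 : 1 - Cmod z <= Cmod (1 - Cconj a * z)%C) by nra.
  assert (L3 : / Cmod (1 - Cconj a * z)%C <= / (1 - Cmod z)) by (apply Rinv_le_contravar; lra).
  assert (0 <= Cmod (a + RtoC (Cmod a) * z)%C / Cmod a).
  { apply Rdiv_le_0_compat; [apply Cmod_ge_0 | lra]. }
  assert (0 < / Cmod (1 - Cconj a * z)%C) by (apply Rinv_0_lt_compat; lra).
  unfold Rdiv at 1. replace (2 / (1 - Cmod z) * (1 - Cmod a))
    with ((1 - Cmod a) * 2 * / (1 - Cmod z)) by (unfold Rdiv; ring).
  apply Rmult_le_compat; try lra.
  - apply Rmult_le_pos; lra.
  - apply Rmult_le_compat_l; lra.
Qed.

Lemma bprod_app (l l' : list C) (z : C) : bprod (l ++ l') z = (bprod l z * bprod l' z)%C.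
Proof. induction l as [|a l IH]; simpl; [ring | rewrite IH; ring]. Qed.

Lemma bprod_bound (l : list C) (z : C) : blaschke_zeros l -> disc z -> Cmod (bprod l z) <= 1.
Proof.
  intros Hl Hz. induction l as [|a l IH]; simpl; [rewrite Cmod_1; lra |].
  destruct (Hl a (or_introl eq_refl)) as [Da Na].
  rewrite Cmod_mult, Cmod_blaschke_factor by exact Na.
  pose proof (pdist_lt_1 a z Da Hz). pose proof (pdist_ge_0 a z).
  assert (Cmod (bprod l z) <= 1) by (apply IH; intros b Hb; apply Hl; now right).
  pose proof (Cmod_ge_0 (bprod l z)). nra.
Qed.

Lemma bprod_0 (l : list C) : blaschke_zeros l -> bprod l 0 = RtoC (Cmod (bprod l 0)).
Proof.
  intros Hl. induction l as [|a l IH]; simpl; [now rewrite Cmod_1 |].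
  destruct (Hl a (or_introl eq_refl)) as [Da Na].
  assert (E : bprod l 0 = RtoC (Cmod (bprod l 0))) by (apply IH; intros b Hb; apply Hl; now right).
  rewrite Cmod_mult, blaschke_factor_0, Cmod_RtoC_pos, RtoC_mult, <- E by (trivial; apply Cmod_ge_0).
  reflexivity.
Qed.

Lemma cdiff_blaschke_factor (a z : C) : disc a -> disc z -> cdiff (blaschke_factor a) z.
Proof.
  intros Da Dz. unfold blaschke_factor. apply cdiff_mult; [apply cdiff_const |].
  apply cdiff_div.
  - apply one_sub_conj_mul_neq; [unfold disc in Da; lra | exact Dz].
  - apply cdiff_minus; [apply cdiff_const | apply cdiff_id].
  - apply cdiff_minus; [apply cdiff_const |].
    apply cdiff_mult; [apply cdiff_const | apply cdiff_id].
Qed.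

Lemma bprod_cdiff (l : list C) (z : C) : blaschke_zeros l -> disc z -> cdiff (bprod l) z.
Proof.
  intros Hl Hz. induction l as [|a l IH]; [apply cdiff_const |].
  apply cdiff_mult.
  - apply cdiff_blaschke_factor; [apply (Hl a); now left | exact Hz].
  - apply IH. intros b Hb. apply Hl. now right.
Qed.

Lemma bprod_unit_ball (l : list C) : blaschke_zeros l -> unit_ball (bprod l).
Proof.
  intros Hl. split.
  - apply holomorphic_cdiff. intros z Hz. now apply bprod_cdiff.
  - intros z Hz. now apply bprod_bound.
Qed.

Lemma bprod_unimodular_at_boundary (l : list C) : blaschke_zeros l -> unimodular_at_boundary (bprod l).
Proof.
  intros Hl. induction l as [|a l IH].
  - intros t Ht. exists 0. split; [lra |]. intros z _ _. simpl. now rewrite Cmod_1.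
  - apply (unimodular_at_boundary_mult (blaschke_factor a) (bprod l)).
    + destruct (Hl a (or_introl eq_refl)) as [Da Na]. intros t Ht.
      destruct (pdist_near_boundary a t Da Ht) as [rho [Hr K]]. exists rho. split; [exact Hr |].
      intros z Hz Hrz. rewrite Cmod_blaschke_factor by exact Na. now apply K.
    + apply IH. intros b Hb. apply Hl. now right.
Qed.

(** If there is no zero, both the function and its inverse obey the maximum
    principle, which makes the function constant. *)
Lemma inner_without_zeros (f : C -> C) :
  rational f -> (forall z, disc z -> Cmod (f z) <= 1) -> unimodular_at_boundary f ->
  (forall z, disc z -> f z <> RtoC 0) ->
  Cmod (f 0) = 1 /\ forall z, disc z -> f z = f 0.
Proof.
  intros Hrat Hb Hin Hno. pose proof (rational_holo_off f Hrat) as Hh.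
  assert (Hinv : forall z, disc z -> Cmod (/ f z)%C <= 1).
  { apply (max_principle nil); [|lra|].
    - intros z Hz. pose proof (rational_cdiff f z Hrat Hz) as Hd.
      assert (K : cdiff (fun w => / f w)%C z) by (apply cdiff_inv; auto).
      split; [now apply cdiff_ccont | auto].
    - intros eps He.
      assert (Ht : / (1 + eps) < 1) by (rewrite <- Rinv_1; apply Rinv_lt_contravar; lra).
      destruct (Hin _ Ht) as [rho [Hr K]]. exists rho. split; [lra |].
      intros z Hz Hrz. specialize (K z Hz Hrz). rewrite Cmod_inv by auto.
      rewrite <- (Rinv_inv (1 + eps)). apply Rinv_le_contravar; [|lra].
      apply Rinv_0_lt_compat. lra. }
  assert (H1 : forall z, disc z -> Cmod (f z) = 1).
  { intros z Hz. apply Rle_antisym; [now apply Hb |].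
    specialize (Hinv z Hz). rewrite Cmod_inv in Hinv by auto.
    pose proof (Cmod_pos _ (Hno z Hz)) as P.
    apply Rmult_le_compat_l with (r := Cmod (f z)) in Hinv; [|lra].
    rewrite Rinv_r in Hinv by lra. lra. }
  split; [apply H1, disc_0 |]. intros z Hz.
  pose proof (schwarz_pick nil f 0 z Hh Hb disc_0 (fun H => H) Hz) as SP.
  assert (E : Cmod (1 - Cconj (f 0) * f z)%C = Cmod (f z - f 0)%C).
  { pose proof (H1 0 disc_0) as U. rewrite <- (Cconj_unit (f 0) U).
    replace (Cconj (f 0) * f 0 - Cconj (f 0) * f z)%C with (Cconj (f 0) * (f 0 - f z))%C by ring.
    rewrite Cmod_mult, Cmod_conj, U, Rmult_1_l. apply Cmod_sub_sym. }
  rewrite E in SP. pose proof (pdist_lt_1 0 z disc_0 Hz).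
  pose proof (Cmod_ge_0 (f z - f 0)%C). apply Cmod_sub_0. nra.
Qed.

(** The root is divided out of the numerator, so that the quotient is again
    rational, hence differentiable at the zero too, and a multiple zero can be
    divided out again. *)
Lemma inner_divide_zero (f : C -> C) (a : C) :
  rational f -> (forall z, disc z -> Cmod (f z) <= 1) -> disc a -> a <> RtoC 0 ->
  f a = RtoC 0 ->
  exists f1, rational f1 /\ (forall z, disc z -> Cmod (f1 z) <= 1) /\
    forall z, disc z -> f z = (blaschke_factor a z * f1 z)%C.
Proof.
  intros [N [D [HN [HD E]]]] Hb Da Na Ha.
  destruct (polynomial_slope N a HN) as [N1 [HN1 EN]].
  assert (NA : N a = RtoC 0).
  { destruct (E a Da) as [ND Ea]. rewrite Ha in Ea.
    replace (N a) with (N a / D a * D a)%C by (now field). rewrite <- Ea. ring. }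
  assert (Nm : RtoC (Cmod a) <> RtoC 0).
  { apply Cmod_pos_neq. rewrite Cmod_RtoC_pos; [now apply Cmod_pos | apply Cmod_ge_0]. }
  set (f1 := fun z => (- (a / RtoC (Cmod a)) * (1 - Cconj a * z) * N1 z / D z)%C).
  assert (Hrat : rational f1).
  { exists (fun z => (- (a / RtoC (Cmod a))) * (RtoC 1 + - Cconj a * z) * N1 z)%C, D.
    split; [repeat constructor; assumption |]. split; [exact HD |].
    intros z Hz. destruct (E z Hz) as [ND _]. split; [exact ND |]. unfold f1. now field. }
  assert (Hfac : forall z, disc z -> f z = (blaschke_factor a z * f1 z)%C).
  { intros z Hz. destruct (E z Hz) as [ND ->]. rewrite EN, NA.
    pose proof (one_sub_conj_mul_neq a z ltac:(unfold disc in Da; lra) Hz).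
    unfold blaschke_factor, f1. field. auto. }
  exists f1. split; [exact Hrat |]. split; [|exact Hfac].
  apply (max_principle nil); [now apply rational_holo_off | lra |]. intros eps He.
  assert (Ht : / (1 + eps) < 1) by (rewrite <- Rinv_1; apply Rinv_lt_contravar; lra).
  destruct (pdist_near_boundary a _ Da Ht) as [rho [Hr K]]. exists rho. split; [lra |].
  intros z Hz Hrz. specialize (K z Hz Hrz). specialize (Hb z Hz).
  rewrite (Hfac z Hz), Cmod_mult, Cmod_blaschke_factor in Hb by exact Na.
  pose proof (Cmod_ge_0 (f1 z)).
  assert (0 < / (1 + eps)) by (apply Rinv_0_lt_compat; lra).
  apply Rmult_le_reg_l with (/ (1 + eps)); [assumption |].
  rewrite Rinv_l by lra. nra.
Qed.

(** Zeros are divided out one by one. They all lie in a ball of radius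
    [R < 1], so each division increases the modulus at the origin by a factor
    [1 / R] at least, and there are finitely many. *)
Lemma inner_factorization (R0 : R) (n : nat) : 0 <= R0 < 1 -> forall f,
  rational f -> (forall z, disc z -> Cmod (f z) <= 1) -> unimodular_at_boundary f ->
  (forall z, disc z -> f z = RtoC 0 -> Cmod z <= R0) -> R0 ^ n < Cmod (f 0) ->
  exists c l, Cmod c = 1 /\ blaschke_zeros l /\
    forall z, disc z -> f z = (c * bprod l z)%C.
Proof.
  intros HR. induction n as [|n IH]; intros f Hrat Hb Hin Hz Hn.
  - simpl in Hn. specialize (Hb 0 disc_0). lra.
  - destruct (classic (exists a, disc a /\ f a = RtoC 0)) as [[a [Da Ha]] | Hno].
    + assert (Na : a <> RtoC 0).
      { intros ->. rewrite Ha, Cmod_0 in Hn. pose proof (pow_le R0 (S n) (proj1 HR)). lra. }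
      destruct (inner_divide_zero f a Hrat Hb Da Na Ha) as [f1 [Hrat1 [Hb1 E1]]].
      pose proof (Hz a Da Ha) as HaR. pose proof (Cmod_pos a Na) as Pa.
      destruct (IH f1 Hrat1 Hb1) as [c [l [Hc [Hl El]]]].
      * intros t Ht. destruct (Hin t Ht) as [rho [Hr K]]. exists rho. split; [exact Hr |].
        intros z Dz Hrz. specialize (K z Dz Hrz).
        rewrite (E1 z Dz), Cmod_mult, Cmod_blaschke_factor in K by exact Na.
        pose proof (pdist_lt_1 a z Da Dz). pose proof (pdist_ge_0 a z).
        pose proof (Cmod_ge_0 (f1 z)). nra.
      * intros z Dz H0. apply Hz; [exact Dz |]. rewrite (E1 z Dz), H0. ring.
      * rewrite (E1 0 disc_0), blaschke_factor_0, Cmod_mult, Cmod_RtoC_pos in Hn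
          by (trivial; lra).
        simpl in Hn. pose proof (Cmod_ge_0 (f1 0)). apply Rmult_lt_reg_l with R0; [lra |]. nra.
      * exists c, (a :: l). split; [exact Hc |]. split.
        { intros b [<- | Hb']; [now split | now apply Hl]. }
        intros z Dz. rewrite (E1 z Dz), (El z Dz). simpl. ring.
    + destruct (inner_without_zeros f Hrat Hb Hin) as [U K].
      { intros z Dz H0. apply Hno. now exists z. }
      exists (f 0), nil. split; [exact U |]. split; [intros a [] |].
      intros z Dz. rewrite (K z Dz). simpl. ring.
Qed.

Lemma schur_factorization (l : list C) (j : nat) : in_disc l -> schur l j 0 <> RtoC 0 ->
  exists c l', Cmod c = 1 /\ blaschke_zeros l' /\
    forall z, disc z -> schur l j z = (c * bprod l' z)%C.
Proof.
  intros Hl H0.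
  destruct (unimodular_at_boundary_schur l Hl j 0 Rlt_0_1) as [rho [Hr K]].
  pose proof (Cmod_pos _ H0) as P.
  destruct (pow_lt_1_zero rho) with (y := Cmod (schur l j 0)) as [n Hn].
  { rewrite Rabs_pos_eq; lra. }
  { exact P. }
  specialize (Hn n (Nat.le_refl n)). rewrite Rabs_pos_eq in Hn by (apply pow_le; lra).
  apply (inner_factorization rho n Hr).
  - now apply rational_schur.
  - intros z Hz. now apply schur_bound.
  - now apply unimodular_at_boundary_schur.
  - intros z Hz E. apply Rnot_lt_le. intros Hlt. specialize (K z Hz Hlt).
    rewrite E, Cmod_0 in K. lra.
  - exact Hn.
Qed.

(** Products of normalized factors are nonnegative at the origin. When [f 0] is
    close to [1], so is the unimodular constant of the factorization, which can
    then be dropped. *)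
Lemma bprod_approximation (f : C -> C) (r eps : R) :
  unit_ball f -> 0 <= r < 1 -> 0 < eps <= 1 / 4 -> Cmod (f 0 - 1)%C <= eps ->
  exists l, blaschke_zeros l /\ forall z, Cmod z <= r -> Cmod (bprod l z - f z)%C <= 5 * eps.
Proof.
  intros Hf Hr He H0. destruct (schur_dense f r eps Hf Hr (proj1 He)) as [ls [Hls Ks]].
  set (S0 := schur ls 0 0).
  assert (HS0 : Cmod (S0 - 1)%C <= 2 * eps).
  { pose proof (Ks 0 ltac:(rewrite Cmod_0; lra)).
    pose proof (Cmod_triangle_mid S0 (f 0) 1). fold S0 in H. lra. }
  pose proof (Cmod_triangle_rev 1 S0) as T. rewrite Cmod_1, Cmod_sub_sym in T.
  assert (NS : S0 <> RtoC 0) by (apply Cmod_pos_neq; lra).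
  destruct (schur_factorization ls 0 Hls NS) as [c [l [Hc [Hl El]]]].
  exists l. split; [exact Hl |].
  assert (Hc1 : Cmod (1 - c)%C <= 4 * eps).
  { pose proof (El 0 disc_0) as E. fold S0 in E.
    assert (M : Cmod S0 = Cmod (bprod l 0)) by (rewrite E, Cmod_mult, Hc; ring).
    rewrite (bprod_0 l Hl), <- M in E.
    pose proof (schur_bound ls Hls 0 0 disc_0) as B. fold S0 in B.
    assert (L : Cmod (S0 - c)%C <= 2 * eps).
    { rewrite E at 1. replace (c * RtoC (Cmod S0) - c)%C with (- (c * RtoC (1 - Cmod S0)))%C
        by (rewrite RtoC_minus; ring).
      rewrite Cmod_opp, Cmod_mult, Hc, Cmod_RtoC_pos; lra. }
    pose proof (Cmod_triangle_mid 1 S0 c) as T2. rewrite (Cmod_sub_sym 1 S0) in T2. lra. }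
  intros z Hz. assert (Dz : disc z) by (unfold disc; lra).
  specialize (Ks z Hz). pose proof (Cmod_triangle_mid (bprod l z) (schur ls 0 z) (f z)) as T2.
  assert (L : Cmod (bprod l z - schur ls 0 z)%C <= 4 * eps).
  { rewrite (El z Dz). replace (bprod l z - c * bprod l z)%C with ((1 - c) * bprod l z)%C by ring.
    rewrite Cmod_mult. pose proof (bprod_bound l z Hl Dz). pose proof (Cmod_ge_0 (bprod l z)).
    pose proof (Cmod_ge_0 (1 - c)%C). nra. }
  lra.
Qed.

(** * A countable dense family in the unit ball *)

Definition rational_point (k : nat) : C :=
  let (d, m) := Cantor.of_nat k in
  let (x, y) := Cantor.of_nat m in
  let (x1, x2) := Cantor.of_nat x in
  let (y1, y2) := Cantor.of_nat y in
  let q : C := ((INR x1 - INR x2) / (INR d + 1), (INR y1 - INR y2) / (INR d + 1)) in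
  (* Codes of points outside the disc stand for the origin. *)
  if Rlt_dec (Cmod q) 1 then q else RtoC 0.

Lemma rational_point_disc (k : nat) : disc (rational_point k).
Proof.
  unfold rational_point. destruct (Cantor.of_nat k) as [d m].
  destruct (Cantor.of_nat m) as [x y], (Cantor.of_nat x) as [x1 x2], (Cantor.of_nat y) as [y1 y2].
  destruct (Rlt_dec _ 1); [assumption | apply disc_0].
Qed.

Lemma nat_difference_approx (x : R) (d : nat) : exists x1 x2 : nat,
  Rabs ((INR x1 - INR x2) / (INR d + 1) - x) <= / (INR d + 1).
Proof.
  pose proof (pos_INR d). set (D := INR d + 1). assert (HD : 0 < D) by (unfold D; lra).
  destruct (base_Int_part (x * D)) as [H1 H2]. set (k := Int_part (x * D)) in *.
  exists (Z.to_nat k), (Z.to_nat (- k)).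
  assert (E : INR (Z.to_nat k) - INR (Z.to_nat (- k)) = IZR k).
  { rewrite !INR_IZR_INZ, <- minus_IZR. f_equal. lia. }
  rewrite E. replace (IZR k / D - x) with ((IZR k - x * D) * / D) by (field; lra).
  rewrite Rabs_mult, (Rabs_pos_eq (/ D)) by (left; now apply Rinv_0_lt_compat).
  rewrite <- (Rmult_1_l (/ D)) at 2. apply Rmult_le_compat_r.
  - left. now apply Rinv_0_lt_compat.
  - apply Rabs_le. lra.
Qed.

Lemma rational_point_dense (g : C) (eps : R) : disc g -> 0 < eps ->
  exists k, Cmod (g - rational_point k)%C < eps.
Proof.
  intros Hg He. unfold disc in Hg. set (e := Rmin eps (1 - Cmod g)).
  assert (Hep : 0 < e) by (apply Rmin_pos; lra).
  assert (He1 : e <= eps) by apply Rmin_l. assert (He2 : e <= 1 - Cmod g) by apply Rmin_r.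
  destruct (INR_unbounded (2 / e)) as [d Hd].
  destruct (nat_difference_approx (Re g) d) as [x1 [x2 Hx]].
  destruct (nat_difference_approx (Im g) d) as [y1 [y2 Hy]].
  exists (Cantor.to_nat (d, Cantor.to_nat (Cantor.to_nat (x1, x2), Cantor.to_nat (y1, y2)))).
  unfold rational_point. rewrite !Cantor.cancel_of_to.
  pose proof (pos_INR d) as Pd. set (D := INR d + 1) in *.
  set (q := ((INR x1 - INR x2) / D, (INR y1 - INR y2) / D) : C).
  assert (Hq : Cmod (q - g)%C < e).
  { eapply Rle_lt_trans; [apply Cmod_le_Re_Im |].
    change (Rabs ((INR x1 - INR x2) / D - Re g) + Rabs ((INR y1 - INR y2) / D - Im g) < e).
    apply Rle_lt_trans with (2 * / D); [lra |].
    assert (2 / e * e = 2) by (field; lra).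
    apply Rmult_lt_reg_r with D; [unfold D; lra |].
    rewrite Rmult_assoc, Rinv_l by (unfold D; lra). unfold D. nra. }
  pose proof (Cmod_triangle_rev q g). destruct (Rlt_dec (Cmod q) 1) as [_ | N].
  - rewrite Cmod_sub_sym. lra.
  - lra.
Qed.

Fixpoint rational_list (n m : nat) : list C :=
  match n with
  | O => nil
  | S k => let (a, b) := Cantor.of_nat m in rational_point a :: rational_list k b
  end.

Definition target (k : nat) : C -> C :=
  let (n, m) := Cantor.of_nat k in schur (rational_list n m) 0.

Lemma rational_list_disc (n m : nat) : in_disc (rational_list n m).
Proof.
  revert m. induction n as [|n IH]; intros m a Ha; [destruct Ha |].
  simpl in Ha. destruct (Cantor.of_nat m) as [x y]. destruct Ha as [<- | Ha].
  - apply rational_point_disc.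
  - now apply (IH y).
Qed.

Lemma schur_unit_ball (l : list C) (j : nat) : in_disc l -> unit_ball (schur l j).
Proof.
  intros Hl. split.
  - apply holomorphic_cdiff. intros z Hz. apply rational_cdiff; [now apply rational_schur | exact Hz].
  - intros z Hz. now apply schur_bound.
Qed.

Lemma target_unit_ball (k : nat) : unit_ball (target k).
Proof.
  unfold target. destruct (Cantor.of_nat k). apply schur_unit_ball, rational_list_disc.
Qed.

Lemma beta_lipschitz (g g' u u' : C) (t : R) : disc g -> disc g' ->
  Cmod u <= t -> Cmod u' <= t -> t < 1 ->
  Cmod (beta g u - beta g' u')%C
  <= 4 / (1 - t) ^ 2 * (Cmod (g - g')%C + Cmod (u - u')%C).
Proof.
  intros Hg Hg' Hu Hu' Ht. unfold disc in Hg, Hg'.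
  assert (Du : disc u) by (unfold disc; lra). assert (Du' : disc u') by (unfold disc; lra).
  pose proof (one_sub_conj_mul_neq g u ltac:(lra) Du) as N.
  pose proof (one_sub_conj_mul_neq g' u' ltac:(lra) Du') as N'.
  pose proof (Cmod_one_sub_conj_mul_ge g u) as L. pose proof (Cmod_one_sub_conj_mul_ge g' u') as L'.
  pose proof (Cmod_ge_0 g). pose proof (Cmod_ge_0 g'). pose proof (Cmod_ge_0 u).
  pose proof (Cmod_ge_0 u').
  set (B := (1 - Cconj g * u)%C) in *. set (B' := (1 - Cconj g' * u')%C) in *.
  set (d := Cmod (g - g')%C + Cmod (u - u')%C).
  pose proof (Cmod_ge_0 (g - g')%C). pose proof (Cmod_ge_0 (u - u')%C).
  assert (E : (beta g u - beta g' u')%C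
    = ((((u - g) - (u' - g')) * B' + (u' - g') * (B' - B)) / (B * B'))%C).
  { unfold beta. fold B B'. field. auto. }
  rewrite E, Cmod_div by (now apply Cmult_neq_0). rewrite Cmod_mult.
  assert (A1 : Cmod ((u - g) - (u' - g'))%C <= d).
  { replace ((u - g) - (u' - g'))%C with ((u - u') - (g - g'))%C by ring.
    eapply Rle_trans; [apply Cmod_triangle_sub | unfold d; lra]. }
  assert (A2 : Cmod B' <= 2).
  { unfold B'. eapply Rle_trans; [apply Cmod_triangle_sub |].
    rewrite Cmod_1, Cmod_mult, Cmod_conj. nra. }
  assert (A3 : Cmod (u' - g')%C <= 2) by (eapply Rle_trans; [apply Cmod_triangle_sub | lra]).
  assert (A4 : Cmod (B' - B)%C <= d).
  { unfold B, B'. replace (1 - Cconj g' * u' - (1 - Cconj g * u))%C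
      with (Cconj g * (u - u') + Cconj (g - g') * u')%C by (rewrite Cminus_conj; ring).
    eapply Rle_trans; [apply Cmod_triangle |]. rewrite !Cmod_mult, !Cmod_conj. unfold d. nra. }
  assert (Hnum : Cmod ((u - g - (u' - g')) * B' + (u' - g') * (B' - B))%C <= 4 * d).
  { eapply Rle_trans; [apply Cmod_triangle |]. rewrite !Cmod_mult.
    pose proof (Cmod_ge_0 B'). pose proof (Cmod_ge_0 (u' - g')%C).
    pose proof (Cmod_ge_0 (B' - B)%C). pose proof (Cmod_ge_0 (u - g - (u' - g'))%C).
    assert (Cmod (u - g - (u' - g'))%C * Cmod B' <= d * 2) by (now apply Rmult_le_compat).
    assert (Cmod (u' - g')%C * Cmod (B' - B)%C <= 2 * d) by (now apply Rmult_le_compat).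
    lra. }
  assert (Hd : 0 <= d) by (unfold d; lra).
  assert (L2 : 1 - t <= Cmod B) by nra. assert (L2' : 1 - t <= Cmod B') by nra.
  assert (Hden : (1 - t) ^ 2 <= Cmod B * Cmod B').
  { simpl. rewrite Rmult_1_r. apply Rmult_le_compat; lra. }
  assert (P2 : 0 < (1 - t) ^ 2) by (apply pow_lt; lra).
  apply Rle_trans with (4 * d * / (Cmod B * Cmod B')).
  - apply Rmult_le_compat_r; [|exact Hnum]. left. apply Rinv_0_lt_compat. lra.
  - replace (4 / (1 - t) ^ 2 * d) with (4 * d * / (1 - t) ^ 2) by (unfold Rdiv; ring).
    apply Rmult_le_compat_l; [lra |]. now apply Rinv_le_contravar.
Qed.

(** On a smaller disc the steps of the algorithm are Lipschitz in the parameter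
    and in the inner function, as the node factor is bounded away from one. *)
Lemma schur_rational_parameters (r : R) (l : list C) : 0 <= r < 1 -> in_disc l ->
  forall j eps, 0 < eps -> exists m, forall z, Cmod z <= r ->
  Cmod (schur l j z - schur (rational_list (length l) m) j z)%C <= eps.
Proof.
  intros Hr Hl. induction l as [|g l IH]; intros j eps He.
  - exists 0%nat. intros z _. simpl. replace (1 - 1)%C with (RtoC 0) by ring. rewrite Cmod_0. lra.
  - assert (Hl' : in_disc l) by (intros a Ha; apply Hl; now right).
    set (t := sqrt (1 - 3 / 16 * (1 - r ^ 2))).
    assert (Ht : 0 <= t < 1).
    { split; [apply sqrt_pos |]. rewrite <- sqrt_1. apply sqrt_lt_1_alt. nra. }
    assert (P2 : 0 < (1 - t) ^ 2) by (apply pow_lt; lra).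
    set (e := eps * (1 - t) ^ 2 / 8).
    assert (Hep : 0 < e) by (unfold e; apply Rdiv_lt_0_compat; [nra | lra]).
    destruct (IH Hl' (S j) e Hep) as [m Hm].
    destruct (rational_point_dense g e (Hl g (or_introl eq_refl)) Hep) as [k Hk].
    exists (Cantor.to_nat (k, m)). intros z Hz. assert (Dz : disc z) by (unfold disc; lra).
    simpl length. cbn [rational_list]. rewrite Cantor.cancel_of_to. simpl.
    specialize (Hm z Hz).
    pose proof (pdist_node_bound j r z (proj2 Hr) Hz) as Hb. fold t in Hb.
    pose proof (pdist_ge_0 (node j) z) as Hb0. unfold pdist in Hb, Hb0.
    pose proof (schur_bound l Hl' (S j) z Dz) as S1.
    pose proof (schur_bound (rational_list (length l) m) (rational_list_disc _ _) (S j) z Dz) as S2.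
    pose proof (Cmod_ge_0 (schur l (S j) z)).
    pose proof (Cmod_ge_0 (schur (rational_list (length l) m) (S j) z)).
    eapply Rle_trans; [apply (beta_lipschitz _ _ _ _ t) |].
    + apply disc_opp, Hl. now left.
    + apply disc_opp, rational_point_disc.
    + rewrite Cmod_mult. nra.
    + rewrite Cmod_mult. nra.
    + lra.
    + replace (- g - - rational_point k)%C with (- (g - rational_point k))%C by ring.
      rewrite Cmod_opp.
      set (b := beta (node j) z) in *.
      replace (b * schur l (S j) z - b * schur (rational_list (length l) m) (S j) z)%C
        with (b * (schur l (S j) z - schur (rational_list (length l) m) (S j) z))%C by ring.
      rewrite Cmod_mult.
      pose proof (Cmod_ge_0 (schur l (S j) z - schur (rational_list (length l) m) (S j) z)%C).
      apply Rle_trans with (4 / (1 - t) ^ 2 * (e + e)).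
      * apply Rmult_le_compat_l; [apply Rdiv_le_0_compat; lra |].
        apply Rplus_le_compat; [lra |]. nra.
      * right. unfold e. field. lra.
Qed.

Lemma target_dense (f : C -> C) (r eps : R) : unit_ball f -> 0 <= r < 1 -> 0 < eps ->
  exists k, forall z, Cmod z <= r -> Cmod (target k z - f z)%C <= eps.
Proof.
  intros Hf Hr He. destruct (schur_dense f r (eps / 2) Hf Hr ltac:(lra)) as [l [Hl K]].
  destruct (schur_rational_parameters r l Hr Hl 0 (eps / 2) ltac:(lra)) as [m Hm].
  exists (Cantor.to_nat (length l, m)). intros z Hz. unfold target.
  rewrite Cantor.cancel_of_to. specialize (K z Hz). specialize (Hm z Hz).
  pose proof (Cmod_triangle_mid (schur (rational_list (length l) m) 0 z) (schur l 0 z) (f z)) as T.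
  rewrite (Cmod_sub_sym (schur (rational_list (length l) m) 0 z) (schur l 0 z)) in T. lra.
Qed.

(** * Prescribing values on three distant hyperbolic discs *)

Lemma unit_ball_comp (f psi : C -> C) :
  unit_ball f -> holomorphic_self_map psi -> unit_ball (fun z => f (psi z)).
Proof.
  intros [Hf Hb] [Hh Hd]. split; [|auto].
  pose proof (proj1 (holomorphic_cdiff f) Hf) as Cf.
  pose proof (proj1 (holomorphic_cdiff psi) Hh) as Cp.
  apply holomorphic_cdiff. intros z Hz. apply (cdiff_comp f psi); auto.
Qed.

(** The weights are [p^2] and [(1 - p)^2] with [p = (1 + chi) / 2]. For [chi] in
    the unit ball, [|p|^2 + |1 - p|^2 <= 1], so the combination stays in the unit
    ball; it is close to [x] where [chi] is close to [1], and to [y] where [chi]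
    is close to [-1]. *)
Definition mix (chi x y : C) : C :=
  (((1 + chi) / RtoC 2) * ((1 + chi) / RtoC 2) * x
   + ((1 - chi) / RtoC 2) * ((1 - chi) / RtoC 2) * y)%C.

Lemma Cmod_half (z : C) : Cmod (z / RtoC 2)%C = Cmod z / 2.
Proof. rewrite Cmod_div by exact RtoC_2_neq. rewrite (Cmod_RtoC_pos 2) by lra. reflexivity. Qed.

Lemma mix_bound (chi x y : C) : Cmod chi <= 1 -> Cmod x <= 1 -> Cmod y <= 1 ->
  Cmod (mix chi x y) <= 1.
Proof.
  intros Hc Hx Hy. unfold mix. eapply Rle_trans; [apply Cmod_triangle |].
  rewrite !Cmod_mult, !Cmod_half.
  assert (E : Cmod (1 + chi)%C ^ 2 + Cmod (1 - chi)%C ^ 2 <= 4).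
  { replace (Cmod (1 + chi)%C ^ 2 + Cmod (1 - chi)%C ^ 2) with (2 + 2 * Cmod chi ^ 2)
      by (rewrite !Cmod_sqr; destruct chi; simpl; ring).
    pose proof (Cmod_ge_0 chi). nra. }
  set (A := Cmod (1 + chi)%C) in *. set (B := Cmod (1 - chi)%C) in *.
  pose proof (pow2_ge_0 A). pose proof (pow2_ge_0 B).
  assert (A / 2 * (A / 2) * Cmod x <= A ^ 2 / 4 * 1).
  { replace (A / 2 * (A / 2)) with (A ^ 2 / 4) by field.
    apply Rmult_le_compat_l; lra. }
  assert (B / 2 * (B / 2) * Cmod y <= B ^ 2 / 4 * 1).
  { replace (B / 2 * (B / 2)) with (B ^ 2 / 4) by field.
    apply Rmult_le_compat_l; lra. }
  lra.
Qed.

Lemma mix_opp (chi x y : C) : mix (- chi)%C x y = mix chi y x.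
Proof. unfold mix, Cdiv. ring. Qed.

Lemma mix_near_left (chi x y : C) : Cmod chi <= 1 -> Cmod x <= 1 -> Cmod y <= 1 ->
  Cmod (mix chi x y - x)%C <= 2 * Cmod (chi - 1)%C.
Proof.
  intros Hc Hx Hy.
  assert (E : (mix chi x y - x)%C
    = ((chi - 1) / RtoC 2 * ((RtoC 3 + chi) / RtoC 2) * x
       + (chi - 1) / RtoC 2 * ((chi - 1) / RtoC 2) * y)%C).
  { unfold mix. replace (RtoC 3) with (RtoC 2 + RtoC 1)%C by (rewrite <- RtoC_plus; f_equal; ring).
    rewrite RtoC_2. field. }
  rewrite E. eapply Rle_trans; [apply Cmod_triangle |]. rewrite !Cmod_mult, !Cmod_half.
  assert (Cmod (RtoC 3 + chi)%C <= 4).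
  { eapply Rle_trans; [apply Cmod_triangle |]. rewrite Cmod_RtoC_pos; lra. }
  assert (Cmod (chi - 1)%C <= 2).
  { eapply Rle_trans; [apply Cmod_triangle_sub |]. rewrite Cmod_1. lra. }
  pose proof (Cmod_ge_0 (RtoC 3 + chi)%C). pose proof (Cmod_ge_0 (chi - 1)%C).
  pose proof (Cmod_ge_0 x). pose proof (Cmod_ge_0 y).
  set (e := Cmod (chi - 1)%C) in *. set (m := Cmod (RtoC 3 + chi)%C) in *.
  assert (m / 2 * Cmod x <= 2 * 1) by (apply Rmult_le_compat; lra).
  assert (e / 2 * Cmod y <= 1 * 1) by (apply Rmult_le_compat; lra).
  nra.
Qed.

Lemma mix_near_right (chi x y : C) : Cmod chi <= 1 -> Cmod x <= 1 -> Cmod y <= 1 ->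
  Cmod (mix chi x y - y)%C <= 2 * Cmod (chi + 1)%C.
Proof.
  intros Hc Hx Hy. rewrite <- (mix_opp chi y x), <- (Cmod_opp (chi + 1)%C).
  replace (- (chi + 1))%C with (- chi - 1)%C by ring.
  apply mix_near_left; trivial. now rewrite Cmod_opp.
Qed.

Lemma mix_unit_ball (chi x y : C -> C) : unit_ball chi -> unit_ball x -> unit_ball y ->
  unit_ball (fun z => mix (chi z) (x z) (y z)).
Proof.
  intros [H1 B1] [H2 B2] [H3 B3]. split.
  - pose proof (proj1 (holomorphic_cdiff _) H1) as C1.
    pose proof (proj1 (holomorphic_cdiff _) H2) as C2.
    pose proof (proj1 (holomorphic_cdiff _) H3) as C3.
    apply holomorphic_cdiff. intros z Hz. unfold mix.
    specialize (C1 z Hz). specialize (C2 z Hz). specialize (C3 z Hz).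
    assert (D1 : cdiff (fun w => (1 + chi w) / RtoC 2)%C z).
    { apply cdiff_mult; [|apply cdiff_const]. apply cdiff_plus; [apply cdiff_const | exact C1]. }
    assert (D2 : cdiff (fun w => (1 - chi w) / RtoC 2)%C z).
    { apply cdiff_mult; [|apply cdiff_const]. apply cdiff_minus; [apply cdiff_const | exact C1]. }
    apply cdiff_plus; (apply cdiff_mult; [apply cdiff_mult; assumption | assumption]).
  - intros z Hz. apply mix_bound; auto.
Qed.

Lemma Cmod_1_add_ge_1 (s : C) : 0 <= Re s -> 1 <= Cmod (1 + s)%C.
Proof.
  intros H. pose proof (Re_le_Cmod (1 + s)%C) as K. destruct s. simpl in *. lra.
Qed.

Lemma half_plane_to_ball (s : C -> C) :
  (forall z, disc z -> cdiff s z /\ 0 <= Re (s z)) ->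
  unit_ball (fun z => (1 - s z) / (1 + s z))%C /\
  (forall z, disc z -> Cmod ((1 - s z) / (1 + s z) - 1)%C <= 2 * Cmod (s z)) /\
  (forall z M, disc z -> 1 < M -> M <= Cmod (s z) ->
     Cmod ((1 - s z) / (1 + s z) + 1)%C <= 2 / (M - 1)).
Proof.
  intros Hs.
  assert (N : forall z, disc z -> (1 + s z)%C <> RtoC 0).
  { intros z Hz. pose proof (Cmod_1_add_ge_1 (s z) (proj2 (Hs z Hz))).
    apply Cmod_pos_neq. lra. }
  split; [split|split].
  - apply holomorphic_cdiff. intros z Hz. destruct (Hs z Hz) as [Cs _].
    apply cdiff_div; [now apply N | |].
    + apply cdiff_minus; [apply cdiff_const | exact Cs].
    + apply cdiff_plus; [apply cdiff_const | exact Cs].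
  - intros z Hz. destruct (Hs z Hz) as [_ Rs]. pose proof (Cmod_pos _ (N z Hz)) as P.
    rewrite Cmod_div by now apply N. apply Rmult_le_reg_r with (1 := P).
    unfold Rdiv. rewrite Rmult_assoc, Rinv_l, Rmult_1_r, Rmult_1_l by lra.
    apply Cmod_le_sqr. rewrite !Cmod_sqr. destruct (s z). simpl in *. nra.
  - intros z Hz. destruct (Hs z Hz) as [_ Rs].
    pose proof (Cmod_1_add_ge_1 (s z) Rs) as L. pose proof (N z Hz) as Nz.
    replace ((1 - s z) / (1 + s z) - 1)%C with (- (RtoC 2 * s z) / (1 + s z))%C
      by (rewrite RtoC_2; now field).
    rewrite Cmod_div, Cmod_opp, Cmod_mult, (Cmod_RtoC_pos 2) by (trivial; lra).
    pose proof (Cmod_ge_0 (s z)).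
    apply Rmult_le_reg_r with (Cmod (1 + s z)%C); [lra |].
    unfold Rdiv. rewrite Rmult_assoc, Rinv_l by lra. nra.
  - intros z M Hz HM HMs. pose proof (N z Hz) as Nz.
    pose proof (Cmod_triangle_rev (s z) (- RtoC 1)%C) as T.
    rewrite Cmod_opp, Cmod_1 in T. replace (s z - - (1))%C with (1 + s z)%C in T by ring.
    replace ((1 - s z) / (1 + s z) + 1)%C with (RtoC 2 / (1 + s z))%C by (rewrite RtoC_2; now field).
    rewrite Cmod_div, (Cmod_RtoC_pos 2) by (trivial; lra).
    unfold Rdiv. apply Rmult_le_compat_l; [lra |]. apply Rinv_le_contravar; lra.
Qed.

Lemma Cmod_cayley (p z : C) : z <> p -> Cmod (cayley p z) * Cmod (p - z)%C = Cmod (p + z)%C.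
Proof.
  intros Hn. assert (N : (p - z)%C <> RtoC 0) by (now apply Csub_neq_0, not_eq_sym).
  rewrite <- Cmod_mult. f_equal. unfold cayley. now field.
Qed.

Lemma cayley_upper (p z : C) (d : R) : Cmod p = 1 -> disc z -> 0 < d -> d <= Cmod (p - z)%C ->
  Cmod (cayley p z) <= 2 / d.
Proof.
  intros Hp Hz Hd H. pose proof (Cmod_cayley p z (unit_disc_neq p z Hp Hz)) as E.
  pose proof (Cmod_triangle p z) as T. unfold disc in Hz.
  pose proof (Cmod_ge_0 (cayley p z)).
  apply Rmult_le_reg_r with (1 := Hd). unfold Rdiv. rewrite Rmult_assoc, Rinv_l by lra. nra.
Qed.

Lemma cayley_lower (p z : C) (d : R) : Cmod p = 1 -> disc z -> 0 < d <= 1 ->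
  Cmod (z - p)%C <= d -> / d <= Cmod (cayley p z).
Proof.
  intros Hp Hz Hd H. pose proof (Cmod_cayley p z (unit_disc_neq p z Hp Hz)) as E.
  rewrite Cmod_sub_sym in H.
  pose proof (Cmod_triangle_rev (RtoC 2 * p)%C (p - z)%C) as T.
  replace (RtoC 2 * p - (p - z))%C with (p + z)%C in T by (rewrite RtoC_2; ring).
  rewrite Cmod_mult, Hp, Cmod_RtoC_pos in T by lra.
  pose proof (Cmod_ge_0 (cayley p z)). pose proof (Cmod_ge_0 (p - z)%C).
  apply Rmult_le_reg_r with d; [lra |]. rewrite Rinv_l by lra. nra.
Qed.

(** The function [chi = (1 - s) / (1 + s)] with [s] a small multiple of a sum of
    Cayley maps with poles at the two points. The poles must not interfere: if
    they are close together, one of them is enough for both. *)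
Lemma separator (r eps : R) : 0 <= r < 1 -> 0 < eps ->
  exists del, 0 < del /\ forall b0 b1, Cmod b0 = 1 -> Cmod b1 = 1 ->
  exists chi, unit_ball chi /\
    (forall z, Cmod z <= r -> Cmod (chi z - 1)%C <= eps) /\
    (forall z, disc z -> Cmod (z - b0)%C <= del \/ Cmod (z - b1)%C <= del ->
       Cmod (chi z + 1)%C <= eps).
Proof.
  intros Hr He. set (c := eps * (1 - r) / 8). set (M := 1 + 2 / eps).
  assert (Hc : 0 < c) by (unfold c; apply Rdiv_lt_0_compat; [nra | lra]).
  assert (HM : 1 < M) by (unfold M; assert (0 < 2 / eps) by (apply Rdiv_lt_0_compat; lra); lra).
  set (d1 := Rmin (1 / 2) (c / (2 * M))).
  assert (Hd1 : 0 < d1) by (apply Rmin_pos; [lra | apply Rdiv_lt_0_compat; lra]).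
  assert (Hd1a : d1 <= 1 / 2) by apply Rmin_l. assert (Hd1b : d1 <= c / (2 * M)) by apply Rmin_r.
  assert (HMc : 0 < M / c) by (apply Rdiv_lt_0_compat; lra).
  assert (H4d : 0 < 4 / d1) by (apply Rdiv_lt_0_compat; lra).
  set (d0 := / (M / c + 4 / d1)).
  assert (Hd0 : 0 < d0) by (apply Rinv_0_lt_compat; lra).
  assert (Hd01 : d0 <= d1 / 4).
  { unfold d0. replace (d1 / 4) with (/ (4 / d1)) by (field; lra).
    apply Rinv_le_contravar; lra. }
  assert (final : forall s, (forall z, disc z -> cdiff s z /\ 0 <= Re (s z)) ->
    (forall z, Cmod z <= r -> Cmod (s z) <= eps / 2) ->
    forall P : C -> Prop, (forall z, disc z -> P z -> M <= Cmod (s z)) ->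
    exists chi, unit_ball chi /\ (forall z, Cmod z <= r -> Cmod (chi z - 1)%C <= eps) /\
      forall z, disc z -> P z -> Cmod (chi z + 1)%C <= eps).
  { intros s Hs Hsmall P Hlarge. destruct (half_plane_to_ball s Hs) as [K1 [K2 K3]].
    eexists. split; [exact K1 |]. split.
    - intros z Hz. specialize (K2 z ltac:(unfold disc; lra)). specialize (Hsmall z Hz). lra.
    - intros z Hz HP. eapply Rle_trans; [apply (K3 z M Hz HM); auto |].
      right. unfold M. field. lra. }
  (* [d1] decides whether one pole is enough; [d0] is so small that, for poles
     further apart, the nearby pole dominates the other one. *)
  exists d0. split; [exact Hd0 |]. intros b0 b1 Hb0 Hb1.
  assert (Hsm : forall b z, Cmod b = 1 -> Cmod z <= r -> Cmod (cayley b z) <= 2 / (1 - r)).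
  { intros b z Hb Hz. apply cayley_upper; [exact Hb | unfold disc; lra | lra |].
    pose proof (Cmod_triangle_rev b z). lra. }
  assert (Hcd : forall b z, Cmod b = 1 -> disc z -> cdiff (cayley b) z).
  { intros b z Hb Hz. unfold cayley. apply cdiff_div; [now apply unit_sub_neq | |].
    - apply cdiff_plus; [apply cdiff_const | apply cdiff_id].
    - apply cdiff_minus; [apply cdiff_const | apply cdiff_id]. }
  destruct (Rle_lt_dec d1 (Cmod (b0 - b1)%C)) as [Hfar | Hnear].
  - apply (final (fun z => RtoC c * (cayley b0 z + cayley b1 z))%C).
    + intros z Hz. split.
      * apply cdiff_mult; [apply cdiff_const |]. apply cdiff_plus; now apply Hcd.
      * pose proof (Re_cayley_pos b0 z Hb0 Hz). pose proof (Re_cayley_pos b1 z Hb1 Hz).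
        rewrite re_scal_l, re_plus. nra.
    + intros z Hz. rewrite Cmod_mult, Cmod_RtoC_pos by lra.
      pose proof (Hsm b0 z Hb0 Hz). pose proof (Hsm b1 z Hb1 Hz).
      pose proof (Cmod_triangle (cayley b0 z) (cayley b1 z)).
      apply Rle_trans with (c * (2 / (1 - r) + 2 / (1 - r))).
      * apply Rmult_le_compat_l; lra.
      * right. unfold c. field. lra.
    + assert (Hone : forall b b' z, Cmod b = 1 -> Cmod b' = 1 -> disc z ->
        d1 <= Cmod (b - b')%C -> Cmod (z - b)%C <= d0 ->
        M <= Cmod (RtoC c * (cayley b z + cayley b' z))%C).
      { intros b b' z Hb Hb' Hz Hf Hn. rewrite Cmod_mult, Cmod_RtoC_pos by lra.
        pose proof (cayley_lower b z d0 Hb Hz ltac:(lra) Hn) as L.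
        assert (U : Cmod (cayley b' z) <= 2 / (d1 / 2)).
        { apply cayley_upper; [exact Hb' | exact Hz | lra |].
          pose proof (Cmod_triangle_mid b z b') as T.
          rewrite (Cmod_sub_sym b z), (Cmod_sub_sym z b') in T. lra. }
        replace (2 / (d1 / 2)) with (4 / d1) in U by (field; lra).
        unfold d0 in L. rewrite Rinv_inv in L.
        pose proof (Cmod_triangle_rev (cayley b z) (- cayley b' z)%C) as T.
        rewrite Cmod_opp in T.
        replace (cayley b z - - cayley b' z)%C with (cayley b z + cayley b' z)%C in T by ring.
        apply Rle_trans with (c * (M / c)); [right; field; lra |].
        apply Rmult_le_compat_l; lra. }
      intros z Hz [Hn | Hn].
      * now apply Hone.
      * rewrite Cplus_comm. apply Hone; trivial. now rewrite Cmod_sub_sym.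
  - apply (final (fun z => RtoC c * cayley b0 z)%C).
    + intros z Hz. split.
      * apply cdiff_mult; [apply cdiff_const | now apply Hcd].
      * pose proof (Re_cayley_pos b0 z Hb0 Hz). rewrite re_scal_l. nra.
    + intros z Hz. rewrite Cmod_mult, Cmod_RtoC_pos by lra. pose proof (Hsm b0 z Hb0 Hz).
      apply Rle_trans with (c * (2 / (1 - r))).
      * apply Rmult_le_compat_l; lra.
      * apply Rle_trans with (eps / 4); [right; unfold c; field; lra | lra].
    + intros z Hz Hn. rewrite Cmod_mult, Cmod_RtoC_pos by lra.
      assert (Hzb : Cmod (z - b0)%C <= 2 * d1).
      { destruct Hn as [Hn | Hn]; [lra |].
        pose proof (Cmod_triangle_mid z b1 b0) as T. rewrite (Cmod_sub_sym b1 b0) in T. lra. }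
      pose proof (cayley_lower b0 z (2 * d1) Hb0 Hz ltac:(lra) Hzb) as L.
      apply Rle_trans with (c * / (2 * d1)).
      * apply Rmult_le_reg_r with (2 * d1); [lra |]. rewrite Rmult_assoc, Rinv_l by lra.
        apply Rle_trans with (M * (2 * (c / (2 * M)))); [apply Rmult_le_compat_l; lra |].
        right. field. lra.
      * apply Rmult_le_compat_l; lra.
Qed.

(** Since [1 - conj(X) Y = (1 - |X|^2) - conj(X) (Y - X)], the assumption bounds
    [|Y - X|] by a multiple of [1 - |X|]. *)
Lemma near_unit_point (r : R) (X Y : C) : 0 <= r < 1 -> 0 < Cmod X <= 1 ->
  Cmod (Y - X)%C <= r * Cmod (1 - Cconj X * Y)%C ->
  Cmod (X / RtoC (Cmod X))%C = 1 /\
  Cmod (Y - X / RtoC (Cmod X))%C <= 3 * (1 - Cmod X) / (1 - r).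
Proof.
  intros Hr HX H. set (m := Cmod X) in *.
  assert (Nm : RtoC m <> RtoC 0) by (apply Cmod_pos_neq; rewrite Cmod_RtoC_pos; lra).
  split.
  { rewrite Cmod_div, Cmod_RtoC_pos by (trivial; lra). fold m. field. lra. }
  assert (E : (1 - Cconj X * Y)%C = (RtoC (1 - m ^ 2) + - (Cconj X * (Y - X)))%C).
  { rewrite RtoC_minus. unfold m. rewrite <- Cmod_conj_mul. ring. }
  pose proof (Cmod_triangle (RtoC (1 - m ^ 2)) (- (Cconj X * (Y - X)))%C) as T.
  rewrite <- E, Cmod_opp, Cmod_mult, Cmod_conj, Cmod_RtoC_pos in T by nra. fold m in T.
  assert (T2 : Cmod (X - X / RtoC m)%C = 1 - m).
  { replace (X - X / RtoC m)%C with (- (X / RtoC m * RtoC (1 - m)))%C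
      by (rewrite RtoC_minus; now field).
    rewrite Cmod_opp, Cmod_mult, Cmod_div, !Cmod_RtoC_pos by (trivial; lra). fold m. field. lra. }
  pose proof (Cmod_triangle_mid Y X (X / RtoC m)%C) as T3. rewrite T2 in T3.
  pose proof (Cmod_ge_0 (Y - X)%C). set (D := Cmod (Y - X)%C) in *.
  apply Rmult_le_reg_r with (1 - r); [lra |].
  unfold Rdiv. rewrite Rmult_assoc, Rinv_l, Rmult_1_r by lra.
  assert (B1 : D <= r * (1 - m ^ 2 + m * D))
    by (eapply Rle_trans; [exact H | apply Rmult_le_compat_l; lra]).
  assert (B2 : r * (m * D) <= r * D) by (apply Rmult_le_compat_l; nra).
  assert (B3 : r * (1 - m ^ 2) <= 1 * (1 - m ^ 2)) by (apply Rmult_le_compat_r; nra).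
  assert (B4 : 1 - m ^ 2 <= 2 * (1 - m)) by nra.
  assert (B5 : D * (1 - r) <= 2 * (1 - m)) by lra.
  assert (B6 : (1 - m) * (1 - r) <= 1 - m) by nra.
  apply Rle_trans with ((D + (1 - m)) * (1 - r)); [apply Rmult_le_compat_r; lra | lra].
Qed.

Lemma isometry_near_unit_point (psi : C -> C) (u a : C) (r : R) (z : C) :
  mobius psi u a -> 0 <= r < 1 -> Cmod z <= r -> psi 0 <> RtoC 0 ->
  Cmod (psi z - psi 0 / RtoC (Cmod (psi 0)))%C <= 3 * (1 - Cmod (psi 0)) / (1 - r).
Proof.
  intros Hm Hr Hz N. pose proof (mobius_self_map psi u a Hm) as [_ Hd].
  assert (Dz : disc z) by (unfold disc; lra).
  pose proof (Hd 0 disc_0) as D0. pose proof (Hd z Dz) as D1. unfold disc in D0.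
  apply near_unit_point; [exact Hr | split; [now apply Cmod_pos | lra] |].
  rewrite <- Cmod_beta by (trivial; lra).
  apply Rmult_le_compat_r; [apply Cmod_ge_0 |].
  rewrite (mobius_isometry psi u a 0 z Hm disc_0 Dz), pdist_0_l. exact Hz.
Qed.

Lemma mobius_comp (phi psi : C -> C) (u a v b : C) :
  mobius phi u a -> mobius psi v b -> exists w c, mobius (fun z => phi (psi z)) w c.
Proof.
  intros Hm Hn. pose proof (mobius_self_map phi u a Hm) as [Hh Hd].
  pose proof (mobius_self_map psi v b Hn) as [Hh' Hd'].
  apply isometry_mobius.
  - split; [|auto]. pose proof (proj1 (holomorphic_cdiff phi) Hh) as Cp.
    pose proof (proj1 (holomorphic_cdiff psi) Hh') as Cq.
    apply holomorphic_cdiff. intros z Hz. apply (cdiff_comp phi psi); auto.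
  - intros z w Hz Hw. rewrite (mobius_isometry phi u a) by auto.
    rewrite (mobius_isometry psi v b) by auto. lra.
Qed.

Lemma mobius_iterate (phi : C -> C) (u a : C) (n : nat) :
  mobius phi u a -> exists w c, mobius (iterate phi n) w c.
Proof.
  intros Hm. induction n as [|n [w [c IH]]].
  - exists (RtoC 1), (RtoC 0). split; [apply Cmod_1 |]. split; [apply disc_0 |].
    intros z _. unfold iterate, beta. simpl. rewrite Cconj_RtoC. field.
  - exact (mobius_comp phi (iterate phi n) u a w c Hm IH).
Qed.

(** Two separations suffice. The function [chi1] tells the disc around the origin
    from the one around [psi1 0]. Then [chi2], composed with the inverse of
    [psi2], tells the disc around [psi2 0] from the other two, which may lie in
    the same direction as seen from there. *)
Lemma three_targets (r eps : R) : 0 <= r < 1 -> 0 < eps ->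
  exists T, T < 1 /\ forall psi1 psi2 u1 a1 u2 a2,
  mobius psi1 u1 a1 -> mobius psi2 u2 a2 ->
  T < Cmod (psi1 0) -> T < Cmod (psi2 0) -> T < pdist (psi1 0) (psi2 0) ->
  forall h1 h2, unit_ball h1 -> unit_ball h2 ->
  exists f, unit_ball f /\ forall z, Cmod z <= r ->
    Cmod (f z - 1)%C <= eps /\
    Cmod (f (psi1 z) - h1 (psi1 z))%C <= eps /\
    Cmod (f (psi2 z) - h2 (psi2 z))%C <= eps.
Proof.
  intros Hr He. destruct (separator r (eps / 4) Hr ltac:(lra)) as [d [Hd Hsep]].
  set (T := Rmax (1 / 2) (1 - d * (1 - r) / 3)).
  assert (HT1 : 1 / 2 <= T) by apply Rmax_l.
  assert (HT2 : 1 - d * (1 - r) / 3 <= T) by apply Rmax_r.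
  assert (HTlt : T < 1) by (apply Rmax_lub_lt; nra).
  assert (Hclose : forall psi u a z, mobius psi u a -> T < Cmod (psi 0) -> Cmod z <= r ->
    Cmod (psi z - psi 0 / RtoC (Cmod (psi 0)))%C <= d).
  { intros psi u a z Hm HT Hz.
    eapply Rle_trans; [apply (isometry_near_unit_point psi u a r z Hm Hr Hz) |].
    - apply Cmod_pos_neq. lra.
    - apply Rmult_le_reg_r with (1 - r); [lra |].
      unfold Rdiv. rewrite Rmult_assoc, Rinv_l by lra. lra. }
  assert (Hunit : forall x : C, T < Cmod x -> Cmod (x / RtoC (Cmod x))%C = 1).
  { intros x Hx.
    assert (N : RtoC (Cmod x) <> RtoC 0) by (apply Cmod_pos_neq; rewrite Cmod_RtoC_pos; lra).
    rewrite Cmod_div, Cmod_RtoC_pos by (trivial; lra). field. lra. }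
  exists T. split; [exact HTlt |].
  intros psi1 psi2 u1 a1 u2 a2 M1 M2 X1 X2 X12 h1 h2 B1 B2.
  pose proof (mobius_self_map _ _ _ M1) as S1. pose proof (mobius_self_map _ _ _ M2) as S2.
  destruct (mobius_inverse psi2 u2 a2 M2) as [eta [v [b [Meta [Seta [I1 I2]]]]]].
  destruct (mobius_comp eta psi1 v b u1 a1 Meta M1) as [w [c Mc]].
  destruct (Hsep _ _ (Hunit _ X1) (Hunit _ X1)) as [chi1 [Bc1 [C1 C1']]].
  set (F := fun z => mix (chi1 z) (RtoC 1) (h1 z)).
  assert (BF : unit_ball F).
  { apply (mix_unit_ball chi1 (fun _ => RtoC 1) h1); trivial.
    apply unit_ball_const. rewrite Cmod_1. lra. }
  assert (Xe : T < Cmod (eta 0)).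
  { rewrite <- (pdist_0_l (eta 0)).
    rewrite <- (mobius_isometry psi2 u2 a2 0 (eta 0) M2 disc_0 (proj2 Seta 0 disc_0)).
    rewrite I2 by apply disc_0. rewrite pdist_sym, pdist_0_l; trivial; [now apply S2, disc_0 | apply disc_0]. }
  assert (Xe1 : T < Cmod (eta (psi1 0))).
  { pose proof (proj2 S1 0 disc_0) as D1.
    rewrite <- (pdist_0_l (eta (psi1 0))).
    rewrite <- (mobius_isometry psi2 u2 a2 0 (eta (psi1 0)) M2 disc_0 (proj2 Seta _ D1)).
    rewrite I2 by exact D1. rewrite pdist_sym; trivial. now apply S2, disc_0. }
  destruct (Hsep _ _ (Hunit _ Xe) (Hunit _ Xe1)) as [chi2 [Bc2 [C2 C2']]].
  assert (Bc2e : unit_ball (fun z => chi2 (eta z))) by (now apply unit_ball_comp).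
  exists (fun z => mix (chi2 (eta z)) (h2 z) (F z)).
  split; [now apply (mix_unit_ball (fun z => chi2 (eta z)) h2 F) |].
  intros z Hz. assert (Dz : disc z) by (unfold disc; lra).
  pose proof (proj2 S1 z Dz) as D1. pose proof (proj2 S2 z Dz) as D2.
  assert (onF : forall x y, disc x ->
    Cmod (chi2 (eta x) + 1)%C <= eps / 4 -> Cmod (F x - y)%C <= 2 * (eps / 4) ->
    Cmod (mix (chi2 (eta x)) (h2 x) (F x) - y)%C <= eps).
  { intros x y Dx K1 K2.
    pose proof (mix_near_right (chi2 (eta x)) (h2 x) (F x) (proj2 Bc2e x Dx)
      (proj2 B2 x Dx) (proj2 BF x Dx)).
    pose proof (Cmod_triangle_mid (mix (chi2 (eta x)) (h2 x) (F x)) (F x) y). lra. }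
  split; [|split].
  - apply onF; [exact Dz | |].
    + apply C2'; [now apply Seta |]. left. now apply (Hclose eta v b).
    + unfold F. eapply Rle_trans; [apply mix_near_left |].
      * now apply Bc1.
      * rewrite Cmod_1. lra.
      * now apply B1.
      * specialize (C1 z Hz). lra.
  - apply onF; [exact D1 | |].
    + apply C2'; [now apply Seta |]. right.
      apply (Hclose (fun x => eta (psi1 x)) w c); trivial.
    + unfold F. eapply Rle_trans; [apply mix_near_right |].
      * now apply Bc1.
      * rewrite Cmod_1. lra.
      * now apply B1.
      * specialize (C1' (psi1 z) D1 (or_introl (Hclose psi1 u1 a1 z M1 X1 Hz))). lra.
  - rewrite I1 by exact Dz. eapply Rle_trans; [apply mix_near_left |].
    + now apply Bc2.
    + now apply B2.
    + now apply BF.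
    + specialize (C2 z Hz). lra.
Qed.

(** * Separation of the orbits *)

Lemma pdist_gt_of_sqr (T pd : R) : 0 <= T -> 0 <= pd -> 1 - pd ^ 2 < 1 - T ^ 2 -> T < pd.
Proof. intros. nra. Qed.

Lemma orbit_to_boundary (phi : C -> C) (p : C) (mu tau T : R) :
  attracting_form phi p mu tau -> T < 1 ->
  exists N, forall n, (N <= n)%nat -> T < Cmod (iterate phi n 0).
Proof.
  intros H HT. destruct (iterates_tend phi p mu tau 0 H disc_0 (1 - T) ltac:(lra)) as [N K].
  exists N. intros n Hn. specialize (K n Hn).
  pose proof (Cmod_triangle_rev p (iterate phi n 0)) as R1. rewrite Cmod_sub_sym in R1.
  destruct H as [[Hp _] _]. lra.
Qed.

Lemma separation_distinct_points (phi1 phi2 : C -> C) (p1 p2 : C) (mu1 mu2 tau1 tau2 T : R) :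
  attracting_form phi1 p1 mu1 tau1 -> attracting_form phi2 p2 mu2 tau2 -> p1 <> p2 ->
  0 <= T < 1 ->
  exists N, forall n, (N <= n)%nat -> T < pdist (iterate phi1 n 0) (iterate phi2 n 0).
Proof.
  intros H1 H2 Hn HT. pose proof (Cmod_pos _ (Csub_neq_0 _ _ Hn)) as Hd.
  pose proof H1 as [[Hp1 _] _]. pose proof H2 as [[Hp2 _] _].
  set (d := Cmod (p1 - p2)%C) in *.
  set (e := Rmin (d / 4) ((1 - T ^ 2) * d ^ 2 / 16)).
  assert (He : 0 < e).
  { apply Rmin_pos; [lra |]. apply Rdiv_lt_0_compat; [|lra].
    apply Rmult_lt_0_compat; [nra | now apply pow_lt]. }
  assert (He1 : e <= d / 4) by apply Rmin_l.
  assert (He2 : e <= (1 - T ^ 2) * d ^ 2 / 16) by apply Rmin_r.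
  destruct (iterates_tend phi1 p1 mu1 tau1 0 H1 disc_0 e He) as [N1 K1].
  destruct (iterates_tend phi2 p2 mu2 tau2 0 H2 disc_0 e He) as [N2 K2].
  exists (max N1 N2). intros n Hnn. specialize (K1 n ltac:(lia)). specialize (K2 n ltac:(lia)).
  destruct (normal_form_iterate phi1 p1 mu1 tau1 n (proj1 H1)) as [_ [_ E1]].
  destruct (normal_form_iterate phi2 p2 mu2 tau2 n (proj1 H2)) as [_ [_ E2]].
  pose proof (proj1 (E1 0 disc_0)) as D1. pose proof (proj1 (E2 0 disc_0)) as D2.
  set (z := iterate phi1 n 0) in *. set (w := iterate phi2 n 0) in *.
  apply pdist_gt_of_sqr; [lra | apply pdist_ge_0 |].
  pose proof (one_sub_pdist_sqr z w ltac:(unfold disc in D1; lra) D2) as E.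
  assert (Ed : Cmod (1 - Cconj p1 * p2)%C = d).
  { rewrite <- (Cconj_unit p1 Hp1).
    replace (Cconj p1 * p1 - Cconj p1 * p2)%C with (Cconj p1 * (p1 - p2))%C by ring.
    rewrite Cmod_mult, Cmod_conj, Hp1. unfold d. ring. }
  pose proof (one_sub_conj_mul_lipschitz p1 p2 z w e) as L.
  rewrite (Cmod_sub_sym p1 z), (Cmod_sub_sym p2 w), Ed in L. unfold disc in D1, D2.
  specialize (L ltac:(lra) ltac:(lra) ltac:(lra) ltac:(lra)).
  set (D := Cmod (1 - Cconj z * w)%C) in *.
  pose proof (Cmod_triangle_rev p1 z) as R1. rewrite Cmod_sub_sym in R1.
  pose proof (Cmod_ge_0 z). pose proof (Cmod_ge_0 w).
  assert (A : (1 - Cmod z ^ 2) * (1 - Cmod w ^ 2) <= 2 * e * 1).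
  { apply Rmult_le_compat; nra. }
  assert (B : (d / 2) ^ 2 <= D ^ 2) by (apply pow_incr; lra).
  set (x := 1 - pdist z w ^ 2) in *.
  assert (Hd2 : 0 < d ^ 2) by (now apply pow_lt).
  apply Rnot_le_lt. intros Hle.
  assert (HT2 : 0 < 1 - T ^ 2) by nra.
  assert ((1 - T ^ 2) * (d / 2) ^ 2 <= x * D ^ 2) by (apply Rmult_le_compat; nra).
  replace ((d / 2) ^ 2) with (d ^ 2 / 4) in * by field. nra.
Qed.

Lemma cayley_orbit (phi : C -> C) (p : C) (mu tau : R) (n : nat) :
  normal_form phi p mu tau ->
  disc (iterate phi n 0) /\
  cayley p (iterate phi n 0) = ((mu ^ n, tau * geometric_sum mu n) : C).
Proof.
  intros H. destruct (normal_form_iterate phi p mu tau n H) as [Hp [_ E]].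
  destruct (E 0 disc_0) as [D K]. split; [exact D |]. rewrite K, cayley_0 by exact Hp.
  unfold Ci, RtoC, Cmult, Cplus. simpl. f_equal; ring.
Qed.

Lemma separation_multipliers (phi1 phi2 : C -> C) (p : C) (mu1 mu2 tau1 tau2 T : R) :
  normal_form phi1 p mu1 tau1 -> normal_form phi2 p mu2 tau2 -> mu1 < mu2 ->
  0 <= T < 1 ->
  exists N, forall n, (N <= n)%nat -> T < pdist (iterate phi1 n 0) (iterate phi2 n 0).
Proof.
  intros H1 H2 Hlt HT. pose proof H1 as [Hp [Hm1 _]].
  assert (Hq : 0 < mu1 / mu2 < 1).
  { split; [apply Rdiv_lt_0_compat; lra |].
    apply Rmult_lt_reg_r with mu2; [lra |]. unfold Rdiv. rewrite Rmult_assoc, Rinv_l by lra. lra. }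
  destruct (pow_lt_1_zero (mu1 / mu2)) with (y := (1 - T ^ 2) / 4) as [N HN].
  { rewrite Rabs_pos_eq; lra. }
  { apply Rdiv_lt_0_compat; nra. }
  exists N. intros n Hn. specialize (HN n Hn). rewrite Rabs_pos_eq in HN by (apply pow_le; lra).
  destruct (cayley_orbit phi1 p mu1 tau1 n H1) as [D1 E1].
  destruct (cayley_orbit phi2 p mu2 tau2 n H2) as [D2 E2].
  pose proof (pdist_cayley p _ _ Hp D1 D2) as E. rewrite E1, E2, Cmod_sqr in E. simpl Re in E.
  simpl Im in E.
  apply pdist_gt_of_sqr; [lra | apply pdist_ge_0 |].
  pose proof (pdist_lt_1 _ _ D1 D2) as L1. pose proof (pdist_ge_0 (iterate phi1 n 0) (iterate phi2 n 0)).
  set (pd := pdist (iterate phi1 n 0) (iterate phi2 n 0)) in *.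
  assert (P1 : 0 < mu1 ^ n) by (apply pow_lt; lra).
  assert (P2 : 0 < mu2 ^ n) by (apply pow_lt; lra).
  unfold Rdiv in HN. rewrite Rpow_mult_distr, pow_inv in HN. fold (mu1 ^ n / mu2 ^ n) in HN.
  set (a := mu1 ^ n) in *. set (b := mu2 ^ n) in *.
  set (y := (tau1 * geometric_sum mu1 n + - (tau2 * geometric_sum mu2 n)) ^ 2) in *.
  assert (Hy : 0 <= y) by apply pow2_ge_0.
  assert (Hx : 0 <= 1 - pd ^ 2) by nra.
  assert (K : (1 - pd ^ 2) * b ^ 2 <= 4 * (a * b)).
  { rewrite <- E. apply Rmult_le_compat_l; [exact Hx | nra]. }
  assert (K2 : 1 - pd ^ 2 <= 4 * (a / b)).
  { apply Rmult_le_reg_r with (b ^ 2); [now apply pow_lt |].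
    replace (4 * (a / b) * b ^ 2) with (4 * (a * b)) by (field; lra). exact K. }
  unfold Rdiv in K2. lra.
Qed.

Lemma separation_parabolic (phi1 phi2 : C -> C) (p : C) (tau1 tau2 T : R) :
  normal_form phi1 p 1 tau1 -> normal_form phi2 p 1 tau2 -> tau1 <> tau2 ->
  0 <= T < 1 ->
  exists N, forall n, (N <= n)%nat -> T < pdist (iterate phi1 n 0) (iterate phi2 n 0).
Proof.
  intros H1 H2 Hne HT. pose proof H1 as [Hp _].
  assert (Hd : 0 < (tau1 - tau2) ^ 2) by (apply pow2_gt_0; lra).
  assert (HT2 : 0 < 1 - T ^ 2) by nra.
  destruct (INR_unbounded (4 / ((tau1 - tau2) ^ 2 * (1 - T ^ 2)) + 1)) as [N HN].
  exists N. intros n Hn. apply le_INR in Hn.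
  destruct (cayley_orbit phi1 p 1 tau1 n H1) as [D1 E1].
  destruct (cayley_orbit phi2 p 1 tau2 n H2) as [D2 E2].
  pose proof (pdist_cayley p _ _ Hp D1 D2) as E. rewrite E1, E2, Cmod_sqr in E. simpl Re in E.
  simpl Im in E. rewrite !geometric_sum_1, !pow1 in E.
  apply pdist_gt_of_sqr; [lra | apply pdist_ge_0 |].
  pose proof (pdist_lt_1 _ _ D1 D2) as L1. pose proof (pdist_ge_0 (iterate phi1 n 0) (iterate phi2 n 0)).
  set (pd := pdist (iterate phi1 n 0) (iterate phi2 n 0)) in *.
  set (k := INR n) in *.
  assert (Hk : 4 / ((tau1 - tau2) ^ 2 * (1 - T ^ 2)) + 1 < k) by lra.
  set (w := (tau1 - tau2) ^ 2) in *.
  assert (H4 : 0 < 4 / (w * (1 - T ^ 2))).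
  { apply Rdiv_lt_0_compat; [lra | now apply Rmult_lt_0_compat]. }
  assert (H5 : 4 < k * (w * (1 - T ^ 2))).
  { apply Rle_lt_trans with (4 / (w * (1 - T ^ 2)) * (w * (1 - T ^ 2))).
    - right. field. split; lra.
    - apply Rmult_lt_compat_r; [now apply Rmult_lt_0_compat | lra]. }
  assert (Hx : 0 <= 1 - pd ^ 2) by nra.
  assert (K : (1 - pd ^ 2) * (w * k) <= 4).
  { apply Rle_trans with ((1 - pd ^ 2) * ((1 + 1) ^ 2 + (tau1 * k + - (tau2 * k)) ^ 2)); [|lra].
    apply Rmult_le_compat_l; [exact Hx |].
    replace ((tau1 * k + - (tau2 * k)) ^ 2) with (w * k ^ 2) by (unfold w; ring). nra. }
  assert (0 < w * k) by nra. nra.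
Qed.

(** Orbits with different attracting points end at different points of the
    circle. For a common attracting point, put at infinity, different slopes make
    the ratio of the real parts diverge, and two different translations make the
    difference of the imaginary parts diverge. *)
Lemma orbits_separate (phi1 phi2 : C -> C) (p1 p2 : C) (mu1 mu2 tau1 tau2 T : R) :
  attracting_form phi1 p1 mu1 tau1 -> attracting_form phi2 p2 mu2 tau2 ->
  (p1 = p2 -> mu1 = mu2 -> mu1 = 1 /\ tau1 <> tau2) -> T < 1 ->
  exists n, T < Cmod (iterate phi1 n 0) /\ T < Cmod (iterate phi2 n 0) /\
    T < pdist (iterate phi1 n 0) (iterate phi2 n 0).
Proof.
  intros H1 H2 Hc HT. set (T' := Rmax 0 T).
  assert (HT' : 0 <= T' < 1) by (split; [apply Rmax_l | apply Rmax_lub_lt; lra]).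
  assert (HTT : T <= T') by apply Rmax_r.
  assert (Hsep : exists N, forall n, (N <= n)%nat ->
    T' < pdist (iterate phi1 n 0) (iterate phi2 n 0)).
  { destruct (classic (p1 = p2)) as [<- | Hn].
    - destruct (Rtotal_order mu1 mu2) as [Hlt | [<- | Hgt]].
      + apply (separation_multipliers phi1 phi2 p1 mu1 mu2 tau1 tau2); trivial; [apply H1 | apply H2].
      + destruct (Hc eq_refl eq_refl) as [-> Ht].
        apply (separation_parabolic phi1 phi2 p1 tau1 tau2); trivial; [apply H1 | apply H2].
      + destruct (separation_multipliers phi2 phi1 p1 mu2 mu1 tau2 tau1 T') as [N K];
          trivial; [apply H2 | apply H1 |].
        exists N. intros n Hn. rewrite pdist_sym; [now apply K | |].
        * apply (cayley_orbit phi1 p1 mu1 tau1 n), H1.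
        * apply (cayley_orbit phi2 p1 mu2 tau2 n), H2.
    - now apply (separation_distinct_points phi1 phi2 p1 p2 mu1 mu2 tau1 tau2). }
  destruct Hsep as [N K].
  destruct (orbit_to_boundary phi1 p1 mu1 tau1 T H1 HT) as [N1 K1].
  destruct (orbit_to_boundary phi2 p2 mu2 tau2 T H2 HT) as [N2 K2].
  exists (max N (max N1 N2)). split; [apply K1; lia |]. split; [apply K2; lia |].
  eapply Rle_lt_trans; [exact HTT |]. apply K. lia.
Qed.

Lemma bounded_image (psi : C -> C) (u a : C) (r : R) : mobius psi u a -> 0 <= r < 1 ->
  exists R0, 0 <= R0 < 1 /\ forall z, Cmod z <= r -> Cmod (psi z) <= R0.
Proof.
  intros Hm Hr. pose proof (mobius_self_map psi u a Hm) as [_ Hd].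
  pose proof (Hd 0 disc_0) as D0. pose proof D0 as D0'. unfold disc in D0'.
  pose proof (Cmod_ge_0 (psi 0)) as P0.
  set (c := (1 - r ^ 2) * (1 - Cmod (psi 0)) ^ 2).
  assert (Hc : 0 < c <= 1).
  { unfold c. split.
    - apply Rmult_lt_0_compat; [nra | apply pow_lt; lra].
    - assert (1 - r ^ 2 <= 1) by nra. assert (0 < 1 - r ^ 2) by nra.
      assert ((1 - Cmod (psi 0)) ^ 2 <= 1) by nra.
      assert (0 <= (1 - Cmod (psi 0)) ^ 2) by apply pow2_ge_0. nra. }
  exists (sqrt (1 - c)). split.
  { split; [apply sqrt_pos |]. apply Rlt_le_trans with (sqrt 1).
    - apply sqrt_lt_1_alt. lra.
    - rewrite sqrt_1. lra. }
  intros z Hz. assert (Dz : disc z) by (unfold disc; lra). pose proof (Hd z Dz) as D1.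
  pose proof (one_sub_pdist_sqr (psi 0) (psi z) ltac:(lra) D1) as E.
  rewrite (mobius_isometry psi u a 0 z Hm disc_0 Dz), pdist_0_l in E.
  pose proof (Cmod_one_sub_conj_mul_ge (psi 0) (psi z)) as L.
  unfold disc in D1. pose proof (Cmod_ge_0 (psi z)). pose proof (Cmod_ge_0 z).
  assert (L2 : 1 - Cmod (psi 0) <= Cmod (1 - Cconj (psi 0) * psi z)%C) by nra.
  assert (L3 : c <= (1 - Cmod z ^ 2) * Cmod (1 - Cconj (psi 0) * psi z)%C ^ 2).
  { unfold c. apply Rmult_le_compat; [nra | apply pow2_ge_0 | nra | apply pow_incr; lra]. }
  rewrite E in L3.
  assert (L4 : (1 - Cmod (psi 0) ^ 2) * (1 - Cmod (psi z) ^ 2) <= 1 * (1 - Cmod (psi z) ^ 2)).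
  { apply Rmult_le_compat_r; nra. }
  apply Rsqr_incr_0; [|assumption|apply sqrt_pos].
  rewrite Rsqr_sqrt by lra. unfold Rsqr. lra.
Qed.

(** At the centre [psi 0], far out, the modulus is close to one, and the
    Schwarz-Pick lemma then leaves no room for variation on the hyperbolic disc. *)
Lemma bprod_far_constant (L : list C) (r eps : R) : blaschke_zeros L -> 0 <= r < 1 -> 0 < eps ->
  exists T, T < 1 /\ forall psi u a, mobius psi u a -> T < Cmod (psi 0) ->
  exists c, Cmod c = 1 /\ forall z, Cmod z <= r -> Cmod (bprod L (psi z) - c)%C <= eps.
Proof.
  intros HL Hr He. set (t := Rmax 0 (1 - eps * (1 - r) / 3)).
  assert (Ht0 : 0 <= t) by apply Rmax_l.
  assert (Ht1 : 1 - eps * (1 - r) / 3 <= t) by apply Rmax_r.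
  assert (Ht : t < 1) by (apply Rmax_lub_lt; nra).
  destruct (bprod_unimodular_at_boundary L HL t Ht) as [rho [Hrho K]].
  exists rho. split; [lra |]. intros psi u a Hm HX.
  pose proof (mobius_self_map psi u a Hm) as S. pose proof (proj2 S 0 disc_0) as D0.
  specialize (K _ D0 HX). pose proof (bprod_unit_ball L HL) as BL.
  pose proof (unit_ball_comp _ _ BL S) as BLp.
  set (X := bprod L (psi 0)) in *.
  exists (X / RtoC (Cmod X))%C.
  assert (HXm : 0 < Cmod X <= 1) by (split; [lra | apply BL, D0]).
  assert (Hz : forall z, Cmod z <= r ->
    Cmod (bprod L (psi z) - X)%C <= r * Cmod (1 - Cconj X * bprod L (psi z))%C).
  { intros z Hz. assert (Dz : disc z) by (unfold disc; lra).
    pose proof (unit_ball_schwarz_pick _ 0 z BLp disc_0 Dz) as SP. fold X in SP.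
    rewrite pdist_0_l in SP. eapply Rle_trans; [exact SP |].
    apply Rmult_le_compat_r; [apply Cmod_ge_0 | exact Hz]. }
  split.
  - apply (near_unit_point r X X Hr HXm). replace (X - X)%C with (RtoC 0) by ring.
    rewrite Cmod_0. apply Rmult_le_pos; [lra | apply Cmod_ge_0].
  - intros z Hzr. eapply Rle_trans; [apply (near_unit_point r X _ Hr HXm (Hz z Hzr)) |].
    apply Rmult_le_reg_r with (1 - r); [lra |]. unfold Rdiv.
    rewrite Rmult_assoc, Rinv_l by lra. lra.
Qed.

(** * The infinite product *)

(** The earlier blocks [L] act on the two distant discs as unimodular constants,
    which the targets for the new block [l] compensate. The new block is the
    Blaschke approximation of a function given by [three_targets]. *)
Lemma next_block (phi1 phi2 : C -> C) (u1 a1 u2 a2 : C) :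
  mobius phi1 u1 a1 -> mobius phi2 u2 a2 ->
  (forall T, T < 1 -> exists n, T < Cmod (iterate phi1 n 0) /\ T < Cmod (iterate phi2 n 0) /\
     T < pdist (iterate phi1 n 0) (iterate phi2 n 0)) ->
  forall (L : list C) (g1 g2 : C -> C) (r eps : R),
  blaschke_zeros L -> unit_ball g1 -> unit_ball g2 -> 0 <= r < 1 -> 0 < eps ->
  exists n l R0, blaschke_zeros l /\ l <> nil /\ r <= R0 < 1 /\ forall z, Cmod z <= r ->
    Cmod (bprod l z - 1)%C <= eps /\
    (Cmod (iterate phi1 n z) <= R0 /\
     Cmod (bprod (L ++ l) (iterate phi1 n z) - g1 z)%C <= eps) /\
    (Cmod (iterate phi2 n z) <= R0 /\
     Cmod (bprod (L ++ l) (iterate phi2 n z) - g2 z)%C <= eps).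
Proof.
  intros M1 M2 Hfar L g1 g2 r eps HL B1 B2 Hr He.
  set (e := Rmin (1 / 4) (eps / 8)).
  assert (Hep : 0 < e) by (apply Rmin_pos; lra).
  assert (He4 : e <= 1 / 4) by apply Rmin_l. assert (He8 : e <= eps / 8) by apply Rmin_r.
  destruct (three_targets r e Hr Hep) as [T1 [HT1 K3]].
  destruct (bprod_far_constant L r e HL Hr Hep) as [T2 [HT2 Kc]].
  destruct (Hfar (Rmax T1 T2)) as [n [X1 [X2 X12]]]; [now apply Rmax_lub_lt |].
  pose proof (Rmax_l T1 T2) as Lm. pose proof (Rmax_r T1 T2) as Lm'.
  destruct (mobius_iterate phi1 u1 a1 n M1) as [w1 [c1 N1]].
  destruct (mobius_iterate phi2 u2 a2 n M2) as [w2 [c2 N2]].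
  set (psi1 := iterate phi1 n) in *. set (psi2 := iterate phi2 n) in *.
  destruct (Kc psi1 w1 c1 N1 ltac:(lra)) as [k1 [U1 C1]].
  destruct (Kc psi2 w2 c2 N2 ltac:(lra)) as [k2 [U2 C2]].
  destruct (mobius_inverse psi1 w1 c1 N1) as [eta1 [? [? [_ [S1 [I1 _]]]]]].
  destruct (mobius_inverse psi2 w2 c2 N2) as [eta2 [? [? [_ [S2 [I2 _]]]]]].
  assert (Bh : forall g eta k, unit_ball g -> holomorphic_self_map eta -> Cmod k = 1 ->
    unit_ball (fun z => Cconj k * g (eta z))%C).
  { intros g eta k Bg Se Uk. pose proof (unit_ball_comp g eta Bg Se) as [Hh Hb]. split.
    - apply holomorphic_cdiff. intros z Hz. apply cdiff_mult; [apply cdiff_const |].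
      exact (proj1 (holomorphic_cdiff _) Hh z Hz).
    - intros z Hz. rewrite Cmod_mult, Cmod_conj, Uk, Rmult_1_l. now apply Hb. }
  destruct (K3 psi1 psi2 w1 c1 w2 c2 N1 N2 ltac:(lra) ltac:(lra) ltac:(lra)
    _ _ (Bh g1 eta1 k1 B1 S1 U1) (Bh g2 eta2 k2 B2 S2 U2)) as [f [Bf Kf]].
  destruct (bounded_image psi1 w1 c1 r N1 Hr) as [R1 [HR1 Q1]].
  destruct (bounded_image psi2 w2 c2 r N2 Hr) as [R2 [HR2 Q2]].
  set (R0 := Rmax r (Rmax R1 R2)).
  assert (HR0 : r <= R0) by apply Rmax_l.
  assert (HR01 : R1 <= R0) by (eapply Rle_trans; [apply Rmax_l | apply Rmax_r]).
  assert (HR02 : R2 <= R0) by (eapply Rle_trans; [apply Rmax_r | apply Rmax_r]).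
  assert (HR0' : R0 < 1) by (repeat apply Rmax_lub_lt; lra).
  destruct (bprod_approximation f R0 e Bf ltac:(lra) (conj Hep He4)) as [l0 [Hl0 K0]].
  { apply (Kf 0). rewrite Cmod_0. lra. }
  (* An extra zero close to the circle keeps the block nonempty. *)
  set (t := Rmin (1 / 2) (e * (1 - R0) / 2)).
  assert (Ht : 0 < t) by (apply Rmin_pos; [lra | apply Rdiv_lt_0_compat; nra]).
  assert (Ht1 : t <= 1 / 2) by apply Rmin_l. assert (Ht2 : t <= e * (1 - R0) / 2) by apply Rmin_r.
  set (a := RtoC (1 - t)).
  assert (Ma : Cmod a = 1 - t) by (apply Cmod_RtoC_pos; lra).
  assert (Da : disc a) by (unfold disc; lra).
  assert (Na : a <> RtoC 0) by (apply Cmod_pos_neq; lra).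
  assert (Hl : blaschke_zeros (a :: l0)).
  { intros b [<- | Hb]; [now split | now apply Hl0]. }
  assert (Kl : forall z, Cmod z <= R0 -> Cmod (bprod (a :: l0) z - f z)%C <= 6 * e).
  { intros z Hz. assert (Dz : disc z) by (unfold disc; lra). simpl.
    pose proof (blaschke_factor_near_1 a z Da Na Dz) as Kb. rewrite Ma in Kb.
    assert (Kb' : 2 / (1 - Cmod z) * (1 - (1 - t)) <= e).
    { apply Rmult_le_reg_r with (1 - Cmod z); [lra |].
      replace (2 / (1 - Cmod z) * (1 - (1 - t)) * (1 - Cmod z)) with (2 * t) by (field; lra).
      nra. }
    specialize (K0 z Hz). pose proof (bprod_bound l0 z Hl0 Dz).
    replace (blaschke_factor a z * bprod l0 z - f z)%C
      with ((blaschke_factor a z - 1) * bprod l0 z + (bprod l0 z - f z))%C by ring.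
    eapply Rle_trans; [apply Cmod_triangle |]. rewrite Cmod_mult.
    pose proof (Cmod_ge_0 (blaschke_factor a z - 1)%C). pose proof (Cmod_ge_0 (bprod l0 z)).
    nra. }
  exists n, (a :: l0), R0. fold psi1 psi2.
  split; [exact Hl |]. split; [discriminate |]. split; [lra |].
  assert (Hmain : forall g eta k psi z, unit_ball g -> Cmod k = 1 -> Cmod z <= r ->
    Cmod (psi z) <= R0 -> eta (psi z) = z ->
    Cmod (f (psi z) - Cconj k * g (eta (psi z)))%C <= e ->
    Cmod (bprod L (psi z) - k)%C <= e ->
    Cmod (bprod (L ++ a :: l0) (psi z) - g z)%C <= eps).
  { intros g eta k psi z Bg Uk Hz Hpz Ieta Kfz Kk.
    rewrite Ieta in Kfz. pose proof (Kl _ Hpz) as Kz.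
    assert (Dp : disc (psi z)) by (unfold disc; lra).
    rewrite bprod_app. pose proof (bprod_bound _ _ Hl Dp) as BQ.
    set (Q := bprod (a :: l0) (psi z)) in *. set (P := bprod L (psi z)) in *.
    pose proof (Cmod_triangle_mid Q (f (psi z)) (Cconj k * g z)%C) as T.
    replace (P * Q - g z)%C with ((P - k) * Q + k * (Q - Cconj k * g z))%C.
    - eapply Rle_trans; [apply Cmod_triangle |]. rewrite !Cmod_mult, Uk.
      pose proof (Cmod_ge_0 (P - k)%C). pose proof (Cmod_ge_0 Q). nra.
    - transitivity (P * Q - (Cconj k * k) * g z)%C; [ring |].
      rewrite (Cconj_unit k Uk). ring. }
  intros z Hz. assert (Dz : disc z) by (unfold disc; lra).
  destruct (Kf z Hz) as [F0 [F1 F2]].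
  split; [|split].
  - pose proof (Kl z ltac:(lra)). pose proof (Cmod_triangle_mid (bprod (a :: l0) z) (f z) 1). lra.
  - assert (Hb : Cmod (psi1 z) <= R0) by (specialize (Q1 z Hz); lra). split; [exact Hb |].
    apply (Hmain g1 eta1 k1 psi1 z); auto.
  - assert (Hb : Cmod (psi2 z) <= R0) by (specialize (Q2 z Hz); lra). split; [exact Hb |].
    apply (Hmain g2 eta2 k2 psi2 z); auto.
Qed.

Definition radius (k : nat) : R := INR k / (INR k + 1).

Lemma radius_bounds (k : nat) : 0 <= radius k < 1.
Proof.
  pose proof (pos_INR k). unfold radius. split; [apply Rdiv_le_0_compat; lra |].
  apply Rmult_lt_reg_r with (INR k + 1); [lra |]. unfold Rdiv.
  rewrite Rmult_assoc, Rinv_l by lra. lra.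
Qed.

Definition tolerance (k : nat) : R := / 2 ^ (k + 2).

Lemma tolerance_pos (k : nat) : 0 < tolerance k.
Proof. apply Rinv_0_lt_compat, pow_lt. lra. Qed.

Lemma tolerance_S (k : nat) : tolerance (S k) = tolerance k / 2.
Proof. unfold tolerance. simpl. field. apply pow_nonzero. lra. Qed.

(** The third component is free, so that every pair of targets recurs. *)
Definition target_pair (k : nat) : (C -> C) * (C -> C) :=
  let (ij, _) := Cantor.of_nat k in
  let (i, j) := Cantor.of_nat ij in (target i, target j).

Lemma target_pair_unit_ball (k : nat) :
  unit_ball (fst (target_pair k)) /\ unit_ball (snd (target_pair k)).
Proof.
  unfold target_pair. destruct (Cantor.of_nat k) as [ij m], (Cantor.of_nat ij) as [i j].
  split; apply target_unit_ball.
Qed.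

(** [L k] lists the zeros of the first [k] blocks. The ball of radius [rad k]
    contains the discs where the earlier blocks have done their work, which block
    [k] must not spoil. *)
Record block_sequence (phi1 phi2 : C -> C) (L : nat -> list C) (rad : nat -> R) : Prop := {
  block_start : L 0%nat = nil;
  block_zeros : forall k, blaschke_zeros (L k);
  block_rad : forall k, 0 <= rad k <= rad (S k) /\ rad k < 1;
  block_step : forall k, exists l, L (S k) = L k ++ l /\ l <> nil /\
    forall z, Cmod z <= rad k -> Cmod (bprod l z - 1)%C <= tolerance k;
  block_hit : forall k, exists n, forall z, Cmod z <= radius k ->
    (Cmod (iterate phi1 n z) <= rad (S k) /\
     Cmod (bprod (L (S k)) (iterate phi1 n z) - fst (target_pair k) z)%C <= tolerance k) /\
    (Cmod (iterate phi2 n z) <= rad (S k) /\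
     Cmod (bprod (L (S k)) (iterate phi2 n z) - snd (target_pair k) z)%C <= tolerance k) }.

Lemma block_sequence_exists (phi1 phi2 : C -> C) (u1 a1 u2 a2 : C) :
  mobius phi1 u1 a1 -> mobius phi2 u2 a2 ->
  (forall T, T < 1 -> exists n, T < Cmod (iterate phi1 n 0) /\ T < Cmod (iterate phi2 n 0) /\
     T < pdist (iterate phi1 n 0) (iterate phi2 n 0)) ->
  exists L rad, block_sequence phi1 phi2 L rad.
Proof.
  intros M1 M2 Hfar.
  set (St := {s : list C * R | blaschke_zeros (fst s) /\ 0 <= snd s < 1}).
  set (rel := fun (k : nat) (s s' : list C * R) =>
    snd s <= snd s' /\
    (exists l, fst s' = fst s ++ l /\ l <> nil /\
       forall z, Cmod z <= snd s -> Cmod (bprod l z - 1)%C <= tolerance k) /\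
    exists n, forall z, Cmod z <= radius k ->
      (Cmod (iterate phi1 n z) <= snd s' /\
       Cmod (bprod (fst s') (iterate phi1 n z) - fst (target_pair k) z)%C <= tolerance k) /\
      (Cmod (iterate phi2 n z) <= snd s' /\
       Cmod (bprod (fst s') (iterate phi2 n z) - snd (target_pair k) z)%C <= tolerance k)).
  assert (step : forall k (s : St), exists s' : St, rel k (proj1_sig s) (proj1_sig s')).
  { intros k [[L R0] [HL HR]]. simpl in HL, HR.
    destruct (target_pair_unit_ball k) as [B1 B2]. pose proof (radius_bounds k) as Hrk.
    pose proof (Rmax_l R0 (radius k)) as Lm. pose proof (Rmax_r R0 (radius k)) as Lm'.
    assert (Hr : 0 <= Rmax R0 (radius k) < 1) by (split; [lra | apply Rmax_lub_lt; lra]).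
    destruct (next_block phi1 phi2 u1 a1 u2 a2 M1 M2 Hfar L _ _ _ _ HL B1 B2 Hr
      (tolerance_pos k)) as [n [l [R' [Hl [Hne [HR' K]]]]]].
    assert (HLl : blaschke_zeros (L ++ l)).
    { intros a Ha. apply in_app_or in Ha. destruct Ha; [now apply HL | now apply Hl]. }
    assert (HR2 : 0 <= R' < 1) by lra.
    exists (exist _ (L ++ l, R') (conj HLl HR2)). unfold rel. simpl.
    split; [lra |]. split.
    - exists l. split; [reflexivity |]. split; [exact Hne |].
      intros z Hz. apply (K z). lra.
    - exists n. intros z Hz. apply (K z). lra. }
  assert (H0 : blaschke_zeros (fst (@nil C, 0)) /\ 0 <= snd (@nil C, 0) < 1).
  { simpl. split; [intros a [] | lra]. }
  set (s := nat_rect (fun _ => St) (exist _ (nil, 0) H0)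
    (fun k s => proj1_sig (constructive_indefinite_description _ (step k s)))).
  assert (Hs : forall k, rel k (proj1_sig (s k)) (proj1_sig (s (S k)))).
  { intros k. exact (proj2_sig (constructive_indefinite_description _ (step k (s k)))). }
  exists (fun k => fst (proj1_sig (s k))), (fun k => snd (proj1_sig (s k))).
  split.
  - reflexivity.
  - intros k. apply (proj2_sig (s k)).
  - intros k. pose proof (proj2_sig (s k)) as [_ K]. pose proof (proj1 (Hs k)). lra.
  - intros k. exact (proj1 (proj2 (Hs k))).
  - intros k. exact (proj2 (proj2 (Hs k))).
Qed.

Lemma Cprod_ext (u v : nat -> C) (n : nat) :
  (forall i, (i < n)%nat -> u i = v i) -> Cprod u n = Cprod v n.
Proof.
  intros H. induction n as [|n IH]; [reflexivity |]. simpl. rewrite IH, H by auto. reflexivity.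
Qed.

Lemma Cprod_bprod (l : list C) (z : C) :
  Cprod (fun n => blaschke_factor (nth n l 0) z) (length l) = bprod l z.
Proof.
  induction l as [|a l IH] using rev_ind; [reflexivity |].
  rewrite length_app, Nat.add_1_r. simpl. rewrite bprod_app, <- IH. simpl.
  rewrite nth_middle. rewrite Cmult_1_r. f_equal.
  apply Cprod_ext. intros i Hi. now rewrite app_nth1.
Qed.

Lemma C_complete (u : nat -> C) :
  (forall eps, 0 < eps -> exists N, forall n m, (N <= n)%nat -> (N <= m)%nat ->
     Cmod (u n - u m)%C <= eps) ->
  exists l, forall eps, 0 < eps -> exists N, forall n, (N <= n)%nat -> Cmod (u n - l)%C <= eps.
Proof.
  intros H.
  assert (Hreal : forall p : C -> R,
    (forall z w, Rabs (p z - p w) <= Cmod (z - w)%C) ->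
    exists l : R, forall eps, 0 < eps -> exists N, forall n, (N <= n)%nat ->
      Rabs (p (u n) - l) <= eps).
  { intros p Hp. assert (Hc : ex_lim_seq_cauchy (fun n => p (u n))).
    { intros eps. pose proof (cond_pos eps) as He.
      destruct (H (eps / 2) ltac:(lra)) as [N K]. exists N. intros n m Hn Hm.
      eapply Rle_lt_trans; [apply Hp |]. specialize (K n m Hn Hm). lra. }
    apply ex_lim_seq_cauchy_corr in Hc. destruct Hc as [l Hl]. exists l.
    apply is_lim_seq_spec in Hl. intros eps He. destruct (Hl (mkposreal eps He)) as [N K].
    exists N. intros n Hn. left. now apply K. }
  destruct (Hreal Re) as [x Hx]; [intros z w; exact (re_le_Cmod (z - w)%C) |].
  destruct (Hreal Im) as [y Hy]; [intros z w; exact (im_le_Cmod (z - w)%C) |].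
  exists (x, y). intros eps He.
  destruct (Hx (eps / 2) ltac:(lra)) as [N1 K1]. destruct (Hy (eps / 2) ltac:(lra)) as [N2 K2].
  exists (max N1 N2). intros n Hn. specialize (K1 n ltac:(lia)). specialize (K2 n ltac:(lia)).
  eapply Rle_trans; [apply Cmod_le_Re_Im |].
  change (Rabs (Re (u n) - x) + Rabs (Im (u n) - y) <= eps). lra.
Qed.

(** The Schwarz-Pick lemma, rescaled from the unit disc to the ball of radius
    [s]. *)
Lemma small_slope (d : C -> C) (z0 z : C) (s eps : R) :
  (forall w, Cmod (w - z0)%C < s -> cdiff d w) ->
  (forall w, Cmod (w - z0)%C < s -> Cmod (d w) <= eps) -> 0 < eps ->
  Cmod (z - z0)%C < s -> Cmod (d z - d z0)%C <= 2 * eps / s * Cmod (z - z0)%C.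
Proof.
  intros Hd Hb He Hz. pose proof (Cmod_ge_0 (z - z0)%C).
  assert (Hs : 0 < s) by lra.
  assert (Ns : RtoC s <> RtoC 0) by (apply Cmod_pos_neq; rewrite Cmod_RtoC_pos; lra).
  assert (Ne : RtoC eps <> RtoC 0) by (apply Cmod_pos_neq; rewrite Cmod_RtoC_pos; lra).
  assert (Hin : forall w, disc w -> Cmod (z0 + RtoC s * w - z0)%C < s).
  { intros w Hw. replace (z0 + RtoC s * w - z0)%C with (RtoC s * w)%C by ring.
    rewrite Cmod_mult, Cmod_RtoC_pos by lra. unfold disc in Hw. nra. }
  set (g := fun w => (d (z0 + RtoC s * w) / RtoC eps)%C).
  assert (Bg : unit_ball g).
  { split.
    - apply holomorphic_cdiff. intros w Hw. apply cdiff_mult; [|apply cdiff_const].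
      apply (cdiff_comp d (fun w => z0 + RtoC s * w)%C); [|now apply Hd, Hin].
      apply cdiff_plus; [apply cdiff_const |].
      apply cdiff_mult; [apply cdiff_const | apply cdiff_id].
    - intros w Hw. unfold g. rewrite Cmod_div, (Cmod_RtoC_pos eps) by (trivial; lra).
      apply Rmult_le_reg_r with eps; [exact He |]. unfold Rdiv.
      rewrite Rmult_assoc, Rinv_l by lra. specialize (Hb _ (Hin w Hw)). lra. }
  set (w := ((z - z0) / RtoC s)%C).
  assert (Ew : Cmod w = Cmod (z - z0)%C / s).
  { unfold w. rewrite Cmod_div, (Cmod_RtoC_pos s) by (trivial; lra). reflexivity. }
  assert (Dw : disc w).
  { unfold disc. rewrite Ew. apply Rmult_lt_reg_r with s; [exact Hs |].
    unfold Rdiv. rewrite Rmult_assoc, Rinv_l by lra. lra. }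
  pose proof (unit_ball_schwarz_pick g 0 w Bg disc_0 Dw) as SP.
  rewrite pdist_0_l, Ew in SP.
  pose proof (proj2 Bg 0 disc_0) as G0. pose proof (proj2 Bg w Dw) as G1.
  pose proof (Cmod_triangle_sub 1 (Cconj (g 0) * g w)%C) as T.
  rewrite Cmod_1, Cmod_mult, Cmod_conj in T.
  pose proof (Cmod_ge_0 (g 0)). pose proof (Cmod_ge_0 (g w)).
  assert (T2 : Cmod (1 - Cconj (g 0) * g w)%C <= 2) by nra.
  assert (E1 : d z = (g w * RtoC eps)%C).
  { unfold g, w. replace (z0 + RtoC s * ((z - z0) / RtoC s))%C with z by (now field).
    now field. }
  assert (E0 : d z0 = (g 0 * RtoC eps)%C).
  { unfold g. replace (z0 + RtoC s * 0)%C with z0 by ring. now field. }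
  rewrite E1, E0. replace (g w * RtoC eps - g 0 * RtoC eps)%C with ((g w - g 0) * RtoC eps)%C by ring.
  rewrite Cmod_mult, (Cmod_RtoC_pos eps) by lra.
  assert (0 <= Cmod (z - z0)%C / s) by (apply Rdiv_le_0_compat; lra).
  apply Rle_trans with (Cmod (z - z0)%C / s * 2 * eps); [|right; field; lra].
  apply Rmult_le_compat_r; [lra |]. eapply Rle_trans; [exact SP |].
  now apply Rmult_le_compat_l.
Qed.

(** By [small_slope], the slope functions at a point converge uniformly too, and
    their limit is a continuous slope function for [B]. *)
Lemma weierstrass (f : nat -> C -> C) (B : C -> C) :
  (forall n z, disc z -> cdiff (f n) z) ->
  (forall r eps, 0 <= r < 1 -> 0 < eps -> exists N, forall n z, (N <= n)%nat ->
     Cmod z <= r -> Cmod (f n z - B z)%C <= eps) ->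
  forall z, disc z -> cdiff B z.
Proof.
  intros Hf Hlim z0 Hz0. pose proof Hz0 as Hz0'. unfold disc in Hz0'.
  pose proof (Cmod_ge_0 z0) as Hp.
  set (s := (1 - Cmod z0) / 2). set (r := (1 + Cmod z0) / 2).
  assert (Hs : 0 < s) by (unfold s; lra). assert (Hr : 0 <= r < 1) by (unfold r; lra).
  assert (Hball : forall w, Cmod (w - z0)%C < s -> Cmod w <= r).
  { intros w Hw. pose proof (Cmod_triangle_rev w z0). unfold s, r in *. lra. }
  assert (Hzz : Cmod (z0 - z0)%C = 0) by (replace (z0 - z0)%C with (RtoC 0) by ring; apply Cmod_0).
  set (q := fun n => proj1_sig (constructive_indefinite_description _ (Hf n z0 Hz0))).
  assert (Hq : forall n, ccont (q n) z0 /\ forall w, (f n w - f n z0 = q n w * (w - z0))%C).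
  { intros n. exact (proj2_sig (constructive_indefinite_description _ (Hf n z0 Hz0))). }
  assert (Hdiff : forall eps, 0 < eps -> exists N, forall n m w, (N <= n)%nat -> (N <= m)%nat ->
    Cmod (w - z0)%C < s -> w <> z0 -> Cmod (q n w - q m w)%C <= eps).
  { intros eps He. assert (He' : 0 < eps * s / 4) by (apply Rdiv_lt_0_compat; nra).
    destruct (Hlim r (eps * s / 4) Hr He') as [N K].
    exists N. intros n m w Hn Hm Hw Nw.
    assert (K2 : Cmod ((f n w - f m w) - (f n z0 - f m z0))%C
      <= 2 * (eps * s / 2) / s * Cmod (w - z0)%C).
    { apply (small_slope (fun w => f n w - f m w)%C); [| |lra|exact Hw].
      - intros v Hv. assert (Dv : disc v) by (specialize (Hball v Hv); unfold disc; lra).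
        apply cdiff_minus; now apply Hf.
      - intros v Hv. specialize (Hball v Hv).
        pose proof (K n v Hn Hball). pose proof (K m v Hm Hball) as Km.
        rewrite Cmod_sub_sym in Km. pose proof (Cmod_triangle_mid (f n v) (B v) (f m v)). lra. }
    replace (2 * (eps * s / 2) / s) with eps in K2 by (field; lra).
    replace ((f n w - f m w) - (f n z0 - f m z0))%C
      with ((f n w - f n z0) - (f m w - f m z0))%C in K2 by ring.
    rewrite (proj2 (Hq n)), (proj2 (Hq m)) in K2.
    replace (q n w * (w - z0) - q m w * (w - z0))%C with ((q n w - q m w) * (w - z0))%C in K2 by ring.
    rewrite Cmod_mult in K2. apply Rmult_le_reg_r with (2 := K2).
    now apply Cmod_pos, Csub_neq_0. }
  assert (Hnear : forall d, 0 < d -> exists w, Cmod (w - z0)%C < d /\ w <> z0).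
  { intros d Hd. exists (z0 + RtoC (d / 2))%C.
    assert (E : Cmod (z0 + RtoC (d / 2) - z0)%C = d / 2).
    { replace (z0 + RtoC (d / 2) - z0)%C with (RtoC (d / 2)) by ring. apply Cmod_RtoC_pos. lra. }
    split; [lra |]. intros K. rewrite K, Hzz in E. lra. }
  destruct (C_complete (fun n => q n z0)) as [l Hl].
  { intros eps He. destruct (Hdiff (eps / 3) ltac:(lra)) as [N K]. exists N. intros n m Hn Hm.
    destruct (proj1 (Hq n) (eps / 3) ltac:(lra)) as [d1 [D1 K1]].
    destruct (proj1 (Hq m) (eps / 3) ltac:(lra)) as [d2 [D2 K2]].
    destruct (Hnear (Rmin s (Rmin d1 d2))) as [w [Hw Nw]]; [repeat apply Rmin_pos; lra |].
    pose proof (Rmin_l s (Rmin d1 d2)). pose proof (Rmin_r s (Rmin d1 d2)).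
    pose proof (Rmin_l d1 d2). pose proof (Rmin_r d1 d2).
    specialize (K n m w Hn Hm ltac:(lra) Nw).
    specialize (K1 w ltac:(lra)). specialize (K2 w ltac:(lra)).
    rewrite Cmod_sub_sym in K1.
    pose proof (Cmod_triangle_mid (q n z0) (q n w) (q m z0)).
    pose proof (Cmod_triangle_mid (q n w) (q m w) (q m z0)). lra. }
  exists (fun w => if Ceq_dec w z0 then l else ((B w - B z0) / (w - z0))%C). split.
  - intros eps He. destruct (Hdiff (eps / 4) ltac:(lra)) as [N1 K1].
    destruct (Hl (eps / 4) ltac:(lra)) as [N2 K2].
    set (n := max N1 N2). specialize (K2 n ltac:(lia)). simpl in K2.
    destruct (proj1 (Hq n) (eps / 4) ltac:(lra)) as [d [Hd K3]].
    exists (Rmin s d). split; [now apply Rmin_pos |]. intros w Hw.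
    pose proof (Rmin_l s d). pose proof (Rmin_r s d).
    destruct (Ceq_dec z0 z0) as [_ | N]; [|now elim N].
    destruct (Ceq_dec w z0) as [-> | Nw].
    { replace (l - l)%C with (RtoC 0) by ring. now rewrite Cmod_0. }
    specialize (K3 w ltac:(lra)).
    pose proof (Csub_neq_0 _ _ Nw) as Nw'. pose proof (Cmod_pos _ Nw') as Pw.
    assert (Hlast : Cmod ((B w - B z0) / (w - z0) - q n w)%C <= eps / 4).
    { apply le_epsilon. intros eta Heta.
      destruct (Hlim r (eta * Cmod (w - z0)%C / 2) Hr) as [N3 K4].
      { apply Rdiv_lt_0_compat; [now apply Rmult_lt_0_compat | lra]. }
      set (m := max n N3). specialize (K1 n m w ltac:(lia) ltac:(lia) ltac:(lra) Nw).
      pose proof (K4 m w ltac:(lia) (Hball w ltac:(lra))) as A1.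
      pose proof (K4 m z0 ltac:(lia) (Hball z0 ltac:(lra))) as A2.
      assert (A3 : Cmod ((B w - B z0) / (w - z0) - q m w)%C <= eta).
      { replace ((B w - B z0) / (w - z0) - q m w)%C
          with (((B w - B z0) - q m w * (w - z0)) / (w - z0))%C by (now field).
        rewrite <- (proj2 (Hq m)), Cmod_div by exact Nw'.
        apply Rmult_le_reg_r with (1 := Pw). unfold Rdiv. rewrite Rmult_assoc, Rinv_l, Rmult_1_r by lra.
        replace (B w - B z0 - (f m w - f m z0))%C with ((f m z0 - B z0) - (f m w - B w))%C by ring.
        eapply Rle_trans; [apply Cmod_triangle_sub | lra]. }
      pose proof (Cmod_triangle_mid ((B w - B z0) / (w - z0))%C (q m w) (q n w)) as A4.
      rewrite (Cmod_sub_sym (q m w) (q n w)) in A4. lra. }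
    pose proof (Cmod_triangle_mid ((B w - B z0) / (w - z0))%C (q n w) l) as A.
    pose proof (Cmod_triangle_mid (q n w) (q n z0) l) as A'. lra.
  - intros w. destruct (Ceq_dec w z0) as [-> | Nw]; [ring |]. field. now apply Csub_neq_0.
Qed.

(** Cover the compact set with balls of radii tending to one. *)
Lemma compact_in_ball (K : C -> Prop) : compact K -> (forall z, K z -> disc z) ->
  exists r, 0 <= r < 1 /\ forall z, K z -> Cmod z <= r.
Proof.
  intros Hc HK.
  destruct (Hc nat (fun n z => Cmod z < radius n)) as [l Hl].
  - intros n z Hz. apply locally_C_iff. exists (radius n - Cmod z). split; [lra |].
    intros w Hw. pose proof (Cmod_triangle_rev w z). lra.
  - intros z Hz. specialize (HK z Hz). unfold disc in HK.
    destruct (INR_unbounded (Cmod z / (1 - Cmod z))) as [n Hn]. exists n.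
    pose proof (pos_INR n). unfold radius.
    apply Rmult_lt_reg_r with (INR n + 1); [lra |].
    replace (INR n / (INR n + 1) * (INR n + 1)) with (INR n) by (field; lra).
    assert (Cmod z / (1 - Cmod z) * (1 - Cmod z) < INR n * (1 - Cmod z))
      by (apply Rmult_lt_compat_r; lra).
    replace (Cmod z / (1 - Cmod z) * (1 - Cmod z)) with (Cmod z) in * by (field; lra). lra.
  - assert (Hm : exists r, 0 <= r < 1 /\ forall n, In n l -> radius n <= r).
    { clear Hl. induction l as [|n l [r [Hr IH]]].
      - exists 0. split; [lra | intros n []].
      - pose proof (radius_bounds n). pose proof (Rmax_l r (radius n)). pose proof (Rmax_r r (radius n)).
        exists (Rmax r (radius n)). split; [split; [lra | apply Rmax_lub_lt; lra] |].
        intros m [<- | Hm]; [assumption |]. specialize (IH m Hm). lra. }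
    destruct Hm as [r [Hr Kr]]. exists r. split; [exact Hr |]. intros z Hz.
    destruct (Hl z Hz) as [n [Hn Hzn]]. specialize (Kr n Hn). lra.
Qed.

Section BlockProduct.

Context (phi1 phi2 : C -> C) (L : nat -> list C) (rad : nat -> R).
Context (HB : block_sequence phi1 phi2 L rad).

Lemma block_prefix (k m : nat) : (k <= m)%nat -> exists l, L m = L k ++ l.
Proof.
  intros H. induction H as [|m _ [l IH]].
  - exists nil. now rewrite app_nil_r.
  - destruct (block_step _ _ _ _ HB m) as [l' [E _]]. exists (l ++ l').
    now rewrite E, IH, app_assoc.
Qed.

Lemma block_length (k : nat) : (k <= length (L k))%nat.
Proof.
  induction k as [|k IH]; [lia |].
  destruct (block_step _ _ _ _ HB k) as [l [E [N _]]]. rewrite E, length_app.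
  destruct l; [now elim N | simpl; lia].
Qed.

Definition block_zero (n : nat) : C := nth n (L (S n)) (RtoC 0).

Lemma block_zero_nth (n k : nat) : (n < length (L k))%nat ->
  block_zero n = nth n (L k) (RtoC 0).
Proof.
  intros H. unfold block_zero. pose proof (block_length (S n)) as H'.
  destruct (Nat.le_ge_cases k (S n)) as [Hk | Hk];
    destruct (block_prefix _ _ Hk) as [l E]; rewrite E, app_nth1; trivial; lia.
Qed.

Lemma block_zero_disc (n : nat) : disc (block_zero n) /\ block_zero n <> RtoC 0.
Proof.
  apply (block_zeros _ _ _ _ HB (S n)). apply nth_In. pose proof (block_length (S n)). lia.
Qed.

Definition partial (N : nat) (z : C) : C := Cprod (fun n => blaschke_factor (block_zero n) z) N.

Lemma partial_block (k : nat) (z : C) : partial (length (L k)) z = bprod (L k) z.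
Proof.
  rewrite <- Cprod_bprod. apply Cprod_ext. intros i Hi. now rewrite (block_zero_nth i k Hi).
Qed.

Lemma partial_bound (N : nat) (z : C) : disc z -> Cmod (partial N z) <= 1.
Proof.
  intros Hz. induction N as [|N IH]; [unfold partial; simpl; rewrite Cmod_1; lra |].
  unfold partial in *. simpl. rewrite Cmod_mult.
  destruct (block_zero_disc N) as [D N0]. rewrite (Cmod_blaschke_factor _ _ N0).
  pose proof (pdist_lt_1 (block_zero N) z D Hz). pose proof (pdist_ge_0 (block_zero N) z).
  pose proof (Cmod_ge_0 (Cprod (fun n => blaschke_factor (block_zero n) z) N)). nra.
Qed.

Lemma partial_cdiff (N : nat) (z : C) : disc z -> cdiff (partial N) z.
Proof.
  intros Hz. induction N as [|N IH]; [apply cdiff_const |].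
  apply (cdiff_mult (partial N) (blaschke_factor (block_zero N)) z IH).
  apply cdiff_blaschke_factor; [apply block_zero_disc | exact Hz].
Qed.

(** This decreasing sequence controls the convergence: it stays above [1/2], and
    so [1 - |a_n|] is at most twice its decrease at the step [n]. *)
Definition weight (N : nat) : R := Cmod (partial N 0).

Lemma weight_S (N : nat) : weight (S N) = weight N * Cmod (block_zero N).
Proof.
  unfold weight, partial. simpl. destruct (block_zero_disc N) as [_ N0].
  rewrite Cmod_mult, (blaschke_factor_0 _ N0), Cmod_RtoC_pos by apply Cmod_ge_0. reflexivity.
Qed.

Lemma weight_decreasing (N M : nat) : (N <= M)%nat -> weight M <= weight N.
Proof.
  intros H. induction H as [|M _ IH]; [lra |]. rewrite weight_S.
  destruct (block_zero_disc M) as [D _]. unfold disc in D.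
  assert (0 <= weight M) by apply Cmod_ge_0. pose proof (Cmod_ge_0 (block_zero M)). nra.
Qed.

(** Block [k] costs at most [tolerance k] at the origin. *)
Lemma weight_lower (N : nat) : 1 / 2 <= weight N.
Proof.
  assert (Hblock : forall k, 1 / 2 + 2 * tolerance k <= weight (length (L k))).
  { intros k. unfold weight. rewrite partial_block. induction k as [|k IH].
    - rewrite (block_start _ _ _ _ HB). simpl. rewrite Cmod_1. unfold tolerance. simpl. lra.
    - destruct (block_step _ _ _ _ HB k) as [l [E [_ K]]]. rewrite E, bprod_app, Cmod_mult.
      pose proof (block_rad _ _ _ _ HB k) as Hr.
      specialize (K 0). rewrite Cmod_0 in K. specialize (K ltac:(lra)).
      pose proof (Cmod_triangle_rev 1 (bprod l 0)) as T. rewrite Cmod_1, Cmod_sub_sym in T.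
      pose proof (bprod_bound (L k) 0 (block_zeros _ _ _ _ HB k) disc_0).
      pose proof (tolerance_pos k). rewrite tolerance_S. nra. }
  pose proof (Hblock N). pose proof (tolerance_pos N).
  pose proof (weight_decreasing _ _ (block_length N)). lra.
Qed.

Lemma block_zero_weight (N : nat) : 1 - Cmod (block_zero N) <= 2 * (weight N - weight (S N)).
Proof.
  rewrite weight_S. pose proof (weight_lower N). destruct (block_zero_disc N) as [D _].
  unfold disc in D. nra.
Qed.

Lemma blaschke_condition : ex_series (fun n => 1 - Cmod (block_zero n)).
Proof.
  assert (Hs : forall N, sum_n (fun n => 1 - Cmod (block_zero n)) N <= 2 * (1 - weight (S N))).
  { induction N as [|N IH].
    - rewrite sum_O. pose proof (block_zero_weight 0) as K.
      replace (weight 0) with 1 in K by (unfold weight, partial; simpl; now rewrite Cmod_1). lra.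
    - rewrite sum_Sn. unfold plus. simpl. pose proof (block_zero_weight (S N)). lra. }
  destruct (ex_finite_lim_seq_incr (sum_n (fun n => 1 - Cmod (block_zero n))) 2) as [l Hl].
  - intros N. rewrite sum_Sn. unfold plus. simpl.
    pose proof (proj1 (block_zero_disc (S N))) as D. unfold disc in D. lra.
  - intros N. specialize (Hs N). pose proof (weight_lower (S N)). lra.
  - exists l. exact Hl.
Qed.

Lemma weight_cauchy (eps : R) : 0 < eps -> exists N, forall n m, (N <= n)%nat -> (n <= m)%nat ->
  weight n - weight m <= eps.
Proof.
  intros He. destruct (ex_finite_lim_seq_decr weight (1 / 2)) as [l Hl].
  - intros n. apply weight_decreasing. lia.
  - apply weight_lower.
  - apply is_lim_seq_spec in Hl. assert (He2 : 0 < eps / 2) by lra.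
    destruct (Hl (mkposreal _ He2)) as [N K]. simpl in K. exists N. intros n m Hn Hm.
    pose proof (K n Hn) as K1. pose proof (K m ltac:(lia)) as K2.
    apply Rabs_def2 in K1. apply Rabs_def2 in K2. lra.
Qed.

Lemma partial_difference (r : R) (z : C) (n m : nat) : r < 1 -> Cmod z <= r -> (n <= m)%nat ->
  Cmod (partial m z - partial n z)%C <= 4 / (1 - r) * (weight n - weight m).
Proof.
  intros Hr Hz H. assert (Dz : disc z) by (unfold disc; lra).
  induction H as [|m _ IH].
  - replace (partial n z - partial n z)%C with (RtoC 0) by ring. rewrite Cmod_0. right. ring.
  - pose proof (Cmod_triangle_mid (partial (S m) z) (partial m z) (partial n z)) as T.
    assert (K : Cmod (partial (S m) z - partial m z)%C
      <= 4 / (1 - r) * (weight m - weight (S m))); [|lra].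
    replace (partial (S m) z - partial m z)%C
      with (partial m z * (blaschke_factor (block_zero m) z - 1))%C
      by (unfold partial; simpl; ring).
    rewrite Cmod_mult. destruct (block_zero_disc m) as [D N0].
    pose proof (blaschke_factor_near_1 _ z D N0 Dz) as Kb.
    pose proof (partial_bound m z Dz). pose proof (Cmod_ge_0 (partial m z)).
    pose proof (Cmod_ge_0 (blaschke_factor (block_zero m) z - 1)%C).
    pose proof (block_zero_weight m) as Kw. unfold disc in D.
    assert (I : / (1 - Cmod z) <= / (1 - r)) by (apply Rinv_le_contravar; lra).
    assert (P : 0 < / (1 - Cmod z)) by (apply Rinv_0_lt_compat; unfold disc in Dz; lra).
    assert (K2 : 2 / (1 - Cmod z) * (1 - Cmod (block_zero m))
      <= 2 * / (1 - r) * (2 * (weight m - weight (S m)))).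
    { apply Rmult_le_compat; unfold Rdiv; lra. }
    unfold Rdiv at 1. nra.
Qed.

Lemma partial_cauchy (r eps : R) : r < 1 -> 0 < eps -> exists N, forall n m z,
  (N <= n)%nat -> (N <= m)%nat -> Cmod z <= r -> Cmod (partial n z - partial m z)%C <= eps.
Proof.
  intros Hr He. destruct (weight_cauchy (eps * (1 - r) / 4)) as [N K].
  { apply Rdiv_lt_0_compat; nra. }
  assert (Hle : forall n m z, (N <= n)%nat -> (n <= m)%nat -> Cmod z <= r ->
    Cmod (partial m z - partial n z)%C <= eps).
  { intros n m z Hn Hm Hz. eapply Rle_trans; [apply (partial_difference r z n m Hr Hz Hm) |].
    apply Rle_trans with (4 / (1 - r) * (eps * (1 - r) / 4)); [|right; field; lra].
    apply Rmult_le_compat_l; [apply Rdiv_le_0_compat; lra |]. now apply K. }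
  exists N. intros n m z Hn Hm Hz. destruct (Nat.le_ge_cases n m) as [H | H].
  - rewrite Cmod_sub_sym. now apply Hle.
  - now apply Hle.
Qed.

Lemma block_limit_exists : exists B : C -> C, forall r eps, r < 1 -> 0 < eps ->
  exists N, forall n z, (N <= n)%nat -> Cmod z <= r -> Cmod (partial n z - B z)%C <= eps.
Proof.
  assert (Hl : forall z, disc z -> exists l, forall eps, 0 < eps -> exists N, forall n,
    (N <= n)%nat -> Cmod (partial n z - l)%C <= eps).
  { intros z Hz. apply (C_complete (fun n => partial n z)). intros eps He.
    destruct (partial_cauchy (Cmod z) eps Hz He) as [N K].
    exists N. intros n m Hn Hm. apply K; trivial. lra. }
  exists (fun z => match excluded_middle_informative (disc z) with
    | left h => proj1_sig (constructive_indefinite_description _ (Hl z h))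
    | right _ => RtoC 0 end).
  intros r eps Hr He. destruct (partial_cauchy r (eps / 2) Hr ltac:(lra)) as [N K].
  exists N. intros n z Hn Hz.
  destruct (excluded_middle_informative (disc z)) as [h | h]; [|elim h; unfold disc; lra].
  destruct (constructive_indefinite_description _ (Hl z h)) as [l El]. simpl.
  destruct (El (eps / 2) ltac:(lra)) as [N' K'].
  specialize (K' (max n N') ltac:(lia)). specialize (K n (max n N') z Hn ltac:(lia) Hz).
  pose proof (Cmod_triangle_mid (partial n z) (partial (max n N') z) l). lra.
Qed.

Lemma block_tail (k m : nat) (w : C) : Cmod w <= rad k ->
  Cmod (bprod (L (m + k)) w - bprod (L k) w)%C <= 2 * (tolerance k - tolerance (m + k)).
Proof.
  intros Hw. pose proof (block_rad _ _ _ _ HB) as Hr.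
  assert (Dw : disc w) by (unfold disc; specialize (Hr k); lra).
  induction m as [|m IH].
  - simpl. replace (bprod (L k) w - bprod (L k) w)%C with (RtoC 0) by ring. rewrite Cmod_0. lra.
  - simpl (S m + k)%nat. destruct (block_step _ _ _ _ HB (m + k)) as [l [E [_ K]]].
    assert (Hmono : rad k <= rad (m + k)).
    { clear - Hr. induction m as [|m IH]; simpl; [lra |]. specialize (Hr (m + k)%nat). lra. }
    specialize (K w ltac:(lra)). rewrite E, bprod_app.
    pose proof (Cmod_triangle_mid (bprod (L (m + k)) w * bprod l w)%C (bprod (L (m + k)) w)
      (bprod (L k) w)) as T.
    replace (bprod (L (m + k)) w * bprod l w - bprod (L (m + k)) w)%C
      with (bprod (L (m + k)) w * (bprod l w - 1))%C in T by ring.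
    rewrite Cmod_mult in T.
    pose proof (bprod_bound _ w (block_zeros _ _ _ _ HB (m + k)) Dw).
    pose proof (Cmod_ge_0 (bprod (L (m + k)) w)). pose proof (Cmod_ge_0 (bprod l w - 1)%C).
    rewrite tolerance_S. nra.
Qed.

Lemma block_product : exists B, blaschke_product B /\ unit_ball B /\
  forall k w, Cmod w <= rad k -> Cmod (B w - bprod (L k) w)%C <= 2 * tolerance k.
Proof.
  destruct block_limit_exists as [B HBl]. exists B. split; [|split; [split|]].
  - right. exists (RtoC 1), 0%nat, block_zero.
    split; [apply Cmod_1 |]. split; [apply block_zero_disc |].
    split; [exact blaschke_condition |]. intros z Hz. apply filterlim_seq_iff.
    intros eps He. destruct (HBl (Cmod z) (eps / 2) Hz ltac:(lra)) as [N K].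
    exists N. intros n Hn. specialize (K n z Hn (Rle_refl _)).
    replace (1 * z ^ 0 * Cprod (fun n0 => blaschke_factor (block_zero n0) z) n)%C
      with (partial n z); [lra |].
    unfold partial. simpl. ring.
  - apply holomorphic_cdiff. apply (weierstrass partial B).
    + intros n z Hz. now apply partial_cdiff.
    + intros r eps Hr He. apply HBl; lra.
  - intros z Hz. apply le_epsilon. intros eps He.
    destruct (HBl (Cmod z) eps Hz He) as [N K]. specialize (K N z (Nat.le_refl N) (Rle_refl _)).
    pose proof (partial_bound N z Hz). pose proof (Cmod_triangle_rev (B z) (partial N z)) as T.
    rewrite Cmod_sub_sym in T. lra.
  - intros k w Hw. apply le_epsilon. intros eps He.
    pose proof (block_rad _ _ _ _ HB k) as Hr.
    destruct (HBl (rad k) eps (proj2 Hr) He) as [N K].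
    pose proof (block_length (N + k)) as Hlen.
    specialize (K (length (L (N + k))) w ltac:(lia) Hw). rewrite partial_block in K.
    pose proof (block_tail k N w Hw) as T. pose proof (tolerance_pos (N + k)).
    pose proof (Cmod_triangle_mid (B w) (bprod (L (N + k)) w) (bprod (L k) w)) as T2.
    rewrite (Cmod_sub_sym (B w) (bprod (L (N + k)) w)) in T2. lra.
Qed.

End BlockProduct.

Lemma target_pair_recurs (i j k0 : nat) : exists k, (k0 <= k)%nat /\
  target_pair k = (target i, target j).
Proof.
  exists (Cantor.to_nat (Cantor.to_nat (i, j), k0)). split.
  - pose proof (Cantor.to_nat_non_decreasing (Cantor.to_nat (i, j)) k0). lia.
  - unfold target_pair. now rewrite !Cantor.cancel_of_to.
Qed.

Lemma tolerance_small (eps : R) : 0 < eps -> exists k0, forall k, (k0 <= k)%nat ->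
  tolerance k <= eps.
Proof.
  intros He. destruct (half_powers_small 1 eps Rlt_0_1 He) as [n Hn]. exists n.
  intros k Hk. unfold tolerance. left. eapply Rle_lt_trans; [|exact Hn].
  unfold Rdiv. rewrite Rmult_1_l. apply Rinv_le_contravar; [apply pow_lt; lra |].
  apply Rle_pow; [lra | lia].
Qed.

Lemma radius_large (r : R) : r < 1 -> exists k0, forall k, (k0 <= k)%nat -> r <= radius k.
Proof.
  intros Hr. destruct (INR_unbounded (Rabs r / (1 - r))) as [n Hn]. exists n.
  intros k Hk. apply le_INR in Hk. pose proof (pos_INR k). unfold radius.
  apply Rmult_le_reg_r with (INR k + 1); [lra |].
  replace (INR k / (INR k + 1) * (INR k + 1)) with (INR k) by (field; lra).
  assert (Rabs r / (1 - r) * (1 - r) <= INR k * (1 - r)) by (apply Rmult_le_compat_r; lra).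
  replace (Rabs r / (1 - r) * (1 - r)) with (Rabs r) in * by (field; lra).
  pose proof (Rle_abs r). lra.
Qed.

Lemma block_sequence_universal (phi1 phi2 : C -> C) (L : nat -> list C) (rad : nat -> R) :
  block_sequence phi1 phi2 L rad ->
  exists B, blaschke_product B /\ disjointly_universal phi1 phi2 B.
Proof.
  intros HB. destruct (block_product phi1 phi2 L rad HB) as [B [Hb [Hu Hc]]].
  exists B. split; [exact Hb |]. split; [exact Hu |].
  intros g1 g2 B1 B2 P [Q1 Q2 [K1 [e1 [Hk1 [Hd1 HQ1]]]] [K2 [e2 [Hk2 [Hd2 HQ2]]]] HP].
  destruct (compact_in_ball K1 Hk1 Hd1) as [r1 [Hr1 Kr1]].
  destruct (compact_in_ball K2 Hk2 Hd2) as [r2 [Hr2 Kr2]].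
  pose proof (cond_pos e1) as He1. pose proof (cond_pos e2) as He2.
  set (e := Rmin e1 e2 / 5).
  assert (He : 0 < e) by (assert (0 < Rmin e1 e2) by (now apply Rmin_pos); unfold e; lra).
  assert (Hee1 : 5 * e <= e1) by (unfold e; pose proof (Rmin_l e1 e2); lra).
  assert (Hee2 : 5 * e <= e2) by (unfold e; pose proof (Rmin_r e1 e2); lra).
  destruct (target_dense g1 r1 e B1 Hr1 He) as [i Hi].
  destruct (target_dense g2 r2 e B2 Hr2 He) as [j Hj].
  destruct (tolerance_small e He) as [m0 Hm0].
  destruct (radius_large r1 (proj2 Hr1)) as [m1 Hm1].
  destruct (radius_large r2 (proj2 Hr2)) as [m2 Hm2].
  destruct (target_pair_recurs i j (max m0 (max m1 m2))) as [k [Hk Ek]].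
  specialize (Hm0 k ltac:(lia)). specialize (Hm1 k ltac:(lia)). specialize (Hm2 k ltac:(lia)).
  destruct (block_hit _ _ _ _ HB k) as [n Hn]. rewrite Ek in Hn. simpl in Hn.
  pose proof (tolerance_S k) as Et. pose proof (tolerance_pos k) as Pt.
  exists (composition_operator (iterate phi1 n) B, composition_operator (iterate phi2 n) B).
  split; [now exists n |]. apply HP.
  - apply HQ1. intros z Hz. specialize (Kr1 z Hz). specialize (Hi z Kr1).
    destruct (proj1 (Hn z ltac:(lra))) as [A1 A2]. specialize (Hc (S k) _ A1).
    unfold composition_operator.
    pose proof (Cmod_triangle_mid (B (iterate phi1 n z)) (bprod (L (S k)) (iterate phi1 n z)) (g1 z)).
    pose proof (Cmod_triangle_mid (bprod (L (S k)) (iterate phi1 n z)) (target i z) (g1 z)). lra.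
  - apply HQ2. intros z Hz. specialize (Kr2 z Hz). specialize (Hj z Kr2).
    destruct (proj2 (Hn z ltac:(lra))) as [A1 A2]. specialize (Hc (S k) _ A1).
    unfold composition_operator.
    pose proof (Cmod_triangle_mid (B (iterate phi2 n z)) (bprod (L (S k)) (iterate phi2 n z)) (g2 z)).
    pose proof (Cmod_triangle_mid (bprod (L (S k)) (iterate phi2 n z)) (target j z) (g2 z)). lra.
Qed.

(** * The characterization *)

Lemma universal_sufficient (phi1 phi2 : C -> C) :
  ~ eq_on_disc phi1 phi2 ->
  parabolic phi1 \/ hyperbolic phi1 -> parabolic phi2 \/ hyperbolic phi2 ->
  (hyperbolic phi1 -> hyperbolic phi2 ->
   (exists a, attractive phi1 a /\ attractive phi2 a) ->
   forall lam1 lam2, is_multiplier phi1 lam1 -> is_multiplier phi2 lam2 -> lam1 <> lam2) ->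
  exists B, blaschke_product B /\ disjointly_universal phi1 phi2 B.
Proof.
  intros Hne T1 T2 Hmult.
  pose proof (type_automorphism phi1 T1) as A1. pose proof (type_automorphism phi2 T2) as A2.
  destruct (attracting_form_of_type phi1 T1) as [p1 [mu1 [tau1 F1]]].
  destruct (attracting_form_of_type phi2 T2) as [p2 [mu2 [tau2 F2]]].
  destruct (automorphism_mobius phi1 A1) as [u1 [a1 M1]].
  destruct (automorphism_mobius phi2 A2) as [u2 [a2 M2]].
  destruct (block_sequence_exists phi1 phi2 u1 a1 u2 a2 M1 M2) as [L [rad HB]].
  - intros T HT. apply (orbits_separate phi1 phi2 p1 p2 mu1 mu2 tau1 tau2 T F1 F2); [|exact HT].
    intros Ep Emu. subst p2 mu2. pose proof F1 as [Hn1 [[Hmu | Hmu] _]].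
    + exfalso. apply (Hmult) with (lam1 := mu1) (lam2 := mu1); trivial.
      * exists p1, (imaginary_point p1 (tau1 / (1 - mu1))). now apply hyperbolic_of_form.
      * exists p1, (imaginary_point p1 (tau2 / (1 - mu1))).
        apply hyperbolic_of_form; [exact A2 | apply F2 | exact Hmu].
      * exists p1. split; [now apply (attractive_of_form phi1 p1 mu1 tau1) |
          now apply (attractive_of_form phi2 p1 mu1 tau2)].
      * now apply (multiplier_of_form phi1 p1 mu1 tau1).
      * apply (multiplier_of_form phi2 p1 mu1 tau2); [exact A2 | apply F2 | exact Hmu].
    + split; [now symmetry |]. intros <-. apply Hne. intros z Hz.
      destruct Hn1 as [Hp [_ E1]]. destruct F2 as [[_ [_ E2]] _].
      destruct (E1 z Hz) as [D1 K1]. destruct (E2 z Hz) as [D2 K2].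
      apply (cayley_inj p1); auto using unit_disc_neq. now rewrite K1, K2.
  - exact (block_sequence_universal phi1 phi2 L rad HB).
Qed.

Theorem corollary3p3 (phi1 phi2 : C -> C)
  (h1 : holomorphic_self_map phi1) (h2 : holomorphic_self_map phi2) :
  (exists B : C -> C, blaschke_product B /\ disjointly_universal phi1 phi2 B)
  <->
  (~ eq_on_disc phi1 phi2 /\
   (parabolic phi1 \/ hyperbolic phi1) /\
   (parabolic phi2 \/ hyperbolic phi2) /\
   (hyperbolic phi1 -> hyperbolic phi2 ->
    (exists a : C, attractive phi1 a /\ attractive phi2 a) ->
    forall lambda1 lambda2 : R,
      is_multiplier phi1 lambda1 -> is_multiplier phi2 lambda2 ->
      lambda1 <> lambda2)).
Proof.
  split.
  - intros [B [_ HB]].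
    destruct (universal_necessary phi1 phi2 B h1 h2 HB) as [N1 [N2 [N3 N4]]].
    repeat split; auto.
  - intros [N1 [N2 [N3 N4]]]. now apply universal_sufficient.
Qed.
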